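(* Let $M$ be a two-dimensional Riemannian manifold with Riemannian distance $d$, let $\varphi: M\to M$ be a $C^2$ diffeomorphism, and let $p\in M$ be a hyperbolic fixed point of $\varphi$ such that $D\varphi_p$ has eigenvalues $\lambda_s,\lambda_u$ with $0<|\lambda_s|<1<|\lambda_u|$. Then there exists a constant $\eta>0$ such that the following properties hold: (1) $W^s_\eta(p)$ is a $C^{1+\mathrm{Lip}}$ one-dimensional submanifold of $M$ (with endpoints), tangent at $p$ to $E^s_p$; (2) $W^s_\eta(p)$ has length at least $\eta$ on either side of $p$; (3) $W^s_\eta(p)$ contracts at an exponential rate: there exist $C>0$ and $\lambda\in(0,1)$ such that $d(\varphi^k(x),\varphi^k(y))\le C\lambda^k d(x,y)$ for all $x,y\in W^s_\eta(p)$ and all $k\ge 0$; (4) $W^s_\eta(p)=\bigcap_{k\ge 0}\mathcal N^{(k)}_\eta(p)$.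
   Context: The fixed point $p$ is hyperbolic if $D\varphi_p$ has no eigenvalue on the unit circle. $E^s_p\subset T_pM$ is the eigenspace of $D\varphi_p$ for the eigenvalue $\lambda_s$. The global stable set of $p$ is $W^s(p)=\{x\in M: d(\varphi^k(x),p)\to 0 \text{ as } k\to\infty\}$. For $\eta>0$ and $k\ge1$, $\mathcal N^{(k)}_\eta(p)=\{x\in M: d(\varphi^j(x),p)\le\eta \text{ for all } 0\le j\le k-1\}$ (for $k=0$ the condition is empty, so $\mathcal N^{(0)}_\eta(p)=M$), and $\mathcal N^{(\infty)}_\eta(p)=\bigcap_{k\ge1}\mathcal N^{(k)}_\eta(p)$. The local stable set of $p$ is $W^s_\eta(p)=W^s(p)\cap\mathcal N^{(\infty)}_\eta(p)$. $C^{1+\mathrm{Lip}}$ means $C^1$ with Lipschitz continuous derivative (tangent direction). *)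

(* Defs.v *)
From HB Require Import structures.
From mathcomp Require Import all_boot all_order all_algebra.
From mathcomp Require Import complex.
From mathcomp Require Import all_classical all_reals all_analysis.
Set Implicit Arguments.
Unset Strict Implicit.
Unset Printing Implicit Defensive.
Import Order.TTheory GRing.Theory Num.Theory.
Import numFieldNormedType.Exports.
Local Open Scope classical_set_scope.
Local Open Scope ring_scope.

(* [f] is of class C^k on [U]. Only meaningful for open [U]; in finite dimension
   it is the usual notion, as f is C^(k+1) iff it is differentiable and all its
   directional derivatives are C^k. *)
Fixpoint Ck (R : realType) (V W : normedModType R) (k : nat) (U : set V)
    (f : V -> W) : Prop :=
  match k with
  | 0%N => forall x, U x -> {for x, continuous f}
  | k'.+1 => (forall x, U x -> differentiable f x) /\
             (forall v : V, Ck k' U ('D_v f))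
  end.

(* A smooth 2-manifold structure on [M]. The maps [chart i] and [chart_inv i] are
   total, and meaningful only on [dom i] and on its image. The function
   [chart_at] chooses a chart around each point; the tangent space at [x] is
   then 'rV[R]_2, read in the chart [chart_at x]. *)
Record surface (R : realType) (M : topologicalType) := Surface {
  idx : Type;
  dom : idx -> set M;
  chart : idx -> M -> 'rV[R]_2;
  chart_inv : idx -> 'rV[R]_2 -> M;
  chart_at : M -> idx;
  _ : hausdorff_space M;
  _ : @second_countable M;
  _ : forall x, dom (chart_at x) x;
  _ : forall i, open (dom i);
  _ : forall i, open (chart i @` dom i);
  _ : forall i x, dom i x -> chart_inv i (chart i x) = x;
  _ : forall i x, dom i x -> {for x, continuous (chart i)};
  _ : forall i z, (chart i @` dom i) z -> {for z, continuous (chart_inv i)};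
  _ : forall i j k,
        Ck k (chart i @` (dom i `&` dom j)) (chart j \o chart_inv i)
}.

(* A smooth Riemannian metric, given by its Gram matrix in each chart; tangent
   vectors are row vectors, so they are transported by right multiplication by
   the Jacobian of the change of charts. *)
Record riemannian_metric (R : realType) (M : topologicalType)
    (S : surface R M) := RiemannianMetric {
  gram : idx S -> 'rV[R]_2 -> 'M[R]_2;
  _ : forall i k, Ck k (chart i @` dom i) (gram i);
  _ : forall i x, dom i x -> (gram i (chart i x))^T = gram i (chart i x);
  _ : forall i x, dom i x -> forall v : 'rV[R]_2, v != 0 ->
        0 < (v *m gram i (chart i x) *m v^T) 0 0;
  _ : forall i j x, dom i x -> dom j x ->
        let J := jacobian (chart j \o chart_inv i) (chart i x) in
        gram i (chart i x) = J *m gram j (chart j x) *m J^T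
}.

Section Maps.
Context (R : realType) (M : topologicalType) (S : surface R M).

Definition Ck_map (k : nat) (f : M -> M) : Prop :=
  continuous f /\
  forall i j : idx S,
    Ck k (chart i @` (dom i `&` f @^-1` dom j))
         (chart j \o f \o chart_inv i).

Definition Ck_diffeomorphism (k : nat) (f : M -> M) : Prop :=
  exists f' : M -> M, [/\ cancel f f', cancel f' f, Ck_map k f & Ck_map k f'].

(* The differential T_xM -> T_(f x)M; it acts on row vectors on the right. *)
Definition tangent_map (f : M -> M) (x : M) : 'M[R]_2 :=
  jacobian (chart (chart_at S (f x)) \o f \o chart_inv (chart_at S x))
           (chart (chart_at S x) x).

Definition hyperbolic_fixed_point (f : M -> M) (p : M) : Prop :=
  f p = p /\
  forall z : R[i], eigenvalue (map_mx (real_complex R) (tangent_map f p)) z ->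
    `|z| != 1.

End Maps.

Section Curves.
Context (R : realType) (M : topologicalType) (S : surface R M).

Definition C1_curve (U : set R) (c : R -> M) : Prop :=
  (forall t, U t -> {for t, continuous c}) /\
  forall i : idx S, Ck 1 ((U `&` c @^-1` dom i) : set R^o)
                         (chart i \o c : R^o -> 'rV[R]_2).

(* Locally Lipschitz derivative in charts: on a compact arc this is the same as
   Lipschitz, and it does not depend on the charts. *)
Definition C1Lip_curve (U : set R) (c : R -> M) : Prop :=
  C1_curve U c /\
  forall (i : idx S) (t : R), U t -> dom i (c t) ->
    \forall e \near (0 : R)^'+,
      [lipschitz (derive1 (chart i \o c) : R^o -> 'rV[R]_2) s
        | s in ball (t : R^o) e].

(* The velocity vector at time [t], an element of T_(c t)M. *)
Definition velocity (c : R -> M) (t : R) : 'rV[R]_2 :=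
  derive1 (chart (chart_at S (c t)) \o c) t.

(* C^1 on [a, b] with one-sided derivatives at the ends, expressed as the
   existence of a C^1 extension to a neighbourhood of [a, b]. *)
Definition C1_segment (c : R -> M) (a b : R) : Prop :=
  a < b /\
  exists (U : set R) (c' : R -> M),
    [/\ open U, `[a, b]%classic `<=` U, C1_curve U c' &
        forall t, t \in `[a, b] -> c t = c' t].

Inductive piecewise_C1 (c : R -> M) : R -> R -> Prop :=
| piecewise_C1_segment a b : C1_segment c a b -> piecewise_C1 c a b
| piecewise_C1_cat a b e :
    piecewise_C1 c a b -> piecewise_C1 c b e -> piecewise_C1 c a e.

(* An embedded compact C^{1+Lip} arc, i.e. a one-dimensional C^{1+Lip}
   submanifold with two endpoints c(a), c(b): an injective regular
   parametrization that is C^{1+Lip} up to (and slightly beyond) the ends. *)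
Definition C1Lip_arc (c : R -> M) (a b : R) : Prop :=
  [/\ a < b,
      exists U : set R,
        [/\ open U, `[a, b]%classic `<=` U & C1Lip_curve U c],
      (forall t, t \in `[a, b] -> velocity c t != 0) &
      {in `[a, b] &, injective c}].

End Curves.

Section Distance.
Context (R : realType) (M : topologicalType) (S : surface R M).
Context (g : riemannian_metric S).

Definition speed (c : R -> M) (t : R) : R :=
  let i := chart_at S (c t) in
  let v := velocity S c t in
  Num.sqrt ((v *m gram g i (chart i (c t)) *m v^T) 0 0).

(* The integrand is junk at the finitely many break points of a piecewise C^1
   curve, which does not affect the integral. *)
Definition curve_length (c : R -> M) (a b : R) : \bar R :=
  (\int[@lebesgue_measure R]_(t in `[a, b]) (speed c t)%:E)%E.

(* Extended-real valued: +oo between distinct connected components, a finite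
   distance when M is connected. *)
Definition riemannian_dist (x y : M) : \bar R :=
  ereal_inf [set l : \bar R | exists (c : R -> M) (a b : R),
    [/\ piecewise_C1 S c a b, c a = x, c b = y & l = curve_length c a b]].

End Distance.

Section StableSets.
Context (R : realType) (M : topologicalType) (S : surface R M).
Context (g : riemannian_metric S) (phi : M -> M) (p : M).

Definition global_stable_set : set M :=
  [set x | (fun k : nat => riemannian_dist g (iter k phi x) p) @ \oo --> 0%E].

Definition orbit_nbhd (eta : R) (k : nat) : set M :=
  [set x | forall j : nat, (j < k)%N ->
           (riemannian_dist g (iter j phi x) p <= eta%:E)%E].

Definition orbit_nbhd_inf (eta : R) : set M :=
  \bigcap_(k in [set k : nat | (1 <= k)%N]) orbit_nbhd eta k.

Definition local_stable_set (eta : R) : set M :=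
  global_stable_set `&` orbit_nbhd_inf eta.

End StableSets.

(* Main.v *)
Require Import Defs.
From HB Require Import structures.
From mathcomp Require Import all_boot all_order all_algebra.
From mathcomp Require Import ring lra.
From mathcomp Require Import all_classical all_reals all_analysis.
From mathcomp Require Import measurable_realfun.
Set Implicit Arguments.
Unset Strict Implicit.
Unset Printing Implicit Defensive.
Import Order.TTheory GRing.Theory Num.Theory.
Import numFieldNormedType.Exports.
Local Open Scope classical_set_scope.
Local Open Scope ring_scope.

(* In linear coordinates along the eigenlines of the differential at p, phi is a small Lipschitz
   perturbation of the linear saddle. The points whose whole forward orbit stays in a small box
   form a Lipschitz graph y = sg x: the point above x is a limit of points whose n-th iterate lies
   on the axis y = 0, and two such points above the same x would separate exponentially. Cross
   differences of three points of the graph are expanded by phi while their second order errors are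
   contracted, which gives |sg x' - sg x - m x (x' - x)| <= C (x' - x)^2, i.e. C^{1+Lip}.

   Near p the Riemannian distance d is comparable to the distance in the chart. For c, the
   parametrization by x of the graph, to reach distance eta from p exactly at its endpoints,
   t |-> d(c(t), p) has to be monotone on each side of p. Pushing almost minimal curves that end at
   p forward by a linear map close to mu * id that sends c(t) to c(mu t) gives
   d(c(mu t), p) <= (|mu| + C |t| |1 - mu|) d(c(t), p), which is < d(c(t), p) for 0 <= mu < 1 and
   small t. The points whose orbit stays eta-close to p therefore form an arc c([a, b]) with
   d(c(a), p) = d(c(b), p) = eta, so both halves have length at least eta. *)

(** [phi] multiplies a cross difference, which is a determinant, by about |ls lu|, and this need not
    exceed 1. What counts is |ls lu| > lam^2 with lam close to |ls|: the cross difference and its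
    error are both bounded by multiples of lam^(2n). The inequality follows from |ls| < 1 < |lu|, so
    no further condition on the eigenvalues arises. The resulting bound is cubic in the horizontal
    differences; divided by two of them, it controls the difference quotients at a point before any
    derivative is known to exist.

    The stable set is cut out by d and not by a box in the chart, and d(., p) is treated purely as
    an infimum of lengths, with no geodesic and no derivative of d. Pushing curves compares d at
    c(t) and at c(mu t) directly. The factor |1 - mu| in the error keeps the comparison sharp as mu
    tends to 1, as strict monotonicity requires. *)

Section RealFacts.
Context {R : realType}.
Implicit Types (x y e : R).

Lemma nonpos_of_bounded_geometric (mu a b : R) :
  1 < mu -> (forall n : nat, mu ^+ n * a <= b) -> a <= 0.
Proof.
move=> mu1 H; rewrite leNgt; apply/negP => a0.
have [n] : exists n : nat, b / a + 1 < n%:R.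
  by exists (Num.trunc (b / a + 1)).+1; exact: truncnS_gt.
move=> hn.
have hmu : n%:R * (mu - 1) <= mu ^+ n - 1.
  elim: n {hn} => [|n IH]; first by rewrite mul0r expr0 subrr.
  have m1 : 1 <= mu ^+ n by rewrite exprn_ege1 // ltW.
  by rewrite exprS -natr1; nra.
have mu1' : 0 < mu - 1 by rewrite subr_gt0.
pose N := (Num.trunc (b / a / (mu - 1))).+1.
have hN : b / a / (mu - 1) < N%:R by exact: truncnS_gt.
have hmuN : N%:R * (mu - 1) <= mu ^+ N - 1.
  elim: N {hN} => [|k IH]; first by rewrite mul0r expr0 subrr.
  have m1 : 1 <= mu ^+ k by rewrite exprn_ege1 // ltW.
  by rewrite exprS -natr1; nra.
move: hN; rewrite ltr_pdivrMr // ltr_pdivrMr // => hN.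
have := H N; nra.
Qed.

Lemma geometric_lt_eps (q a e : R) : 0 <= q -> q < 1 -> 0 < e ->
  exists n : nat, forall k, (n <= k)%N -> a * q ^+ k < e.
Proof.
move=> q0 q1 e0.
have /cvgrPdist_lt /(_ _ e0) [n _ Hn] : (fun k : nat => a * q ^+ k) @ \oo --> (0:R).
  rewrite -[X in _ --> X](mulr0 a); apply: cvgMr; apply: cvg_expr.
  by rewrite ger0_norm.
exists n => k nk; have := Hn k nk; rewrite sub0r normrN.
exact/le_lt_trans/ler_norm.
Qed.

(** Helly's theorem on the line: closed intervals that meet pairwise share a point, the supremum of
    their left ends. It yields the height of the stable point above x and, later, the slope of the
    graph, with no passage to a limit. *)
Lemma exists_common_approx (I : Type) (i0 : I) (P : I -> Prop) (A e : I -> R) :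
  P i0 -> (forall i j, P i -> P j -> A i - e i <= A j + e j) ->
  exists m, forall i, P i -> `|A i - m| <= e i.
Proof.
move=> Pi0 H.
pose E := [set A i - e i | i in [set i | P i]].
have E0 : E !=set0 by exists (A i0 - e i0), i0.
have ubE j : P j -> ubound E (A j + e j).
  by move=> Pj _ [i Pi <-]; apply: H.
exists (sup E) => i Pi; rewrite ler_distlC.
have s1 : A i - e i <= sup E.
  by apply: sup_upper_bound; [split=> //; exists (A i0 + e i0); exact: ubE | exists i].
have s2 : sup E <= A i + e i by apply: ge_sup => //; exact: ubE.
by apply/andP; split.
Qed.

(** The quantity [v n] below satisfies rho * v n <= v n.+1. Were [v 0] positive, it would grow like
    rho^n, against the bound kap^n * B on [u]. The lemma serves with kap = lam^2 for cross
    differences and with kap = 1 for the tangency at the origin. *)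
Lemma expanding_recursion_bound (kap rho T B : R) (u : nat -> R) :
  0 < kap -> kap < rho -> 0 <= T ->
  (forall n, rho * u n - kap ^+ n * T <= u n.+1) ->
  (forall n, u n <= kap ^+ n * B) -> (rho - kap) * u 0%N <= T.
Proof.
move=> kap0 kr T0 Hu HB; rewrite -subr_le0.
pose v n := (rho - kap) * u n - kap ^+ n * T.
have Hv n : rho ^+ n * v 0%N <= v n.
  elim: n => [|n IH]; first by rewrite expr0 mul1r.
  have h1 : rho * v n <= v n.+1.
    have := ler_wpM2l (ltW (_ : 0 < rho - kap)) (Hu n); rewrite subr_gt0 => /(_ kr).
    by rewrite /v exprS; lra.
  apply: le_trans h1; rewrite exprS -mulrA ler_wpM2l //.
  exact: ltW (lt_trans kap0 kr).
have -> : (rho - kap) * u 0%N - T = v 0%N by rewrite /v expr0 mul1r.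
apply: (@nonpos_of_bounded_geometric (rho / kap) _ ((rho - kap) * B)).
  by rewrite ltr_pdivlMr // mul1r.
move=> n; rewrite exprMn exprVn mulrAC ler_pdivrMr ?exprn_gt0 //.
apply: le_trans (Hv n) _; rewrite /v.
have := ler_wpM2l (ltW (_ : 0 < rho - kap)) (HB n); rewrite subr_gt0 => /(_ kr).
have : 0 <= kap ^+ n * T by rewrite mulr_ge0 ?exprn_ge0 // ltW.
lra.
Qed.

Lemma lipschitz_within_continuous (C a b : R) (h : R -> R) :
  (forall x y, a <= x <= b -> a <= y <= b -> `|h x - h y| <= C * `|x - y|) ->
  {within `[a, b], continuous h}.
Proof.
move=> H; apply/subspace_continuousP => x /= xab.
apply/cvgrPdist_lt => e e0.
pose C' := `|C| + 1.
have C0 : 0 < C' by rewrite /C' ltr_wpDl.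
near=> y.
have yab : y \in `[a, b] by near: y; exact: withinT.
have xy : `|x - y| < e / C'.
  near: y; apply: cvg_within; apply/nbhs_ballP; exists (e / C') => //=; exact: divr_gt0.
apply: (le_lt_trans (H _ _ _ _)) => //.
  have : C * `|x - y| <= C' * `|x - y|.
    by rewrite ler_wpM2r // /C'; have := ler_norm C; lra.
  move: xy; rewrite ltr_pdivlMr // => xy; lra.
Unshelve. all: by end_near.
Qed.

End RealFacts.

(** * The stable graph of a perturbed linear saddle *)

Section SaddleDynamics.
Context {R : realType}.
Variables (F : R * R -> R * R) (ls lu r eps lam mu : R).

Definition box (z : R * R) := `|z.1| <= r /\ `|z.2| <= r.

Definition stays (n : nat) (z : R * R) := forall k, (k <= n)%N -> box (iter k F z).

Definition stable (z : R * R) := forall k, box (iter k F z).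

Hypothesis r_gt0 : 0 < r.
Hypothesis eps_ge0 : 0 <= eps.
Hypothesis lam_ge : `|ls| + eps <= lam.
Hypothesis lam_lt1 : lam < 1.
Hypothesis mu_le : mu <= `|lu| - eps.
Hypothesis mu_gt1 : 1 < mu.
Hypothesis F0 : F (0, 0) = (0, 0).
(* [e] plays the role of the sup norm of [z' - z]. *)
Hypothesis F_lin : forall z z' (e : R), box z -> box z' ->
  `|z'.1 - z.1| <= e -> `|z'.2 - z.2| <= e ->
  `|(F z').1 - (F z).1 - ls * (z'.1 - z.1)| <= eps * e /\
  `|(F z').2 - (F z).2 - lu * (z'.2 - z.2)| <= eps * e.

Ltac slra := move: r_gt0 eps_ge0 lam_ge lam_lt1 mu_le mu_gt1; lra.

Let lam_ge0 : 0 <= lam.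
Proof. by apply: le_trans lam_ge; rewrite addr_ge0. Qed.

Let box0 : box (0, 0).
Proof. by split; rewrite normr0 ltW. Qed.

Let norm_split (a b c : R) : `|a| <= `|a - b * c| + `|b| * `|c|.
Proof. by rewrite -normrM -{1}(subrK (b * c) a) ler_normD. Qed.

Lemma saddle_contract z z' e : box z -> box z' ->
  `|z'.1 - z.1| <= e -> `|z'.2 - z.2| <= e -> `|(F z').1 - (F z).1| <= lam * e.
Proof.
move=> bz bz' h1 h2; have [+ _] := F_lin bz bz' h1 h2.
have := norm_split ((F z').1 - (F z).1) ls (z'.1 - z.1).
have e0 : 0 <= e by exact: le_trans h1.
have : `|ls| * `|z'.1 - z.1| <= `|ls| * e by rewrite ler_wpM2l.
have : (`|ls| + eps) * e <= lam * e by rewrite ler_wpM2r.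
slra.
Qed.

Lemma saddle_expand z z' : box z -> box z' -> `|z'.1 - z.1| <= `|z'.2 - z.2| ->
  mu * `|z'.2 - z.2| <= `|(F z').2 - (F z).2|.
Proof.
move=> bz bz' h; have [_ H] := F_lin bz bz' h (lexx _).
have h2 := ler_normB ((F z').2 - (F z).2) ((F z').2 - (F z).2 - lu * (z'.2 - z.2)).
move: h2; rewrite opprB addrCA subrr addr0 normrM => h2.
have : mu * `|z'.2 - z.2| <= (`|lu| - eps) * `|z'.2 - z.2| by rewrite ler_wpM2r.
slra.
Qed.

Lemma saddle_lipschitz z z' e : box z -> box z' ->
  `|z'.1 - z.1| <= e -> `|z'.2 - z.2| <= e ->
  `|(F z').2 - (F z).2| <= (`|lu| + eps) * e.
Proof.
move=> bz bz' h1 h2; have [_ +] := F_lin bz bz' h1 h2.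
have := norm_split ((F z').2 - (F z).2) lu (z'.2 - z.2).
have : `|lu| * `|z'.2 - z.2| <= `|lu| * e by rewrite ler_wpM2l.
slra.
Qed.

Lemma stays_le m n z : (m <= n)%N -> stays n z -> stays m z.
Proof. by move=> mn H k km; apply: H; exact: leq_trans mn. Qed.

Lemma stable_iter n z : stable z -> stable (iter n F z).
Proof. by move=> H k; rewrite -iterD; exact: H. Qed.

Lemma stays_S n z : box z -> stays n (F z) -> stays n.+1 z.
Proof.
move=> bz H [|k] kn //=.
by rewrite -iterS iterSr; apply: H.
Qed.

(** The vertical cone is invariant: the new horizontal difference is at most lam times the vertical
    one, the new vertical difference at least mu times it, and lam < 1 < mu. *)
Lemma cone_growth n z z' : stays n z -> stays n z' ->
  `|z'.1 - z.1| <= `|z'.2 - z.2| ->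
  `|(iter n F z').1 - (iter n F z).1| <= `|(iter n F z').2 - (iter n F z).2| /\
  mu ^+ n * `|z'.2 - z.2| <= `|(iter n F z').2 - (iter n F z).2|.
Proof.
move=> + + h; elim: n => [|n IH] H H'; first by rewrite expr0 mul1r.
have [h1 h2] := IH (stays_le (leqnSn n) H) (stays_le (leqnSn n) H').
have b := H n (leqnSn n); have b' := H' n (leqnSn n).
have e := saddle_expand b b' h1.
have c := saddle_contract b b' h1 (lexx _).
rewrite !iterS; split.
  apply: le_trans c _; apply: le_trans _ e; rewrite ler_wpM2r //.
  by rewrite ltW // (lt_trans lam_lt1).
apply: le_trans _ e; rewrite exprS -mulrA; apply: ler_wpM2l h2.
by rewrite ltW // (lt_trans ltr01).
Qed.

Lemma box_dist z z' : box z -> box z' -> `|z'.2 - z.2| <= 2 * r.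
Proof.
move=> [_ h] [_ h']; apply: le_trans (ler_normB _ _) _; slra.
Qed.

(** In the vertical cone the height difference would grow like mu^n, yet inside the box it never
    exceeds 2r. This gives both the uniqueness of the point above x and the Lipschitz constant 1 of
    the graph. *)
Lemma stable_cone_eq z z' : stable z -> stable z' ->
  `|z'.1 - z.1| <= `|z'.2 - z.2| -> z' = z.
Proof.
move=> H H' h.
have e2 : `|z'.2 - z.2| <= 0.
  apply: (nonpos_of_bounded_geometric (mu := mu) (b := 2 * r)) => // n.
  have [_ h2] := cone_growth (n := n) (fun k _ => H k) (fun k _ => H' k) h.
  exact: le_trans h2 (box_dist (H n) (H' n)).
have e1 := le_trans h e2.
move: e1 e2; rewrite !normr_le0 !subr_eq0 => /eqP e1 /eqP e2.
by case: z z' {H H' h} e1 e2 => [? ?] [? ?] /= -> ->.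
Qed.

Lemma stable_graph_lipschitz z z' : stable z -> stable z' ->
  `|z'.2 - z.2| <= `|z'.1 - z.1|.
Proof.
move=> H H'; rewrite leNgt; apply/negP => h.
have E := stable_cone_eq H H' (ltW h).
by move: h; rewrite E !subrr ltxx.
Qed.

Lemma stable_contracts n z z' : stable z -> stable z' ->
  `|(iter n F z').1 - (iter n F z).1| <= lam ^+ n * `|z'.1 - z.1|.
Proof.
move=> H H'; elim: n => [|n IH]; first by rewrite mul1r.
have g := stable_graph_lipschitz (stable_iter n H) (stable_iter n H').
have c := saddle_contract (H n) (H' n) (lexx _) g.
by rewrite exprS -mulrA !iterS; apply: le_trans c _; rewrite ler_wpM2l.
Qed.

Lemma stable0 : stable (0, 0).
Proof. by elim=> [//|n IH]; rewrite iterSr F0. Qed.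

(* The n-th graph transform of the horizontal axis, constructed pointwise. *)
Lemma hit_axis n : exists s : R -> R, forall x, `|x| <= r ->
  stays n (x, s x) /\ (iter n F (x, s x)).2 = 0.
Proof.
elim: n => [|n [s IH]].
  exists (fun=> 0) => x xr; split => // k; rewrite leqn0 => /eqP -> /=.
  by split; rewrite //= normr0 ltW.
have sr x : `|x| <= r -> `|s x| <= r by move=> /IH [/(_ 0%N (leq0n _)) []].
(* Two points violating this would lie in the vertical cone, so their n-th iterates would have
   different heights; both heights are 0. *)
have slip x x' : `|x| <= r -> `|x'| <= r -> `|s x' - s x| <= `|x' - x|.
  move=> xr xr'; rewrite leNgt; apply/negP => h.
  have [H1 H2] := IH _ xr; have [H1' H2'] := IH _ xr'.
  have [_] := cone_growth H1 H1' (ltW h).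
  rewrite H2 H2' subrr normr0 leNgt mulr_gt0 //.
    by rewrite exprn_gt0 // (lt_trans ltr01).
  exact: le_lt_trans h.
suff H x : `|x| <= r -> exists y, stays n.+1 (x, y) /\ (iter n.+1 F (x, y)).2 = 0.
  have H' x : exists y, `|x| <= r ->
      stays n.+1 (x, y) /\ (iter n.+1 F (x, y)).2 = 0.
    by have [/H[y]|] := pselect (`|x| <= r); [exists y | exists 0].
  by have [s' Hs'] := choice H'; exists s'.
(* A zero of [h] is a height y for which F (x, y) lies on the graph of [s]; it comes from the
   intermediate value theorem. *)
move=> xr; pose h y := (F (x, y)).2 - s (F (x, y)).1.
have bx y : `|y| <= r -> box (x, y) by [].
have F1 z : box z -> `|(F z).1| <= r.
  move=> bz; have [b1 b2] := bz.
  have := saddle_contract (z := (0, 0)) (z' := z) (e := r) box0 bz.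
  rewrite F0 /= !subr0 => /(_ b1 b2); have : lam * r <= r by rewrite ger_pMl // ltW.
  slra.
have hc : {within `[- r, r], continuous h}.
  apply: (@lipschitz_within_continuous R (`|lu| + eps + lam)) => y y'.
  rewrite -!ler_norml => yr yr'.
  have e1 : `|(x, y).1 - (x, y').1| <= `|y - y'| by rewrite subrr normr0.
  have q1 := saddle_contract (bx _ yr') (bx _ yr) e1 (lexx _).
  have q2 := saddle_lipschitz (bx _ yr') (bx _ yr) e1 (lexx _).
  have q3 := slip _ _ (F1 _ (bx _ yr')) (F1 _ (bx _ yr)).
  have -> : h y - h y' = ((F (x, y)).2 - (F (x, y')).2)
     - (s (F (x, y)).1 - s (F (x, y')).1) by rewrite /h; slra.
  apply: le_trans (ler_normB _ _) _; move: q1 q2 q3; rewrite /=; slra.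
(* On the top and bottom edges the height of the image is at least |lu| r - eps r >= r in absolute
   value, which dominates [s]; so [h] has the sign of lu * y there, and opposite signs at r and
   -r. *)
have hr y : `|y| = r -> 0 <= lu * y * h y.
  move=> yr; have by_ : box (x, y) by apply: bx; rewrite yr.
  have := F_lin (e := r) box0 by_.
  rewrite F0 /= !subr0 => H; have {H} := H xr; rewrite yr lexx => /(_ isT) [_].
  rewrite ler_norml => /andP[H1 H2].
  have := sr _ (F1 _ by_); rewrite ler_norml => /andP[H3 H4].
  have luy : `|lu * y| = `|lu| * r by rewrite normrM yr.
  have key : (1 + eps) * r <= `|lu| * r.
    by apply: ler_wpM2r; [exact: ltW | move: mu_le mu_gt1; lra].
  rewrite /h; case: (ler0P (lu * y)) luy => [l0|l0] luy.
    rewrite mulr_le0 //; slra.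
  rewrite mulr_ge0 //; first exact: ltW.
  slra.
have hr1 := hr r (ger0_norm (ltW r_gt0)).
have hr2 := hr (- r); rewrite normrN (ger0_norm (ltW r_gt0)) in hr2.
have {}hr2 := hr2 erefl.
have [||c cr hc0] := @IVT R h (- r) r 0 _ hc.
- slra.
- have lu0 : lu != 0 by apply/eqP => lu0; move: mu_le mu_gt1; rewrite lu0 normr0; slra.
  rewrite ge_min le_max; case: (ltrgt0P lu) lu0 => // l0 _.
    have -> : 0 <= h r by rewrite -(pmulr_rge0 _ (mulr_gt0 l0 r_gt0)).
    have -> : h (- r) <= 0.
      by rewrite -oppr_ge0 -(pmulr_rge0 _ (mulr_gt0 l0 r_gt0)); slra.
    by rewrite orbT.
  have -> : 0 <= h (- r).
    by rewrite -(pmulr_rge0 _ (mulr_gt0 (_ : 0 < - lu) r_gt0)) ?oppr_gt0 //; slra.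
  have -> : h r <= 0.
    rewrite -oppr_ge0 -(pmulr_rge0 _ (mulr_gt0 (_ : 0 < - lu) r_gt0)) ?oppr_gt0 //; slra.
  by rewrite orbT.
exists c; move: cr; rewrite in_itv /= -ler_norml => cr.
have [I1 I2] := IH _ (F1 _ (bx _ cr)).
have E : F (x, c) = ((F (x, c)).1, s (F (x, c)).1).
  move/eqP: hc0; rewrite /h subr_eq0 => /eqP <-; by case: (F _).
split; first by apply: stays_S; [exact: bx | rewrite E].
by rewrite -iterS iterSr E.
Qed.

Lemma exists_stable x : `|x| <= r -> exists y, stable (x, y).
Proof.
move=> xr; have /choice[s Hs] := hit_axis.
have {}Hs n := Hs n x xr.
(* Both points stay in the box up to time m, where their initial height difference has been
   multiplied by mu^m and is still at most 2r. *)
have cauchy m n : (m <= n)%N -> `|s n x - s m x| <= 2 * r * mu^-1 ^+ m.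
  move=> mn; have [H _] := Hs m; have [H' _] := Hs n.
  have := cone_growth (n := m) H (stays_le mn H').
  rewrite /= subrr normr0 => /(_ (normr_ge0 _)) [_].
  have mum : 0 < mu ^+ m by rewrite exprn_gt0 // (lt_trans ltr01).
  rewrite exprVn ler_pdivlMr // mulrC => /le_trans; apply.
  exact: box_dist (H m (leqnn m)) (H' m mn).
have [] := @exists_common_approx R nat 0%N (fun=> True) (fun n => s n x)
  (fun n => 2 * r * mu^-1 ^+ n) I.
  move=> m n _ _; have p k : 0 <= 2 * r * mu^-1 ^+ k.
    by rewrite mulr_ge0 ?mulr_ge0 ?exprn_ge0 ?invr_ge0 // ltW // (lt_trans ltr01).
  have := p m; have := p n.
  have [/cauchy|/ltnW/cauchy] := leqP m n; rewrite ler_norml => /andP[]; slra.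
move=> y Hy; exists y => k.
pose La := `|lu| + eps + lam.
have La0 : 0 <= La by rewrite /La !addr_ge0.
have small j e : 0 < e -> exists n, (k <= n)%N /\ La ^+ j * `|s n x - y| < e.
  move=> e0; have [||n Hn] := @geometric_lt_eps R mu^-1 (La ^+ j * (2 * r)) e _ _ e0.
  - by rewrite invr_ge0 ltW // (lt_trans ltr01).
  - by rewrite invf_lt1 // (lt_trans ltr01).
  exists (maxn k n); split; first exact: leq_maxl.
  apply: le_lt_trans (Hn _ (leq_maxr k n)).
  by rewrite -mulrA ler_wpM2l ?exprn_ge0 //; exact: Hy.
(* [F] is controlled only inside the box, so one induction on j proves two things together: the
   approximating orbits converge to the orbit of (x, y) at time j, and that orbit is still in the
   closed box. [La] is a Lipschitz constant of [F] in the sup norm. *)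
pose D j n := `|(iter j F (x, s n x)).1 - (iter j F (x, y)).1| <= La ^+ j * `|s n x - y| /\
    `|(iter j F (x, s n x)).2 - (iter j F (x, y)).2| <= La ^+ j * `|s n x - y|.
have inbox j : (j <= k)%N -> (forall n, (k <= n)%N -> D j n) -> box (iter j F (x, y)).
  move=> jk HD; split; apply/ler_addgt0Pr => e /(small j)[n [kn he]];
    have [d1 d2] := HD n kn; have [b1 b2] := (Hs n).1 j (leq_trans jk kn).
    have := ler_normB (iter j F (x, s n x)).1
      ((iter j F (x, s n x)).1 - (iter j F (x, y)).1).
    by rewrite opprB addrCA subrr addr0; slra.
  have := ler_normB (iter j F (x, s n x)).2
    ((iter j F (x, s n x)).2 - (iter j F (x, y)).2).
  by rewrite opprB addrCA subrr addr0; slra.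
suff HD j : (j <= k)%N -> forall n, (k <= n)%N -> D j n by exact: inbox (HD k _).
elim: j => [|j IH] jk n kn.
  by rewrite /D /= subrr normr0 expr0 mul1r.
have b := inbox j (ltnW jk) (IH (ltnW jk)).
have [d1 d2] := IH (ltnW jk) n kn.
have b' := (Hs n).1 j (leq_trans (ltnW jk) kn).
have t0 : 0 <= La ^+ j * `|s n x - y| by rewrite mulr_ge0 ?exprn_ge0.
have q1 := saddle_contract b b' d1 d2.
have q2 := saddle_lipschitz b b' d1 d2.
rewrite /D !iterS exprS -mulrA; split.
  apply: le_trans q1 _; apply: ler_wpM2r => //; rewrite /La.
  have : 0 <= `|lu| by []. slra.
apply: le_trans q2 _; apply: ler_wpM2r => //; rewrite /La; move: lam_ge0; slra.
Qed.

(** * Second-order estimates: cross differences and slopes of the stable graph *)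

Variables (a b c d : R * R -> R) (K rho : R).
Hypothesis K_ge0 : 0 <= K.
Hypothesis eps_le1 : eps <= 1.
Hypothesis lam_gt0 : 0 < lam.
Hypothesis rho_le : rho <= `|ls| * `|lu| - eps * (`|ls| + `|lu| + 2).
Hypothesis rho_gt : lam ^+ 2 < rho.
Hypothesis coef : forall z, box z ->
  [/\ `|a z - ls| <= eps, `|b z| <= eps, `|c z| <= eps & `|d z - lu| <= eps].
Hypothesis F_quad : forall z z' (e : R), box z -> box z' ->
  `|z'.1 - z.1| <= e -> `|z'.2 - z.2| <= e ->
  `|(F z').1 - (F z).1 - (a z * (z'.1 - z.1) + b z * (z'.2 - z.2))| <= K * e ^+ 2 /\
  `|(F z').2 - (F z).2 - (c z * (z'.1 - z.1) + d z * (z'.2 - z.2))| <= K * e ^+ 2.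
Hypothesis F_quad0 : forall z (e : R), box z -> `|z.1| <= e -> `|z.2| <= e ->
  `|(F z).2 - lu * z.2| <= K * e ^+ 2.

Let B := `|ls| + `|lu| + 2.

(** Twice a signed triangle area. Divided by the horizontal differences z'.1 - z.1 and z''.1 - z.1,
    it is the difference of the slopes of the two chords issuing from z. *)
Let cross (z z' z'' : R * R) :=
  (z'.2 - z.2) * (z''.1 - z.1) - (z''.2 - z.2) * (z'.1 - z.1).

(** The determinant is ls * lu up to four errors. The summand 2 in [rho_le] pays for the two
    products of small terms, each at most eps because eps <= 1. *)
Let det_ge z : box z -> rho <= `|a z * d z - b z * c z|.
Proof.
move=> /coef[ha hb hc hd].
have e1 : a z * d z - b z * c z = ls * lu +
  ((a z - ls) * (d z - lu) + (a z - ls) * lu + ls * (d z - lu) - b z * c z) by ring.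
have h1 : `|(a z - ls) * (d z - lu)| <= eps * 1.
  by rewrite normrM ler_pM // (le_trans hd).
have h2 : `|(a z - ls) * lu| <= eps * `|lu| by rewrite normrM ler_wpM2r.
have h3 : `|ls * (d z - lu)| <= `|ls| * eps by rewrite normrM ler_wpM2l.
have h4 : `|b z * c z| <= eps * 1 by rewrite normrM ler_pM // (le_trans hc).
have h5 := ler_normB (a z * d z - b z * c z)
  ((a z - ls) * (d z - lu) + (a z - ls) * lu + ls * (d z - lu) - b z * c z).
rewrite {1}e1 addrK normrM in h5.
have h6 := ler_normB ((a z - ls) * (d z - lu) + (a z - ls) * lu + ls * (d z - lu)) (b z * c z).
have h7 := ler_normD ((a z - ls) * (d z - lu) + (a z - ls) * lu) (ls * (d z - lu)).
have h8 := ler_normD ((a z - ls) * (d z - lu)) ((a z - ls) * lu).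
move: rho_le; lra.
Qed.

Let lin_le (u v s t P : R) : `|u| + `|v| <= B -> `|s| <= P -> `|t| <= P ->
  `|u * s + v * t| <= B * P.
Proof.
move=> h hs ht; apply: le_trans (ler_normD _ _) _; rewrite !normrM.
have P0 : 0 <= P by exact: le_trans hs.
have := ler_wpM2l (normr_ge0 u) hs; have := ler_wpM2l (normr_ge0 v) ht.
have := ler_wpM2r P0 h; lra.
Qed.

Let rows z : box z -> `|a z| + `|b z| <= B /\ `|c z| + `|d z| <= B.
Proof.
move=> /coef[ha hb hc hd]; have := ler_normD (a z - ls) ls.
have := ler_normD (d z - lu) lu; rewrite !subrK /B.
have := normr_ge0 ls; have := normr_ge0 lu; move: eps_le1; lra.
Qed.

(** The linear part multiplies [cross] by the determinant. Every other term pairs a quadratic error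
    of one chord with the image or the error of the other chord, which gives the order P * Q * (P +
    Q). *)
Let cross_step z z' z'' P Q : box z -> box z' -> box z'' ->
  `|z'.1 - z.1| <= P -> `|z'.2 - z.2| <= P ->
  `|z''.1 - z.1| <= Q -> `|z''.2 - z.2| <= Q -> P <= 2 * r ->
  rho * `|cross z z' z''| - (2 * B * K + 4 * K ^+ 2 * r) * (P * Q * (P + Q))
    <= `|cross (F z) (F z') (F z'')|.
Proof.
move=> bz bz' bz'' x' y' x'' y'' Pr.
have [f1 f2] := F_quad bz bz' x' y'; have [g1 g2] := F_quad bz bz'' x'' y''.
have [r1 r2] := rows bz.
have m1 := lin_le r1 x' y'; have m2 := lin_le r2 x' y'.
have n1 := lin_le r1 x'' y''; have n2 := lin_le r2 x'' y''.
have P0 : 0 <= P by exact: le_trans x'.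
have Q0 : 0 <= Q by exact: le_trans x''.
have B0 : 0 <= B by exact: le_trans r1.
have dd := ler_wpM2r (normr_ge0 (cross z z' z'')) (det_ge bz).
rewrite -normrM in dd.
set A1' := a z * (z'.1 - z.1) + _ in f1 m1.
set A2' := c z * (z'.1 - z.1) + _ in f2 m2.
set A1'' := a z * (z''.1 - z.1) + _ in g1 n1.
set A2'' := c z * (z''.1 - z.1) + _ in g2 n2.
set e1' := _ - A1' in f1; set e2' := _ - A2' in f2.
set e1'' := _ - A1'' in g1; set e2'' := _ - A2'' in g2.
have E : cross (F z) (F z') (F z'') =
   (a z * d z - b z * c z) * cross z z' z'' + (A2' * e1'' + e2' * A1'' + e2' * e1''
    - A2'' * e1' - e2'' * A1' - e2'' * e1').
  by rewrite /cross /e1' /e2' /e1'' /e2'' /A1' /A2' /A1'' /A2''; ring.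
have prod (s t u v : R) : `|s| <= u -> `|t| <= v -> `|s * t| <= u * v.
  by move=> hs ht; rewrite normrM ler_pM.
have p1 := prod _ _ _ _ m2 g1; have p2 := prod _ _ _ _ f2 n1.
have p3 := prod _ _ _ _ f2 g1; have p4 := prod _ _ _ _ n2 f1.
have p5 := prod _ _ _ _ g2 m1; have p6 := prod _ _ _ _ g2 f1.
(* The product of two errors is quartic; one factor P <= 2r is given up to make it cubic like the
   other terms. *)
have KK : K * P ^+ 2 * (K * Q ^+ 2) <= 2 * K ^+ 2 * r * (P * Q * (P + Q)).
  have -> : K * P ^+ 2 * (K * Q ^+ 2) = (K ^+ 2 * P * Q ^+ 2) * P by ring.
  have : (K ^+ 2 * P * Q ^+ 2) * P <= (K ^+ 2 * P * Q ^+ 2) * (2 * r).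
    by rewrite ler_wpM2l // !mulr_ge0 ?sqr_ge0.
  have : 0 <= 2 * K ^+ 2 * r * (P ^+ 2 * Q).
    by rewrite !mulr_ge0 ?sqr_ge0 // ltW.
  lra.
set W := _ - e2'' * e1' in E.
have hW : `|W| <= (2 * B * K + 4 * K ^+ 2 * r) * (P * Q * (P + Q)).
  rewrite /W; have t1 := ler_normB (A2' * e1'' + e2' * A1'' + e2' * e1''
    - A2'' * e1' - e2'' * A1') (e2'' * e1').
  have t2 := ler_normB (A2' * e1'' + e2' * A1'' + e2' * e1'' - A2'' * e1') (e2'' * A1').
  have t3 := ler_normB (A2' * e1'' + e2' * A1'' + e2' * e1'') (A2'' * e1').
  have t4 := ler_normD (A2' * e1'' + e2' * A1'') (e2' * e1'').
  have t5 := ler_normD (A2' * e1'') (e2' * A1'').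
  lra.
have := ler_normB (cross (F z) (F z') (F z'')) W.
rewrite {1}E addrK; lra.
Qed.

(** Along stable orbits P * Q shrinks at least like lam^(2n) and P + Q does not grow, so the errors
    of [cross_step] and the cross difference itself are O(lam^(2n)). As rho > lam^2,
    [expanding_recursion_bound] bounds the initial cross difference by the initial error. *)
Lemma stable_cross z z' z'' : stable z -> stable z' -> stable z'' ->
  (rho - lam ^+ 2) * `|cross z z' z''| <=
  (2 * B * K + 4 * K ^+ 2 * r) *
    (`|z'.1 - z.1| * `|z''.1 - z.1| * (`|z'.1 - z.1| + `|z''.1 - z.1|)).
Proof.
move=> H H' H''; set P := `|z'.1 - z.1|; set Q := `|z''.1 - z.1|.
have C0 : 0 <= 2 * B * K + 4 * K ^+ 2 * r.
  by rewrite addr_ge0 ?mulr_ge0 ?sqr_ge0 ?addr_ge0 // ltW.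
have P2 w w' : stable w -> stable w' -> `|w'.1 - w.1| <= 2 * r.
  move=> /(_ 0%N)[h _] /(_ 0%N)[h' _]; apply: le_trans (ler_normB _ _) _.
  by move: h h' => /=; lra.
have P0 : 0 <= P by exact: normr_ge0.
have Q0 : 0 <= Q by exact: normr_ge0.
pose u n := `|cross (iter n F z) (iter n F z') (iter n F z'')|.
apply: (@expanding_recursion_bound R (lam ^+ 2) rho _ (2 * P * Q) u) => //.
- by rewrite exprn_gt0.
- by rewrite mulr_ge0 // mulr_ge0 ?(mulr_ge0 P0 Q0) ?(addr_ge0 P0 Q0).
- move=> n; have S := stable_iter n H; have S' := stable_iter n H'.
  have S'' := stable_iter n H''.
  have q1 := stable_contracts n H H'; have q2 := stable_contracts n H H''.
  have g1 := stable_graph_lipschitz S S'; have g2 := stable_graph_lipschitz S S''.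
  have := cross_step (H n) (H' n) (H'' n) (lexx _) g1 (lexx _) g2 (P2 _ _ S S').
  rewrite -!iterS; apply: le_trans; rewrite lerB //.
  rewrite [leRHS]mulrCA; apply: ler_wpM2l => //.
  set Pn := `|_| in q1 *; set Qn := `|_| in q2 *.
  have l1 : lam ^+ n <= 1 by rewrite exprn_ile1 // ltW.
  have l0 : 0 <= lam ^+ n by rewrite exprn_ge0.
  rewrite -exprM mulnC exprM; set l := lam ^+ n in q1 q2 l1 l0 *.
  have s1 : Pn * Qn <= l ^+ 2 * (P * Q).
    have -> : l ^+ 2 * (P * Q) = (l * P) * (l * Q) by ring.
    by apply: ler_pM => //; exact: normr_ge0.
  have s2 : Pn + Qn <= P + Q.
    have := ler_piMl P0 l1.
    have := ler_piMl Q0 l1.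
    by move: q1 q2; rewrite -/P -/Q; lra.
  by rewrite mulrA; apply: ler_pM => //; [apply: mulr_ge0 | apply: addr_ge0]; exact: normr_ge0.
- move=> n; have S := stable_iter n H; have S' := stable_iter n H'.
  have S'' := stable_iter n H''.
  have q1 := stable_contracts n H H'; have q2 := stable_contracts n H H''.
  have g1 := stable_graph_lipschitz S S'; have g2 := stable_graph_lipschitz S S''.
  apply: le_trans (ler_normB _ _) _; rewrite !normrM.
  have -> : (lam ^+ 2) ^+ n * (2 * P * Q) =
    (lam ^+ n * P) * (lam ^+ n * Q) + (lam ^+ n * Q) * (lam ^+ n * P).
    by rewrite -exprM mulnC exprM; ring.
  by apply: lerD; apply: ler_pM => //; exact: le_trans q1 || exact: le_trans q2.
Qed.

(** Tangency to the contracting axis at the origin: the height is expanded by mu up to an error of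
    order z.1^2, which does not increase along the orbit, while the height stays below r. *)
Lemma stable_tangent0 z : stable z -> (mu - 1) * `|z.2| <= K * z.1 ^+ 2.
Proof.
move=> H; have p n : `|(iter n F z).2| <= `|(iter n F z).1| /\ `|(iter n F z).1| <= `|z.1|.
  have := stable_graph_lipschitz stable0 (stable_iter n H).
  have := stable_contracts n stable0 H.
  have -> : iter n F (0, 0) = (0, 0) by elim: n => //= n ->.
  rewrite /= !subr0 => h ->; split => //; apply: le_trans h _.
  by rewrite ler_piMl // exprn_ile1 // ltW.
apply: (@expanding_recursion_bound R 1 mu _ r (fun n => `|(iter n F z).2|)) => //.
- exact: mulr_ge0 K_ge0 (sqr_ge0 _).
- move=> n; rewrite expr1n mul1r.
  have [p1 p2] := p n; have := F_quad0 (H n) (lexx _) p1.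
  have -> : `|(iter n F z).1| ^+ 2 = (iter n F z).1 ^+ 2 by rewrite real_normK ?num_real.
  have := ler_normB (F (iter n F z)).2 ((F (iter n F z)).2 - lu * (iter n F z).2).
  rewrite opprB addrCA subrr addr0 normrM -iterS => h1 h2.
  have h3 : (iter n F z).1 ^+ 2 <= z.1 ^+ 2.
    by rewrite -[X in X <= _]real_normK ?num_real // -[X in _ <= X]real_normK ?num_real // lerXn2r.
  have h4 := ler_wpM2l K_ge0 h3.
  have h5 : mu * `|(iter n F z).2| <= `|lu| * `|(iter n F z).2|.
    by rewrite ler_wpM2r //; move: mu_le eps_ge0; lra.
  lra.
- by move=> n; rewrite expr1n mul1r; exact: (H n).2.
Qed.

(* Both the graph and its slopes are defined by junk values outside [-r, r]. *)
Theorem stable_graph : exists (sg m : R -> R) (C : R),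
  [/\ 0 <= C,
      forall x, `|x| <= r -> stable (x, sg x),
      forall z, stable z -> z.2 = sg z.1,
      sg 0 = 0 /\ m 0 = 0 &
      forall x x', `|x| <= r -> `|x'| <= r ->
        `|sg x' - sg x - m x * (x' - x)| <= C * (x' - x) ^+ 2].
Proof.
have H x : exists y, `|x| <= r -> stable (x, y).
  by have [/exists_stable[y]|] := pselect (`|x| <= r); [exists y | exists 0].
have [sg Hsg] := choice H.
have uniq z : stable z -> z.2 = sg z.1.
  move=> Hz; have := Hsg _ (Hz 0%N).1.
  by move=> /stable_cone_eq /(_ Hz); rewrite /= subrr normr0 => /(_ (normr_ge0 _)) E; rewrite [in LHS]E.
have sg0 : sg 0 = 0 by have := uniq _ stable0.
pose C := (2 * B * K + 4 * K ^+ 2 * r) / (rho - lam ^+ 2).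
have rl : 0 < rho - lam ^+ 2 by rewrite subr_gt0.
have C0 : 0 <= C.
  rewrite divr_ge0 ?(ltW rl) // addr_ge0 //; last first.
    by apply: mulr_ge0 (ltW r_gt0); apply: mulr_ge0 => //; exact: sqr_ge0.
  by apply: mulr_ge0 => //; apply: mulr_ge0 => //; rewrite /B !addr_ge0.
pose q x x' := (sg x' - sg x) / (x' - x).
have slope x x' x'' : `|x| <= r -> `|x'| <= r -> `|x''| <= r -> x' != x -> x'' != x ->
    `|q x x' - q x x''| <= C * `|x' - x| + C * `|x'' - x|.
  move=> hx hx' hx'' n' n''.
  have := stable_cross (Hsg _ hx) (Hsg _ hx') (Hsg _ hx''); rewrite /cross /=.
  have p' : 0 < `|x' - x| by rewrite normr_gt0 subr_eq0.
  have p'' : 0 < `|x'' - x| by rewrite normr_gt0 subr_eq0.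
  have -> : (sg x' - sg x) * (x'' - x) - (sg x'' - sg x) * (x' - x) =
     (q x x' - q x x'') * ((x' - x) * (x'' - x)).
    by rewrite /q; field; rewrite !subr_eq0 n' n''.
  rewrite 2!normrM => h.
  have : (rho - lam ^+ 2) * `|q x x' - q x x''| <=
      (2 * B * K + 4 * K ^+ 2 * r) * (`|x' - x| + `|x'' - x|).
    by rewrite -(ler_pM2r (mulr_gt0 p' p'')); lra.
  rewrite mulrC -ler_pdivlMr // => /le_trans; apply.
  by rewrite -mulrDr /C mulrAC.
(* By [slope], the intervals of radius C * |x' - x| around the difference quotients at x meet
   pairwise; a common point is the derivative, with the quadratic error already included. *)
have slope_ex x : exists m, `|x| <= r -> forall x', `|x'| <= r ->
    `|sg x' - sg x - m * (x' - x)| <= C * (x' - x) ^+ 2.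
  have [hx|] := pselect (`|x| <= r); last by exists 0.
  have [x1 [hx1 n1]] : exists x1, `|x1| <= r /\ x1 != x.
    have [->|x0] := eqVneq x 0.
      by exists r; rewrite gtr0_norm ?gt_eqF.
    by exists 0; rewrite normr0 ltW // eq_sym.
  have [] := @exists_common_approx R R x1 (fun x' => `|x'| <= r /\ x' != x) (q x)
     (fun x' => C * `|x' - x|) (conj hx1 n1).
    move=> i j [hi ni] [hj nj]; have := slope _ _ _ hx hi hj ni nj.
    by rewrite ler_norml => /andP[]; lra.
  move=> m Hm; exists m => _ x' hx'; have [->|n'] := eqVneq x' x.
    by rewrite !subrr mulr0 subrr normr0 expr0n mulr0.
  have d0 : x' - x != 0 by rewrite subr_eq0.
  have -> : sg x' - sg x - m * (x' - x) = (q x x' - m) * (x' - x).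
    by rewrite /q mulrBl divfK.
  rewrite normrM -[X in C * X]real_normK ?num_real // expr2 mulrA ler_wpM2r //.
  exact: Hm.
have [m Hm] := choice slope_ex.
pose C1 := K / (mu - 1); have mu1 : 0 < mu - 1 by rewrite subr_gt0.
have C10 : 0 <= C1 by rewrite divr_ge0 // ltW.
(* At 0 the slope is set to 0, which [stable_tangent0] justifies with constant [C1]. *)
exists sg, (fun x => if x == 0 then 0 else m x), (C + C1); split => //.
- by rewrite addr_ge0.
- by rewrite eqxx.
move=> x x' hx hx'; case: (eqVneq x 0) hx => [-> _|_ hx].
  rewrite sg0 mul0r !subr0.
  have := stable_tangent0 (Hsg _ hx'); rewrite /= mulrC -ler_pdivlMr // mulrAC => h.
  apply: le_trans h _; rewrite -/C1 ler_wpM2r ?sqr_ge0 //; lra.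
apply: le_trans (Hm _ hx _ hx') _; rewrite ler_wpM2r ?sqr_ge0 //; lra.
Qed.

End SaddleDynamics.

(** * Calculus in the plane *)

Section MatrixNorm.
Context {R : realType}.

Lemma coord_le_norm (m n : nat) (A : 'M[R]_(m, n)) i j : `|A i j| <= `|A|.
Proof. by rewrite [leRHS]/Num.Def.normr /= mx_normrE; exact: (le_bigmax _ _ (i, j)). Qed.

Lemma norm_le_coord (m n : nat) (A : 'M[R]_(m, n)) e :
  0 <= e -> (forall i j, `|A i j| <= e) -> `|A| <= e.
Proof.
by move=> e0 H; rewrite [leLHS]/Num.Def.normr /= mx_normrE bigmax_le // => -[i j] _; exact: H.
Qed.

Lemma row2E (v : 'rV[R]_2) : v = v 0 0 *: delta_mx 0 0 + v 0 1 *: delta_mx 0 1.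
Proof. by rewrite [LHS]row_sum_delta big_ord_recl big_ord1; congr (_ + v _ _ *: delta_mx _ _); apply/val_inj. Qed.

(** The norm of a matrix is its largest entry in absolute value and not an operator norm, hence the
    factor 2, which recurs in later constants. *)
Lemma norm_mulmx (v : 'rV[R]_2) (A : 'M[R]_2) : `|v *m A| <= 2 * `|v| * `|A|.
Proof.
apply: norm_le_coord => [|i j]; first by rewrite !mulr_ge0.
rewrite mxE big_ord_recl big_ord1; apply: le_trans (ler_normD _ _) _.
have P k : `|v i k * A k j| <= `|v| * `|A|.
  by rewrite normrM; apply: ler_pM => //; exact: coord_le_norm.
have := P ord0; have := P (lift ord0 ord0); lra.
Qed.

Lemma norm_lincomb2 (W : normedModType R) (a b s t e : R) (x y : W) :
  `|a| <= s -> `|b| <= s -> `|x| <= t -> `|y| <= e -> `|a *: x + b *: y| <= (t + e) * s.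
Proof.
move=> ha hb hx hy; apply: le_trans (ler_normD _ _) _.
by rewrite !normrZ [leRHS]mulrC mulrDr lerD // ler_pM.
Qed.

End MatrixNorm.

Section Differential.
Context {R : realType}.
Implicit Types (V W : normedModType R).

Lemma is_derive_line V W (f : V -> W) (z v : V) (s : R) :
  derivable f (z + s *: v) v ->
  is_derive s 1 (fun t : R => f (z + t *: v)) ('D_v f (z + s *: v)).
Proof.
have E : (fun h : R => h^-1 *: (f (z + (h *: 1 + s) *: v) - f (z + s *: v))) =
    (fun h : R => h^-1 *: (f (h *: v + (z + s *: v)) - f (z + s *: v))).
  by apply/funext => h; rewrite scalerDl addrCA -scalerA scale1r.
move=> H; apply: DeriveDef.
  by rewrite /derivable E.
by rewrite /derive E.
Qed.

Lemma MVT_line V (f : V -> R) (z z' : V) :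
  (forall s : R, 0 <= s <= 1 -> derivable f (z + s *: (z' - z)) (z' - z)) ->
  exists2 s : R, 0 <= s <= 1 & f z' - f z = 'D_(z' - z) f (z + s *: (z' - z)).
Proof.
move=> H; have D s : 0 <= s <= 1 -> _ := fun hs => is_derive_line (H s hs).
have [s|| s /[!in_itv] /= s01 E] := @MVT R (fun t : R => f (z + t *: (z' - z)))
    (fun s => 'D_(z' - z) f (z + s *: (z' - z))) 0 1 ltr01.
- by rewrite in_itv /= => /andP[/ltW s0 /ltW s1]; apply: D; rewrite s0 s1.
- apply: derivable_within_continuous => s /[!in_itv] /= hs.
  exact: (@ex_derive _ _ _ _ _ _ _ (D s hs)).
exists s; first by case/andP: s01 => /ltW -> /ltW ->.
by move: E; rewrite scale1r scale0r addr0 subr0 mulr1 [z + _]addrCA subrr addr0.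
Qed.

Lemma derive_row2 W (f : 'rV[R]_2 -> W) (z v : 'rV[R]_2) : differentiable f z ->
  'D_v f z = v 0 0 *: 'D_(delta_mx 0 0) f z + v 0 1 *: 'D_(delta_mx 0 1) f z.
Proof.
by move=> df; rewrite !deriveE // {1}[v]row2E linearD !linearZ.
Qed.

End Differential.

Section ContinuouslyDifferentiable.
Context {R : realType}.
Implicit Types (V W : normedModType R).

Lemma Ck_differentiable V W k U (f : V -> W) x : Ck k.+1 U f -> U x -> differentiable f x.
Proof. by move=> [H _]; exact: H. Qed.

Lemma Ck_sub V W k U U' (f : V -> W) : U' `<=` U -> Ck k U f -> Ck k U' f.
Proof.
move=> UU; elim: k f => [|k IH] f /=; first by move=> H x /UU; exact: H.
by move=> [H1 H2]; split=> [x /UU|v]; [exact: H1 | exact: IH].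
Qed.

Lemma in_ball_segment (z0 z z' : 'rV[R]_2) rho (s : R) : 0 <= s <= 1 ->
  `|z0 - z| < rho -> `|z0 - z'| < rho -> `|z0 - (z + s *: (z' - z))| < rho.
Proof.
move=> /andP[s0 s1] h h'.
have -> : z0 - (z + s *: (z' - z)) = (1 - s) *: (z0 - z) + s *: (z0 - z').
  by apply/matrixP => i j; rewrite !mxE; ring.
apply: le_lt_trans (ler_normD _ _) _; rewrite !normrZ (ger0_norm s0).
rewrite (ger0_norm (_ : 0 <= 1 - s)); last lra.
have [->|sn0] := eqVneq s 0; first by lra.
have sp : 0 < s by rewrite lt_def sn0.
have := ler_wpM2l (_ : 0 <= 1 - s) (ltW h); have : s * `|z0 - z'| < s * rho by rewrite ltr_pM2l.
by move=> a /(_ ltac:(lra)) b; lra.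
Qed.

(** The mean value theorem is for real functions, so it is applied to each entry, with its own
    intermediate point; for the max norm nothing is lost. *)
Lemma lipschitz_of_partials (m n : nat) (f : 'rV[R]_2 -> 'M[R]_(m, n)) z0 rho B :
  (forall z : 'rV[R]_2, `|z0 - z| < rho -> differentiable f z /\
     forall k, `|'D_(delta_mx 0 k) f z| <= B) ->
  forall z z' : 'rV[R]_2, `|z0 - z| < rho -> `|z0 - z'| < rho -> `|f z' - f z| <= 2 * B * `|z' - z|.
Proof.
move=> H z z' hz hz'.
have B0 : 0 <= B by have [_ /(_ 0)] := H z hz; exact: le_trans.
apply: norm_le_coord => [|i j]; first by rewrite !mulr_ge0.
have Hd (s : R) : 0 <= s <= 1 -> differentiable f (z + s *: (z' - z)).
  by move=> hs; have [] := H _ (in_ball_segment hs hz hz').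
have [s hs|s hs E] := @MVT_line R _ (fun x => f x i j) z z'.
  by have /derivable_mxP := diff_derivable (v := z' - z) (Hd s hs); apply.
have -> : (f z' - f z) i j = f z' i j - f z i j by rewrite !mxE.
rewrite E.
have -> : 'D_(z' - z) (fun x => f x i j) (z + s *: (z' - z)) = ('D_(z' - z) f (z + s *: (z' - z))) i j.
  by rewrite derive_mx ?mxE //; exact/diff_derivable/Hd.
apply: le_trans (coord_le_norm _ i j) _; rewrite derive_row2; last exact: Hd.
have [_ Hk] := H _ (in_ball_segment hs hz hz').
have -> : 2 * B = B + B by ring.
exact: norm_lincomb2 (coord_le_norm (z' - z) 0 0) (coord_le_norm (z' - z) 0 1) (Hk 0) (Hk 1).
Qed.

Lemma Ck1_locally_lipschitz (m n : nat) (U : set 'rV[R]_2) (f : 'rV[R]_2 -> 'M[R]_(m, n)) z0 :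
  open U -> U z0 -> Ck 1 U f ->
  exists rho K : R, [/\ 0 < rho, 0 <= K, (forall z : 'rV[R]_2, `|z0 - z| < rho -> U z) &
    forall z z' : 'rV[R]_2, `|z0 - z| < rho -> `|z0 - z'| < rho -> `|f z' - f z| <= K * `|z' - z|].
Proof.
move=> oU Uz0 [fd fD].
pose B := `|'D_(delta_mx 0 0) f z0| + `|'D_(delta_mx 0 1) f z0| + 1.
have B0 : 0 <= B by rewrite !addr_ge0.
have cont k : \forall z \near z0, `|'D_(delta_mx 0 k) f z0 - 'D_(delta_mx 0 k) f z| < 1.
  have := fD (delta_mx 0 k) z0 Uz0; move=> /cvgrPdist_lt; exact.
have near_all : \forall z \near z0, forall k, `|'D_(delta_mx 0 k) f z0 - 'D_(delta_mx 0 k) f z| < 1.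
  exact: filter_forall cont.
have : \forall z \near z0, U z /\ forall k, `|'D_(delta_mx 0 k) f z| <= B.
  near=> z; split; first by near: z; exact: open_nbhs_nbhs.
  have t (a b : 'M[R]_(m, n)) c : `|a| + 1 <= c -> `|a - b| < 1 -> `|b| <= c.
    by move=> ac ab; have := ler_normB a (a - b); rewrite subKr; lra.
  suff H k : `|'D_(delta_mx 0 k) f z0| + 1 <= B.
    move=> k; apply: t (H k) _; by move: k; near: z.
  rewrite /B lerD2r; case: k => [[|[|//]] kk].
    by rewrite (_ : Ordinal kk = 0) ?lerDl //; exact/val_inj.
  by rewrite (_ : Ordinal kk = 1) ?lerDr //; exact/val_inj.
move=> /nbhs_normP[rho /= rho0 Hrho]; exists rho, (2 * B); split => //.
- by rewrite mulr_ge0.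
- by move=> z hz; have [] := Hrho z hz.
- apply: lipschitz_of_partials => z hz; split; last by have [] := Hrho z hz.
  by apply: fd; have [] := Hrho z hz.
Unshelve. all: by end_near. Qed.

(** Second derivatives enter the whole proof only through these two bounds: the partial derivatives
    are C^1, hence locally Lipschitz, and the mean value theorem turns this into a quadratic Taylor
    error. *)
Lemma Ck2_taylor (m n : nat) (U : set 'rV[R]_2) (f : 'rV[R]_2 -> 'M[R]_(m, n)) z0 :
  open U -> U z0 -> Ck 2 U f ->
  exists rho K : R, [/\ 0 < rho, 0 <= K, (forall z : 'rV[R]_2, `|z0 - z| < rho -> U z),
    (forall z z' v : 'rV[R]_2, `|z0 - z| < rho -> `|z0 - z'| < rho ->
       `|'D_v f z' - 'D_v f z| <= K * `|z' - z| * `|v|) &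
    forall z z' : 'rV[R]_2, `|z0 - z| < rho -> `|z0 - z'| < rho ->
       `|f z' - f z - 'D_(z' - z) f z| <= K * `|z' - z| ^+ 2].
Proof.
move=> oU Uz0 [fd fD].
have [rho0 [K0 [r0 k0 U0 L0]]] := Ck1_locally_lipschitz oU Uz0 (fD (delta_mx 0 0)).
have [rho1 [K1 [r1 k1 U1 L1]]] := Ck1_locally_lipschitz oU Uz0 (fD (delta_mx 0 1)).
pose rho := Num.min rho0 rho1; pose K := K0 + K1.
have inU (z : 'rV[R]_2) : `|z0 - z| < rho -> U z by rewrite lt_min => /andP[/U0].
have lipD (z z' v : 'rV[R]_2) : `|z0 - z| < rho -> `|z0 - z'| < rho ->
       `|'D_v f z' - 'D_v f z| <= K * `|z' - z| * `|v|.
  move=> hz hz'; rewrite !(derive_row2 v (fd _ _)); try exact: inU.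
  have -> (a b : R) (w x y t : 'M[R]_(m, n)) :
      a *: w + b *: x - (a *: y + b *: t) = a *: (w - y) + b *: (x - t).
    by rewrite opprD addrACA !scalerBr.
  move: hz hz'; rewrite !lt_min => /andP[a0 a1] /andP[b0 b1].
  rewrite /K mulrDl.
  exact: norm_lincomb2 (coord_le_norm v 0 0) (coord_le_norm v 0 1) (L0 _ _ a0 b0) (L1 _ _ a1 b1).
exists rho, K; split => //.
- by rewrite lt_min r0 r1.
- by rewrite addr_ge0.
move=> z z' hz hz'; apply: norm_le_coord => [|i j].
  by rewrite mulr_ge0 ?addr_ge0 ?sqr_ge0.
have Hd (s : R) : 0 <= s <= 1 -> differentiable f (z + s *: (z' - z)).
  by move=> hs; apply: fd; apply: inU; exact: in_ball_segment.
have [s hs|s hs E] := @MVT_line R _ (fun x => f x i j) z z'.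
  by have /derivable_mxP := diff_derivable (v := z' - z) (Hd s hs); apply.
have -> : (f z' - f z - 'D_(z' - z) f z) i j =
   ('D_(z' - z) f (z + s *: (z' - z)) - 'D_(z' - z) f z) i j.
  have -> : ('D_(z' - z) f (z + s *: (z' - z)) - 'D_(z' - z) f z) i j =
     ('D_(z' - z) f (z + s *: (z' - z))) i j - ('D_(z' - z) f z) i j by rewrite !mxE.
  have -> : ('D_(z' - z) f (z + s *: (z' - z))) i j =
     'D_(z' - z) (fun x => f x i j) (z + s *: (z' - z)).
    by rewrite derive_mx ?mxE //; exact/diff_derivable/Hd.
  by rewrite -E !mxE.
apply: le_trans (coord_le_norm _ i j) _.
apply: le_trans (lipD _ _ _ hz (in_ball_segment hs hz hz')) _.
rewrite expr2 mulrA ler_wpM2r // ler_wpM2l ?addr_ge0 //.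
rewrite addrAC subrr add0r normrZ; case/andP: hs => s0 s1.
by rewrite ger0_norm // ler_piMl.
Qed.

End ContinuouslyDifferentiable.

(** * C^1 curves and the chain rule *)

Section SmoothCurves.
Context {R : realType}.

(** [Ck 1] quantifies over all directions v, but on the line the derivative along v is v times
    [derive1 u]; on open sets this pointwise form is therefore equivalent to it, see
    [Ck1_curveP]. *)
Definition C1_at (W : normedModType R) (u : R -> W) (t : R) : Prop :=
  derivable (u : R^o -> W) t 1 /\ {for t, continuous (derive1 u)}.

Lemma derive_scale_direction (W : normedModType R) (u : R -> W) (t v : R) :
  derivable (u : R^o -> W) t 1 -> 'D_v (u : R^o -> W) t = v *: derive1 u t.
Proof.
move=> du; rewrite derive1E.
have df : differentiable (u : R^o -> W) t by exact/derivable1_diffP.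
rewrite !deriveE // -[v in LHS]mulr1.
by rewrite -[in RHS]linearZ.
Qed.

Lemma near_eq_continuous_at (T W : topologicalType) (f h : T -> W) (x : T) :
  (\near x, f x = h x) -> {for x, continuous f} -> {for x, continuous h}.
Proof.
move=> E cf; rewrite /prop_for /continuous_at -(nbhs_singleton E).
exact: cvg_trans (near_eq_cvg E) _.
Qed.

Lemma Ck1_curveP (W : normedModType R) (U : set R) (u : R -> W) : open U ->
  Ck 1 (U : set R^o) (u : R^o -> W) <-> forall t, U t -> C1_at u t.
Proof.
move=> oU; split=> [[H1 H2] t Ut|H].
  split; first exact/derivable1_diffP/H1.
  have := H2 1 t Ut; rewrite (_ : 'D_1 (u : R^o -> W) = derive1 u) //.
  by apply/funext => s; rewrite derive1E.
split=> [t /H[/derivable1_diffP //]|v t Ut].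
have E : \forall s \near t, v *: derive1 u s = 'D_v (u : R^o -> W) s.
  near=> s; rewrite derive_scale_direction //; apply: (H s _).1.
  by near: s; exact: open_nbhs_nbhs.
have [_ cu] := H t Ut.
apply: (near_eq_continuous_at E); exact: cvgZr.
Unshelve. all: by end_near. Qed.

Lemma C1_at_continuous (W : normedModType R) (u : R -> W) t :
  C1_at u t -> {for t, continuous u}.
Proof. by move=> [/derivable1_diffP /differentiable_continuous]. Qed.

Lemma near_eq_derive1 (W : normedModType R) (u w : R -> W) (t : R) :
  (\forall s \near t, u s = w s) -> \forall s \near t, derive1 u s = derive1 w s.
Proof.
move=> /nbhs_interior H; near=> s; rewrite !derive1E; apply: near_eq_derive.
by near: s.
Unshelve. all: by end_near. Qed.

Lemma near_eq_C1_at (W : normedModType R) (u w : R -> W) (t : R) :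
  (\forall s \near t, u s = w s) -> C1_at u t -> C1_at w t.
Proof.
move=> E [d c]; split; first exact: near_eq_derivable d.
exact: near_eq_continuous_at (near_eq_derive1 E) c.
Qed.

Lemma derive1_comp_row2 (W : normedModType R) (f : 'rV[R]_2 -> W) (u : R -> 'rV[R]_2) (t : R) :
  derivable (u : R^o -> 'rV[R]_2) t 1 -> differentiable f (u t) ->
  derivable (f \o u : R^o -> W) t 1 /\ derive1 (f \o u) t = 'D_(derive1 u t) f (u t).
Proof.
move=> /derivable1_diffP du df.
have dc : differentiable (f \o (u : R^o -> 'rV[R]_2)) t by exact: differentiable_comp.
split; first exact/derivable1_diffP.
by rewrite !derive1E !deriveE //= diff_comp.
Qed.

Lemma C1_at_comp (W : normedModType R) (f : 'rV[R]_2 -> W) (Om : set 'rV[R]_2)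
    (u : R -> 'rV[R]_2) (t : R) :
  open Om -> Om (u t) -> Ck 1 Om f -> (\forall s \near t, C1_at u s) -> C1_at (f \o u) t.
Proof.
move=> oO Ot [fd fD] Hu; have ut := nbhs_singleton Hu.
have near_Om : \forall s \near t, Om (u s).
  by apply: (C1_at_continuous ut); exact: open_nbhs_nbhs.
split; first exact: (derive1_comp_row2 ut.1 (fd _ Ot)).1.
(* The direction [derive1 u s] moves with s, whereas [Ck] gives continuity of derivatives in fixed
   directions only; so the chain rule is written with the two partial derivatives. *)
have E : \forall s \near t, derive1 u s 0 0 *: 'D_(delta_mx 0 0) f (u s) +
    derive1 u s 0 1 *: 'D_(delta_mx 0 1) f (u s) = derive1 (f \o u) s.
  near=> s; have us : C1_at u s by near: s.
  have Os : Om (u s) by near: s.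
  by rewrite (derive1_comp_row2 us.1 (fd _ Os)).2 [RHS]derive_row2 //; exact: fd.
apply: (near_eq_continuous_at E).
have cD k : 'D_(delta_mx 0 k) f (u s) @[s --> t] --> 'D_(delta_mx 0 k) f (u t).
  apply: (@continuous_comp _ _ _ u ('D_(delta_mx 0 k) f) t); [exact: C1_at_continuous | exact: fD].
have cu k : derive1 u s 0 k @[s --> t] --> derive1 u t 0 k.
  apply: (@continuous_comp _ _ _ (derive1 u) (fun v : 'rV[R]_2 => v 0 k) t).
    exact: ut.2.
  exact: coord_continuous.
by apply: cvgD; apply: cvgZ.
Unshelve. all: by end_near. Qed.

End SmoothCurves.

(** * Curves, charts and lengths *)

Section SurfaceCharts.
Context {R : realType} {M : topologicalType} (S : surface R M).
Implicit Types (i j : idx S) (x : M) (c : R -> M) (U : set R).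

Lemma surface_hausdorff : hausdorff_space M.
Proof. case: S => *; assumption. Qed.

Lemma dom_chart_at x : dom (chart_at S x) x.
Proof. by case: S => *. Qed.

Lemma open_dom i : open (dom i).
Proof. by case: S i. Qed.

Lemma open_image_chart i : open (chart i @` dom i).
Proof. by case: S i. Qed.

Lemma chartK i x : dom i x -> chart_inv i (chart i x) = x.
Proof. by case: S i x. Qed.

Lemma chart_continuous i x : dom i x -> {for x, continuous (chart i)}.
Proof. by case: S i x. Qed.

Lemma chart_inv_continuous i z :
  (chart i @` dom i) z -> {for z, continuous (chart_inv i)}.
Proof. by case: S i z. Qed.

Lemma transition_smooth i j k :
  Ck k (chart i @` (dom i `&` dom j)) (chart j \o chart_inv i).
Proof. by case: S i j k. Qed.

Lemma dom_chart_inv i z : (chart i @` dom i) z -> dom i (chart_inv i z).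
Proof. by move=> [x dx <-]; rewrite chartK. Qed.

Lemma chart_invK i z : (chart i @` dom i) z -> chart i (chart_inv i z) = z.
Proof. by move=> [x dx <-]; rewrite chartK. Qed.

Lemma image_chartP i (A : set M) z :
  (chart i @` (dom i `&` A)) z <-> (chart i @` dom i) z /\ A (chart_inv i z).
Proof.
split=> [[x [dx Ax] <-]|[[x dx <-]]]; first by rewrite chartK //; split => //; exists x.
by rewrite chartK // => Ax; exists x.
Qed.

Lemma open_image_chartI i (A : set M) : open A -> open (chart i @` (dom i `&` A)).
Proof.
move=> oA; rewrite openE => z /image_chartP[dz Az].
have h1 : \forall w \near z, (chart i @` dom i) w.
  by apply: open_nbhs_nbhs; split => //; exact: open_image_chart.
have h2 : \forall w \near z, A (chart_inv i w).
  by apply: (chart_inv_continuous dz); exact: open_nbhs_nbhs.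
rewrite /interior; near=> w; apply/image_chartP; split; first by near: w.
by near: w.
Unshelve. all: by end_near. Qed.

Lemma near_preimage_open (U : set R) c (A : set M) t :
  {for t, continuous c} -> open A -> A (c t) -> \forall s \near t, A (c s).
Proof. by move=> cc oA Act; apply: cc; exact: open_nbhs_nbhs. Qed.

Lemma open_curve_preimage U c (A : set M) : open U ->
  (forall t, U t -> {for t, continuous c}) -> open A -> open (U `&` c @^-1` A).
Proof.
move=> oU cc oA; rewrite openE => t [Ut At]; rewrite /interior.
have h1 : \forall s \near t, U s by exact: open_nbhs_nbhs.
have h2 := near_preimage_open U (cc t Ut) oA At.
by near=> s; split; near: s.
Unshelve. all: by end_near. Qed.

Lemma C1_curve_chart U c i t : open U -> C1_curve S U c -> U t -> dom i (c t) ->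
  \forall s \near t, C1_at (chart i \o c) s.
Proof.
move=> oU [cc Hc] Ut dt.
have oV := open_curve_preimage oU cc (open_dom i).
have /(Ck1_curveP _ oV) H := Hc i.
near=> s; apply: H; near: s; exact: open_nbhs_nbhs.
Unshelve. all: by end_near. Qed.

Lemma chart_curve_transition c i j t : {for t, continuous c} -> dom i (c t) ->
  \forall s \near t, ((chart j \o chart_inv i) \o (chart i \o c)) s = (chart j \o c) s.
Proof.
move=> cc dt; have h := near_preimage_open setT cc (open_dom i) dt.
by near=> s => /=; rewrite chartK //; near: s.
Unshelve. all: by end_near. Qed.

Lemma derive1_chart_change U c i j t : open U -> C1_curve S U c -> U t ->
  dom i (c t) -> dom j (c t) ->
  derive1 (chart j \o c) t =
  derive1 (chart i \o c) t *m jacobian (chart j \o chart_inv i) (chart i (c t)).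
Proof.
move=> oU Hc Ut di dj.
have [du _] := nbhs_singleton (C1_curve_chart oU Hc Ut di).
have dtr : differentiable (chart j \o chart_inv i) (chart i (c t)).
  by apply: (Ck_differentiable (transition_smooth i j 1)); exists (c t).
rewrite -deriveEjacobian // -(derive1_comp_row2 du dtr).2.
exact: esym (nbhs_singleton (near_eq_derive1 (chart_curve_transition j (Hc.1 t Ut) di))).
Qed.

Lemma C1_curve_of_chart U i (u : R -> 'rV[R]_2) : open U ->
  (forall t, U t -> C1_at u t) -> (forall t, U t -> (chart i @` dom i) (u t)) ->
  C1_curve S U (chart_inv i \o u).
Proof.
move=> oU Hu Hd.
have cc t : U t -> {for t, continuous (chart_inv i \o u)}.
  move=> Ut; apply: continuous_comp; first exact/C1_at_continuous/Hu.
  exact/chart_inv_continuous/Hd.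
split=> // j; have oV := open_curve_preimage oU cc (open_dom j).
apply/(Ck1_curveP _ oV) => t [Ut dt].
change (C1_at ((chart j \o chart_inv i) \o u) t).
apply: (@C1_at_comp R _ (chart j \o chart_inv i) (chart i @` (dom i `&` dom j)) u t).
- exact/open_image_chartI/open_dom.
- by apply/image_chartP; split => //; exact: Hd.
- exact: transition_smooth.
- by near=> s; apply: Hu; near: s; exact: open_nbhs_nbhs.
Unshelve. all: by end_near. Qed.

End SurfaceCharts.

(** * The speed of a curve read in a fixed chart *)

Section Speed.
Context {R : realType} {M : topologicalType} (S : surface R M) (g : riemannian_metric S).
Implicit Types (i j : idx S) (x : M) (c : R -> M) (U : set R).

Definition quad (A : 'M[R]_2) (v : 'rV[R]_2) : R := (v *m A *m v^T) 0 0.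

Lemma quadE (A : 'M[R]_2) (v : 'rV[R]_2) :
  quad A v = v 0 0 * A 0 0 * v 0 0 + v 0 1 * A 1 0 * v 0 0 +
             (v 0 0 * A 0 1 * v 0 1 + v 0 1 * A 1 1 * v 0 1).
Proof.
rewrite /quad !mxE !big_ord_recl !big_ord0 !mxE !big_ord_recl !big_ord0 /=.
rewrite !addr0 !mulrDl.
by congr (_ * _ * _ + _ * _ * _ + (_ * _ * _ + _ * _ * _)); congr (_ _ _) => //; apply/val_inj.
Qed.

Lemma gram_smooth i k : Ck k (chart i @` dom i) (gram g i).
Proof. by case: g => /= G H *; exact: H. Qed.

Lemma gram_sym i x : dom i x -> (gram g i (chart i x))^T = gram g i (chart i x).
Proof. by case: g => /= G _ H *; exact: H. Qed.

Lemma gram_pos i x (v : 'rV[R]_2) : dom i x -> v != 0 -> 0 < quad (gram g i (chart i x)) v.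
Proof. by case: g => /= G _ _ H *; exact: H. Qed.

Lemma gram_change i j x : dom i x -> dom j x ->
  let J := jacobian (chart j \o chart_inv i) (chart i x) in
  gram g i (chart i x) = J *m gram g j (chart j x) *m J^T.
Proof. by case: g => /= G _ _ _ H *; exact: H. Qed.

(** [speed] uses the chart chosen at c(t), which may jump with t. The transformation law of the Gram
    matrix allows any fixed chart, in which continuity in t becomes visible. *)
Lemma speed_chart U c i t : open U -> C1_curve S U c -> U t -> dom i (c t) ->
  speed g c t = Num.sqrt (quad (gram g i (chart i (c t))) (derive1 (chart i \o c) t)).
Proof.
move=> oU Hc Ut di; have dj := dom_chart_at S (c t).
rewrite /speed /velocity; congr Num.sqrt.
rewrite (derive1_chart_change oU Hc Ut di dj) /quad (gram_change di dj).
by rewrite trmx_mul !mulmxA.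
Qed.

Lemma speed_continuous U c t : open U -> C1_curve S U c -> U t ->
  {for t, continuous (speed g c)}.
Proof.
move=> oU Hc Ut; pose i := chart_at S (c t); have di := dom_chart_at S (c t).
have cu := C1_curve_chart oU Hc Ut di; have cut := nbhs_singleton cu.
pose f s := Num.sqrt (quad (gram g i (chart i (c s))) (derive1 (chart i \o c) s)).
apply: (@near_eq_continuous_at _ _ f).
  near=> s; apply/esym; apply: (@speed_chart U) => //.
    by near: s; exact: open_nbhs_nbhs.
  by near: s; apply: near_preimage_open => //; [exact: Hc.1 | exact: open_dom].
have cv k : {for t, continuous (fun s => derive1 (chart i \o c) s 0 k)}.
  apply: (@continuous_comp _ _ _ (derive1 (chart i \o c)) (fun v : 'rV[R]_2 => v 0 k) t).
    exact: cut.2.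
  exact: coord_continuous.
have cG k l : {for t, continuous (fun s => gram g i (chart i (c s)) k l)}.
  apply: (@continuous_comp _ _ _ (fun s => gram g i (chart i (c s))) (fun A : 'M[R]_2 => A k l) t).
    apply: (@continuous_comp _ _ _ (chart i \o c) (gram g i) t).
      exact: C1_at_continuous cut.
    by apply: (gram_smooth i 0); exists (c t).
  exact: coord_continuous.
apply: (@continuous_comp _ _ _ (fun s => quad (gram g i (chart i (c s))) (derive1 (chart i \o c) s)) Num.sqrt t); last exact: sqrt_continuous.
pose w s := derive1 (chart i \o c) s; pose G s := gram g i (chart i (c s)).
apply: (@near_eq_continuous_at _ _ (fun s =>
  w s 0 0 * G s 0 0 * w s 0 0 + w s 0 1 * G s 1 0 * w s 0 0 +
  (w s 0 0 * G s 0 1 * w s 0 1 + w s 0 1 * G s 1 1 * w s 0 1))).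
  by near=> s; rewrite quadE.
have cm (a b d : R -> R) : {for t, continuous a} -> {for t, continuous b} ->
   {for t, continuous d} -> {for t, continuous (fun s => a s * b s * d s)}.
  by move=> ca cb cd; apply: cvgM; [apply: cvgM|].
by apply: cvgD; apply: cvgD; apply: cm; first [exact: cv | exact: cG].
Unshelve. all: by end_near. Qed.

Lemma speed_ge0 c t : 0 <= speed g c t.
Proof. exact: sqrtr_ge0. Qed.

End Speed.

(** * Lengths of piecewise C^1 curves *)

Section CurveLength.
Context {R : realType} {M : topologicalType} (S : surface R M) (g : riemannian_metric S).
Implicit Types (c : R -> M) (U : set R) (a b t : R).
Local Notation mu := (@lebesgue_measure R).

Lemma ge0_integral_oo_leZl (a b k : R) (f1 f2 : R -> R) : 0 <= k ->
  (forall t, 0 <= f1 t) -> (forall t, 0 <= f2 t) ->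
  measurable_fun `]a, b[ (fun t => (f1 t)%:E) ->
  measurable_fun `]a, b[ (fun t => (f2 t)%:E) ->
  (forall t, t \in `]a, b[ -> f1 t <= k * f2 t) ->
  (\int[mu]_(t in `]a, b[) (f1 t)%:E <= k%:E * \int[mu]_(t in `]a, b[) (f2 t)%:E)%E.
Proof.
move=> k0 f10 f20 m1 m2 H; rewrite -ge0_integralZl //; last first.
- by move=> t _; rewrite lee_fin.
- apply: ge0_le_integral => //.
  + by move=> t _; rewrite lee_fin.
  + exact: measurable_funeM.
Qed.

Lemma near_itv_oo a b t : t \in `]a, b[ -> \forall s \near t, s \in `[a, b].
Proof.
move=> tab; have : \forall s \near t, s \in `]a, b[ by exact: near_in_itvoo.
by apply: filterS => s; exact: subset_itv_oo_cc.
Qed.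

Lemma speed_near_eq c c' t : (\forall s \near t, c s = c' s) ->
  speed g c t = speed g c' t.
Proof.
move=> E; have Et := nbhs_singleton E.
have V : velocity S c t = velocity S c' t.
  rewrite /velocity Et !derive1E; apply: near_eq_derive.
  by apply: filterS E => s /= ->.
by rewrite /speed V Et.
Qed.

#[local] Opaque speed.

Lemma speed_eq_oo c c' a b t : (forall t, t \in `[a, b] -> c t = c' t) ->
  t \in `]a, b[ -> speed g c t = speed g c' t.
Proof.
by move=> E tab; apply: speed_near_eq; apply: filterS (near_itv_oo tab) => s; exact: E.
Qed.

Lemma measurable_speed_oo U c a b : open U -> C1_curve S U c -> `]a, b[ `<=` U ->
  measurable_fun `]a, b[ (fun t => (speed g c t)%:E).
Proof.
move=> oU Hc sU; apply/measurable_EFinP.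
apply: subspace_continuous_measurable_fun => //.
apply: continuous_in_subspaceT => t /set_mem tab.
exact: (speed_continuous oU Hc (sU _ tab)).
Qed.

(** [c] and its C^1 extension agree only on [a, b], so their speeds agree only in the interior: at
    the ends, the speed of [c] also depends on its values outside. Integrals are therefore compared
    over open intervals. *)
Lemma segment_extension c a b : C1_segment S c a b ->
  exists U c', [/\ a < b, open U, `[a, b]%classic `<=` U, C1_curve S U c' &
    [/\ forall t, t \in `[a, b] -> c t = c' t,
       forall t, t \in `]a, b[ -> speed g c t = speed g c' t,
       measurable_fun `]a, b[ (fun t => (speed g c t)%:E) &
       measurable_fun `]a, b[ (fun t => (speed g c' t)%:E)]].
Proof.
move=> [ab [U [c' [oU sU Hc E]]]]; exists U, c'.
have mc' : measurable_fun `]a, b[ (fun t => (speed g c' t)%:E).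
  apply: measurable_speed_oo oU Hc _; apply: subset_trans sU; exact: subset_itv_oo_cc.
have E' t : t \in `]a, b[ -> speed g c t = speed g c' t by exact: (speed_eq_oo E).
split; [exact: ab | exact: oU | exact: sU | exact: Hc | split; [exact: E | exact: E' | | exact: mc']].
apply: eq_measurable_fun mc' => t /set_mem /= tab.
by rewrite E'.
Qed.

Lemma measurable_itv_oo_cc a b (f : R -> \bar R) :
  measurable_fun `]a, b[ f -> measurable_fun `[a, b] f.
Proof.
by move=> /emeasurable_fun_itv_bndo_bndcP /emeasurable_fun_itv_obnd_cbndP.
Qed.

Lemma piecewise_C1_lt c a b : piecewise_C1 S c a b -> a < b.
Proof. by elim=> {a b} [a b []|a b e _ + _] //; exact: lt_trans. Qed.

Lemma itv_cc_setU a b e : a <= b -> b <= e ->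
  (`[a, e]%classic : set R) = `[a, b[ `|` `[b, e].
Proof. by move=> ab be; rewrite (@itv_bndbnd_setU _ _ _ (BLeft b)) ?bnd_simp. Qed.

Lemma piecewise_C1_measurable c a b : piecewise_C1 S c a b ->
  measurable_fun `[a, b] (fun t => (speed g c t)%:E).
Proof.
elim=> {a b} [a b /segment_extension[U [c' [_ _ _ _ [_ _ mc _]]]]|a b e Hab IHab Hbe IHbe].
  exact: measurable_itv_oo_cc.
have ab := ltW (piecewise_C1_lt Hab); have be := ltW (piecewise_C1_lt Hbe).
rewrite (itv_cc_setU ab be); apply/measurable_funU => //; split => //.
by apply: measurable_funS IHab => //; apply: subset_itvl; rewrite bnd_simp.
Qed.

Lemma curve_length_cat c a b e : a <= b -> b <= e ->
  measurable_fun `[a, e] (fun t => (speed g c t)%:E) ->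
  curve_length g c a e = (curve_length g c a b + curve_length g c b e)%E.
Proof.
move=> ab be mc; rewrite /curve_length (itv_cc_setU ab be).
have sp t : (0 <= (speed g c t)%:E)%E by rewrite lee_fin speed_ge0.
have mab : measurable_fun `[a, b[ (fun t => (speed g c t)%:E).
  apply: measurable_funS mc => //; apply: subset_itvl; rewrite bnd_simp //.
rewrite ge0_integral_setU //=.
- by rewrite integral_itv_bndo_bndc.
- by rewrite -itv_cc_setU.
- apply/disj_setPS => t /= []; rewrite !in_itv /= => /andP[_ tb] /andP[bt _].
  by rewrite ltNge bt in tb.
Qed.

Lemma piecewise_C1_length_cat c a b e : piecewise_C1 S c a b -> piecewise_C1 S c b e ->
  curve_length g c a e = (curve_length g c a b + curve_length g c b e)%E.
Proof.
move=> H1 H2; apply: curve_length_cat; try exact/ltW/(piecewise_C1_lt (c := c)).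
exact: piecewise_C1_measurable (piecewise_C1_cat H1 H2).
Qed.

Lemma piecewise_C1_restrict c a b t : piecewise_C1 S c a b -> a < t <= b ->
  piecewise_C1 S c a t.
Proof.
move=> H; elim: H t => {a b} [a b [ab [U [c' [oU sU Hc E]]]]|a b e H1 IH1 H2 IH2] t /andP[at_ tb].
  apply: piecewise_C1_segment; split => //; exists U, c'; split => //.
    by apply: subset_trans sU; apply: subset_itvl; rewrite bnd_simp.
  move=> s sat; apply: E; apply: subitvPr sat; by rewrite bnd_simp.
have [tb'|bt] := leP t b; first by apply: IH1; rewrite at_.
by apply: piecewise_C1_cat H1 _; apply: IH2; rewrite bt.
Qed.

Lemma curve_length_ge0 c a b : (0 <= curve_length g c a b)%E.
Proof. by apply: integral_ge0 => t _; rewrite lee_fin speed_ge0. Qed.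

Lemma curve_length_restrict c a b t : piecewise_C1 S c a b -> a < t <= b ->
  (curve_length g c a t <= curve_length g c a b)%E.
Proof.
move=> H /andP[at_ tb]; rewrite (curve_length_cat (ltW at_) tb (piecewise_C1_measurable H)).
by rewrite leeDl // curve_length_ge0.
Qed.

Lemma curve_length_oo c a b : measurable_fun `]a, b[ (fun t => (speed g c t)%:E) ->
  curve_length g c a b = (\int[mu]_(t in `]a, b[) (speed g c t)%:E)%E.
Proof. by move=> mc; rewrite /curve_length integral_itv_bndoo. Qed.

Lemma in_itv_left a b e t : b <= e -> t \in `[a, b] -> t \in `[a, e].
Proof. by move=> be; apply: subset_itvl; rewrite bnd_simp. Qed.

Lemma in_itv_right a b e t : a <= b -> t \in `[b, e] -> t \in `[a, e].
Proof. by move=> ab; apply: subset_itvr; rewrite bnd_simp. Qed.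

Lemma curve_restrict_preimage (D : set M) U c c' a b : open D -> open U ->
  C1_curve S U c' -> `[a, b]%classic `<=` U ->
  (forall t, t \in `[a, b] -> c t = c' t) -> (forall t, t \in `[a, b] -> D (c t)) ->
  let V := U `&` c' @^-1` D in
  [/\ open V, C1_curve S V c' & `[a, b]%classic `<=` V].
Proof.
move=> oD oU Hc sU E HD; split; first exact: open_curve_preimage oU Hc.1 oD.
- split=> [t [Ut _]|i]; first exact: Hc.1.
  by apply: Ck_sub (Hc.2 i) => t [[Ut _] dt].
- by move=> t tab; split; [exact: sU | rewrite /= -E //; exact: HD].
Qed.

(** The hypothesis on [P] concerns C^1 curves on open sets: each segment is replaced by its
    extension, cut down by [curve_restrict_preimage] to the times at which it lies in [D]. *)
Lemma piecewise_C1_push (D : set M) (P : M -> M) (theta : R) c a b :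
  open D -> 0 <= theta ->
  (forall U c', open U -> C1_curve S U c' -> (forall t, U t -> D (c' t)) ->
     C1_curve S U (P \o c') /\
     forall t, U t -> speed g (P \o c') t <= theta * speed g c' t) ->
  piecewise_C1 S c a b -> (forall t, t \in `[a, b] -> D (c t)) ->
  piecewise_C1 S (P \o c) a b /\
  (curve_length g (P \o c) a b <= theta%:E * curve_length g c a b)%E.
Proof.
move=> oD th0 HP; elim=> {a b} [a b Hs|a b e H1 IH1 H2 IH2] HD.
  have [U [c' [ab oU sU Hc [E Es mc mc']]]] := segment_extension Hs.
  have [oV HcV sV] := curve_restrict_preimage oD oU Hc sU E HD.
  have [HPc Hsp] := HP _ c' oV HcV (fun t Vt => Vt.2).
  have sg : C1_segment S (P \o c) a b.
    by split => //; exists (U `&` c' @^-1` D), (P \o c'); split => // t tab; rewrite /= E.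
  split; first exact: piecewise_C1_segment.
  have [_ [_ [_ _ _ _ [_ _ mP _]]]] := segment_extension sg.
  rewrite (curve_length_oo mP) (curve_length_oo mc).
  apply: ge0_integral_oo_leZl th0 _ _ mP mc _; try exact: speed_ge0.
  move=> t tab; rewrite (Es t tab).
  have E1 s : s \in `[a, b] -> (P \o c) s = (P \o c') s by move=> sab; rewrite /= E.
  rewrite (speed_eq_oo E1 tab); apply: Hsp; apply: sV; exact: subset_itv_oo_cc.
have l1 := piecewise_C1_lt H1; have l2 := piecewise_C1_lt H2.
have [q1 q1'] := IH1 (fun t tab => HD t (in_itv_left (ltW l2) tab)).
have [q2 q2'] := IH2 (fun t tab => HD t (in_itv_right (ltW l1) tab)).
split; first exact: piecewise_C1_cat q1 q2.
rewrite (piecewise_C1_length_cat q1 q2) (piecewise_C1_length_cat H1 H2).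
by rewrite ge0_muleDr ?curve_length_ge0 // leeD.
Qed.

(** The fundamental theorem of calculus on each piece. It is applied to a cut-off function on all of
    M, and then to the coordinates of a chart. *)
Lemma lipschitz_along_curves (D : set M) (h : M -> R) (L : R) c a b : open D -> 0 <= L ->
  (forall U c', open U -> C1_curve S U c' -> (forall t, U t -> D (c' t)) ->
     forall t, U t ->
     C1_at (h \o c') t /\ `|derive1 (h \o c') t| <= L * speed g c' t) ->
  piecewise_C1 S c a b -> (forall t, t \in `[a, b] -> D (c t)) ->
  (`|h (c b) - h (c a)|%:E <= L%:E * curve_length g c a b)%E.
Proof.
move=> oD L0 Hh; elim=> {a b} [a b Hs|a b e H1 IH1 H2 IH2] HD.
  have [U [c' [ab oU sU Hc [E Es mc mc']]]] := segment_extension Hs.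
  have [oV HcV sV] := curve_restrict_preimage oD oU Hc sU E HD.
  have HU t : t \in `[a, b] -> (U `&` c' @^-1` D) t by move=> tab; exact: sV.
  have H := Hh _ c' oV HcV (fun t Vt => Vt.2).
  have dc : {within `[a, b], continuous (derive1 (h \o c'))}.
    apply: continuous_in_subspaceT => t /set_mem tab; exact: (H t (sV _ tab)).1.2.
  have lab : a \in `[a, b] by rewrite in_itv /= lexx ltW.
  have rab : b \in `[a, b] by rewrite in_itv /= lexx ltW.
  have := @continuous_FTC2 R (derive1 (h \o c')) (h \o c') a b ab dc.
  have [] : derivable_oo_LRcontinuous (h \o c') a b.
    split.
    - move=> t tab; apply: (H t _).1.1; apply: HU; exact: subset_itv_oo_cc.
    - apply: cvg_at_right_filter; exact: C1_at_continuous (H a (HU _ lab)).1.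
    - apply: cvg_at_left_filter; exact: C1_at_continuous (H b (HU _ rab)).1.
  move=> d1 d2 d3 /(_ (And3 d1 d2 d3)) /(_ (fun _ _ => erefl)) FTC.
  have -> : `|h (c b) - h (c a)|%:E = `|\int[mu]_(t in `[a, b]) (derive1 (h \o c') t)%:E|%E.
    by rewrite FTC /= !E.
  have md : measurable_fun `[a, b] (fun t => (derive1 (h \o c') t)%:E).
    by apply/measurable_EFinP; exact: subspace_continuous_measurable_fun.
  apply: (le_trans (le_abse_integral mu (measurable_itv _) md)).
  have mda : measurable_fun `]a, b[ (fun t => `|derive1 (h \o c') t|%:E).
    apply/measurable_EFinP; apply: measurableT_comp => //; apply/measurable_EFinP.
    by apply: measurable_funS md => //; exact: subset_itv_oo_cc.
  rewrite integral_itv_bndoo; last exact: mda.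
  rewrite (curve_length_oo mc).
  apply: ge0_integral_oo_leZl L0 _ _ mda mc _.
  - by move=> t; exact: normr_ge0.
  - exact: speed_ge0.
  move=> t tab; rewrite (Es t tab).
  by apply: (H t _).2; apply: HU; exact: subset_itv_oo_cc.
have l1 := piecewise_C1_lt H1; have l2 := piecewise_C1_lt H2.
have {}IH1 := IH1 (fun t tab => HD t (in_itv_left (ltW l2) tab)).
have {}IH2 := IH2 (fun t tab => HD t (in_itv_right (ltW l1) tab)).
rewrite (piecewise_C1_length_cat H1 H2) ge0_muleDr ?curve_length_ge0 //.
apply: le_trans _ (leeD IH1 IH2); rewrite -EFinD lee_fin.
have -> : h (c e) - h (c a) = (h (c b) - h (c a)) + (h (c e) - h (c b)) by ring.
exact: ler_normD.
Qed.

Lemma curve_lengthE c a b :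
  curve_length g c a b = (\int[mu]_(t in `[a, b]) (speed g c t)%:E)%E.
Proof. by []. Qed.

End CurveLength.

(** * Derivatives from quadratic errors, a C^1 cut-off, compact balls *)

Section RealCalculus.
Context {R : realType}.

Lemma is_derive_of_quadratic (f : R -> R) (x l K e : R) : 0 < e ->
  (forall y, `|y - x| < e -> `|f y - f x - l * (y - x)| <= K * (y - x) ^+ 2) ->
  is_derive x 1 (f : R^o -> R^o) l.
Proof.
move=> e0 H.
have cv : (fun h : R => h^-1 *: (f (h *: 1 + x) - f x) : R^o) @ 0^' --> (l : R^o).
  apply/cvgrPdist_lt => d d0; pose K1 := `|K| + 1.
  have K10 : 0 < K1 by rewrite /K1 ltr_wpDl.
  near=> h.
  have h0 : h != 0 by near: h; exact: nbhs_dnbhs_neq.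
  have he : `|h| < e by near: h; exact: dnbhs0_lt.
  have hd : `|h| < d / K1 by near: h; apply: dnbhs0_lt; exact: divr_gt0.
  have hp : 0 < `|h| by rewrite normr_gt0.
  rewrite [h *: 1]mulr1.
  have := H (h + x); rewrite addrK => /(_ he) Hh.
  have -> : l - h^-1 *: (f (h + x) - f x) = - ((f (h + x) - f x - l * h) / h).
    by rewrite /GRing.scale /=; field.
  rewrite normrN normrM normfV ltr_pdivrMr //; apply: le_lt_trans Hh _.
  rewrite -[h ^+ 2]real_normK ?num_real // expr2 mulrA ltr_pM2r //.
  move: hd; rewrite ltr_pdivlMr // => hd.
  apply: le_lt_trans (ler_wpM2r (ltW hp) (ler_norm K)) _.
  apply: le_lt_trans _ hd; rewrite mulrC ler_wpM2l // /K1; lra.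
apply: DeriveDef; first by apply/cvg_ex; exists l.
exact: cvg_lim.
Unshelve. all: by end_near. Qed.

(** Squaring the positive part makes it C^1 across 0, so cutting off with it preserves C^1
    regularity along curves. *)
Definition posq (x : R) : R := Num.max 0 x ^+ 2.

Lemma is_derive_posq (x : R) : is_derive x 1 (posq : R^o -> R^o) (2 * Num.max 0 x).
Proof.
apply: (@is_derive_of_quadratic _ _ _ 1 1) => // y _.
rewrite /posq mul1r ler_norml.
have := sqr_ge0 (y - x); have := sqr_ge0 x; have := sqr_ge0 y.
case: (leP 0 x) => hx; case: (leP 0 y) => hy h1 h2 h3; apply/andP; split; try lra.
- by have := mulr_ge0 hx (ltW (_ : 0 < - y)); rewrite oppr_gt0 => /(_ hy); lra.
- by have := mulr_ge0 (ltW (_ : 0 < - x)) hy; rewrite oppr_gt0 => /(_ hx); lra.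
Qed.

Lemma posq_ge0 x : 0 <= posq x.
Proof. exact: sqr_ge0. Qed.

Lemma pos_of_posq x : 0 < posq x -> 0 < x.
Proof. by rewrite /posq; case: (leP 0 x) => // + h; [nra | lra]. Qed.

Lemma is_derive_disc (x y : R -> R) (s a b r2 : R) :
  is_derive s 1 x a -> is_derive s 1 y b ->
  is_derive s 1 (fun s => r2 - (x s ^+ 2 + y s ^+ 2)) (- (2 * x s * a + 2 * y s * b)).
Proof.
move=> dx dy.
have d1 := is_deriveM dx dx; have d2 := is_deriveM dy dy; have d3 := is_deriveD d1 d2.
have d4 := is_deriveB (is_derive_cst r2 s 1) d3.
have -> : (fun s => r2 - (x s ^+ 2 + y s ^+ 2)) = cst r2 - (x * x + y * y).
  by apply/funext => t; rewrite /= !fctE !expr2.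
have -> : - (2 * x s * a + 2 * y s * b) = 0 - (x s *: a + x s *: a + (y s *: b + y s *: b)).
  by rewrite /GRing.scale /=; ring.
exact: d4.
Qed.

Lemma compact_norm_ball (z0 : 'rV[R]_2) (r : R) : compact [set z | `|z - z0| <= r].
Proof.
apply: bounded_closed_compact.
  exists (r + `|z0|); split; first exact: num_real.
  move=> y hy z /= hz; rewrite -(subrK z0 z); apply: le_trans (ler_normD _ _) _.
  by apply: le_trans (ltW hy); rewrite lerD2r.
rewrite (_ : [set z | _] = (fun z => `|z - z0|) @^-1` [set x | x <= r]) //.
apply: closed_comp => [z _|]; last exact: closed_le.
apply: (@continuous_comp _ _ _ (fun z : 'rV[R]_2 => z - z0) Num.Def.normr z).
  by apply: continuousB; [exact: cvg_id | exact: cst_continuous].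
exact: norm_continuous.
Qed.

End RealCalculus.

Section QuadraticForms.
Context {R : realType}.
Implicit Types (A : 'M[R]_2) (v : 'rV[R]_2).

Lemma quad_bound A v : `|quad A v| <= 4 * `|A| * `|v| ^+ 2.
Proof.
rewrite quadE.
have P i j : `|v 0 i * A i j * v 0 j| <= `|A| * `|v| ^+ 2.
  rewrite !normrM mulrC mulrA mulrC expr2 ler_pM // ?mulr_ge0 ?coord_le_norm //.
  by rewrite ler_pM // coord_le_norm.
apply: le_trans (ler_normD _ _) _.
have := ler_normD (v 0 0 * A 0 0 * v 0 0) (v 0 1 * A 1 0 * v 0 0).
have := ler_normD (v 0 0 * A 0 1 * v 0 1) (v 0 1 * A 1 1 * v 0 1).
have := P 0 0; have := P 0 1; have := P 1 0; have := P 1 1.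
lra.
Qed.

Lemma quadB A A' v : quad (A - A') v = quad A v - quad A' v.
Proof. by rewrite /quad mulmxBr mulmxBl !mxE. Qed.

Lemma norm_row2 v : `|v| = Num.max `|v 0 0| `|v 0 1|.
Proof.
apply/le_anti/andP; split.
  apply: norm_le_coord => [|i j]; first by rewrite le_max normr_ge0.
  rewrite (ord1 i) le_max; case: j => [[|[|//]] kk].
    by rewrite (_ : Ordinal kk = 0) ?lexx //; exact/val_inj.
  by rewrite (_ : Ordinal kk = 1) ?lexx ?orbT //; exact/val_inj.
by rewrite ge_max !coord_le_norm.
Qed.

(** The constant is the determinant over the trace: completing the square in either variable bounds
    det * v_k^2 by the opposite diagonal entry times [quad A v]. *)
Lemma quad_posdef A : A^T = A -> (forall v, v != 0 -> 0 < quad A v) ->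
  exists m, 0 < m /\ forall v, m * `|v| ^+ 2 <= quad A v.
Proof.
move=> At H.
have s : A 1 0 = A 0 1 by rewrite -[in LHS]At mxE.
have q v : quad A v = A 0 0 * v 0 0 ^+ 2 + 2 * A 0 1 * v 0 0 * v 0 1 + A 1 1 * v 0 1 ^+ 2.
  by rewrite quadE s; ring.
pose w (x y : R) : 'rV[R]_2 := \row_j (if j == 0 then x else y).
have w0 x y : w x y 0 0 = x by rewrite mxE.
have w1 x y : w x y 0 1 = y by rewrite mxE.
have wn x y : (x != 0) || (y != 0) -> w x y != 0.
  apply: contraL => /eqP E; rewrite negb_or !negbK.
  by rewrite -(w0 x y) -{2}(w1 x y) E !mxE eqxx.
have a0 : 0 < A 0 0.
  have := H (w 1 0); rewrite wn ?oner_eq0 // q w0 w1 => /(_ isT); lra.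
have d0 : 0 < A 1 1.
  have := H (w 0 1); rewrite wn ?oner_eq0 ?orbT // q w0 w1 => /(_ isT); lra.
have det0 : 0 < A 0 0 * A 1 1 - A 0 1 ^+ 2.
  (* On this vector the form takes the value A 0 0 times the determinant. *)
  have := H (w (- A 0 1) (A 0 0)); rewrite wn ?(gt_eqF a0) ?orbT // q w0 w1 => /(_ isT).
  have -> : A 0 0 * (- A 0 1) ^+ 2 + 2 * A 0 1 * - A 0 1 * A 0 0 + A 1 1 * A 0 0 ^+ 2 =
    A 0 0 * (A 0 0 * A 1 1 - A 0 1 ^+ 2) by ring.
  by rewrite pmulr_rgt0.
exists ((A 0 0 * A 1 1 - A 0 1 ^+ 2) / (A 0 0 + A 1 1)); split.
  by rewrite divr_gt0 // addr_gt0.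
move=> v; rewrite mulrAC ler_pdivrMr ?addr_gt0 // q norm_row2.
have h0 : (A 0 0 * A 1 1 - A 0 1 ^+ 2) * `|v 0 0| ^+ 2 <=
   A 1 1 * (A 0 0 * v 0 0 ^+ 2 + 2 * A 0 1 * v 0 0 * v 0 1 + A 1 1 * v 0 1 ^+ 2).
  rewrite real_normK ?num_real //; have := sqr_ge0 (A 0 1 * v 0 0 + A 1 1 * v 0 1); lra.
have h1 : (A 0 0 * A 1 1 - A 0 1 ^+ 2) * `|v 0 1| ^+ 2 <=
   A 0 0 * (A 0 0 * v 0 0 ^+ 2 + 2 * A 0 1 * v 0 0 * v 0 1 + A 1 1 * v 0 1 ^+ 2).
  rewrite real_normK ?num_real //; have := sqr_ge0 (A 0 0 * v 0 0 + A 0 1 * v 0 1); lra.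
have Q0 : 0 <= A 0 0 * v 0 0 ^+ 2 + 2 * A 0 1 * v 0 0 * v 0 1 + A 1 1 * v 0 1 ^+ 2.
  rewrite -(pmulr_rge0 _ d0); apply: le_trans h0; by rewrite mulr_ge0 ?sqr_ge0 // ltW.
have := mulr_ge0 (ltW a0) Q0; have := mulr_ge0 (ltW d0) Q0.
by case: (leP `|v 0 0| `|v 0 1|) => _; move: h0 h1; lra.
Qed.

End QuadraticForms.

Section CurveCoordinates.
Context {R : realType}.

Lemma C1_at_of_is_derive (W : normedModType R) (h E : R -> W) (t : R) :
  (\forall s \near t, is_derive (s : R^o) 1 (h : R^o -> W) (E s)) ->
  {for t, continuous E} -> C1_at h t /\ derive1 h t = E t.
Proof.
move=> H cE.
have E1 : \forall s \near t, E s = derive1 h s.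
  by apply: filterS H => s Hs; rewrite derive1E derive_val.
split; last by rewrite (nbhs_singleton E1).
have [dh _] := nbhs_singleton H; split => //.
exact: near_eq_continuous_at E1 cE.
Qed.

Lemma is_derive_coord (u : R -> 'rV[R]_2) (t : R) k : C1_at u t ->
  is_derive (t : R^o) 1 (fun s : R^o => u s 0 k : R^o) (derive1 u t 0 k).
Proof.
move=> [du _]; apply: DeriveDef.
  by have /derivable_mxP := du; exact.
by rewrite derive1E derive_mx // mxE.
Qed.

Lemma continuous_derive1_coord (u : R -> 'rV[R]_2) (t : R) k : C1_at u t ->
  {for t, continuous (fun s => derive1 u s 0 k)}.
Proof.
move=> [_ cu].
apply: (@continuous_comp _ _ _ (derive1 u) (fun v : 'rV[R]_2 => v 0 k) t) => //.
exact: coord_continuous.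
Qed.

Lemma continuous_coord_curve (u : R -> 'rV[R]_2) (t : R) k : C1_at u t ->
  {for t, continuous (fun s => u s 0 k)}.
Proof.
move=> /C1_at_continuous cu.
apply: (@continuous_comp _ _ _ u (fun v : 'rV[R]_2 => v 0 k) t) => //.
exact: coord_continuous.
Qed.

Lemma C1_at_coord (u : R -> 'rV[R]_2) (t : R) k : (\forall s \near t, C1_at u s) ->
  C1_at (fun s => u s 0 k) t /\ derive1 (fun s => u s 0 k) t = derive1 u t 0 k.
Proof.
move=> H; apply: (@C1_at_of_is_derive R^o (fun s => u s 0 k) (fun s => derive1 u s 0 k) t).
  by apply: filterS H => s; exact: is_derive_coord.
exact/continuous_derive1_coord/(nbhs_singleton H).
Qed.

Lemma mulmxr_continuous (T : 'M[R]_2) : continuous (mulmxr T : 'rV[R]_2 -> 'rV[R]_2).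
Proof.
move=> z; apply/(@cvgrPdist_lt _ _ _ (nbhs z)) => e e0; pose K := 2 * `|T| + 1.
have K0 : 0 < K by rewrite /K ltr_wpDl // mulr_ge0.
near=> y => /=.
have zy : `|z - y| < e / K.
  by near: y; apply: cvgr_dist_lt => //; exact: divr_gt0.
rewrite -mulmxBl; apply: le_lt_trans (norm_mulmx _ _) _.
apply: le_lt_trans (_ : `|z - y| * K < _); last by rewrite -ltr_pdivlMr.
by rewrite mulrAC mulrC ler_wpM2l // /K lerDl.
Unshelve. all: by end_near. Qed.

Lemma affine_C1 (z0 : 'rV[R]_2) (T : 'M[R]_2) :
  let f := fun z : 'rV[R]_2 => z0 + (z - z0) *m T in
  Ck 1 setT f /\ forall z v, 'D_v f z = v *m T.
Proof.
move=> f.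
have fE : f = (fun z => cst (z0 - z0 *m T) z + mulmxr T z).
  by apply/funext => z; rewrite /f /= mulmxBl addrCA addrC.
have D z v : is_derive z v f (v *m T).
  rewrite fE -[v *m T]add0r; apply: is_deriveD.
  have dl : differentiable (mulmxr T : 'rV[R]_2 -> 'rV[R]_2) z by apply/linear_differentiable/mulmxr_continuous.
  apply: DeriveDef; first exact: diff_derivable.
  by rewrite deriveE // diff_lin //; exact: mulmxr_continuous.
have Dv z v : 'D_v f z = v *m T by have [_ ->] := D z v.
split=> //; split=> [z _|v].
  rewrite fE; apply: differentiableD; first exact: differentiable_cst.
  exact/linear_differentiable/mulmxr_continuous.
rewrite (_ : 'D_v f = cst (v *m T)); last by apply/funext => z; rewrite Dv.
by move=> z _; exact: cst_continuous.
Qed.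

Lemma C1_at_affine (z0 : 'rV[R]_2) (T : 'M[R]_2) (u : R -> 'rV[R]_2) (t : R) :
  (\forall s \near t, C1_at u s) ->
  C1_at (fun s => z0 + (u s - z0) *m T) t /\
  derive1 (fun s => z0 + (u s - z0) *m T) t = derive1 u t *m T.
Proof.
move=> H; have [C D] := affine_C1 z0 T; split.
  exact: (@C1_at_comp R _ (fun z => z0 + (z - z0) *m T) setT u t openT I C H).
have [du _] := nbhs_singleton H.
have := (derive1_comp_row2 du (Ck_differentiable C (x := u t) I)).2.
by rewrite D.
Qed.

End CurveCoordinates.

Section LocalConstants.
Context {R : realType} {M : topologicalType} (S : surface R M) (g : riemannian_metric S).

Lemma gram_local_bounds (i : idx S) (p : M) : dom i p ->
  exists rho m K B : R, [/\ 0 < rho, 0 < m, 0 <= K, 0 <= B &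
   [/\ forall z, `|z - chart i p| <= rho -> (chart i @` dom i) z,
      forall z v, `|z - chart i p| <= rho -> m * `|v| ^+ 2 <= quad (gram g i z) v,
      forall z, `|z - chart i p| <= rho -> `|gram g i z| <= B &
      forall z z', `|z - chart i p| <= rho -> `|z' - chart i p| <= rho ->
        `|gram g i z' - gram g i z| <= K * `|z' - z|]].
Proof.
move=> dp; set z0 := chart i p.
have Iz0 : (chart i @` dom i) z0 by exists p.
have [r [K [r0 K0 rU rL]]] :=
  Ck1_locally_lipschitz (@open_image_chart _ _ S i) Iz0 (@gram_smooth _ _ S g i 1).
have [m [m0 Hm]] := quad_posdef (@gram_sym _ _ S g i p dp) (fun v => @gram_pos _ _ S g i p v dp).
(* On this ball the Gram matrix varies by at most m/8, hence by [quad_bound] the form by at most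
   half of its lower bound m |v|^2. *)
pose rho := Num.min (r / 2) (m / (8 * (K + 1))).
have K1 : 0 < K + 1 by lra.
have rho0 : 0 < rho by rewrite lt_min !divr_gt0 // mulr_gt0.
have rr z : `|z - z0| <= rho -> `|z0 - z| < r.
  by rewrite distrC => h; apply: le_lt_trans h _; rewrite gt_min; apply/orP; left; lra.
have r00 : `|z0 - z0| < r by rewrite subrr normr0.
have gK z : `|z - z0| <= rho -> `|gram g i z - gram g i z0| <= K * rho.
  by move=> h; apply: le_trans (rL z0 z r00 (rr z h)) _; rewrite ler_wpM2l.
have Krho : K * rho <= m / 8.
  apply: le_trans (_ : (K + 1) * rho <= _); first by rewrite ler_wpM2r ?(ltW rho0) // lerDl.
  have : rho <= m / (8 * (K + 1)) by rewrite ge_min lexx orbT.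
  by rewrite invfM mulrA ler_pdivlMr // mulrC.
exists rho, (m / 2), K, (`|gram g i z0| + m / 8); split => //.
- by rewrite divr_gt0.
- by rewrite addr_ge0 // divr_ge0 // ltW.
split.
- by move=> z /rr; exact: rU.
- move=> z v hz; have q1 := Hm v.
  have := quad_bound (gram g i z - gram g i z0) v; rewrite quadB => q2.
  have q3 : 4 * `|gram g i z - gram g i z0| * `|v| ^+ 2 <= 4 * (m / 8) * `|v| ^+ 2.
    by rewrite ler_wpM2r ?sqr_ge0 // ler_wpM2l // (le_trans (gK z hz)).
  have := le_trans q2 q3; rewrite ler_norml => /andP[q4 _].
  have -> : m / 2 * `|v| ^+ 2 = m * `|v| ^+ 2 - 4 * (m / 8) * `|v| ^+ 2 by field.
  move: q1 q4; lra.
- move=> z hz; rewrite -(subrK (gram g i z0) (gram g i z)).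
  apply: le_trans (ler_normD _ _) _; rewrite addrC lerD2l.
  exact: le_trans (gK z hz) Krho.
- by move=> z z' hz hz'; apply: rL; exact: rr.
Qed.

End LocalConstants.

#[local] Opaque curve_length riemannian_dist.

(** * The Riemannian distance in a chart *)

Section LocalGeometry.
Context {R : realType} {M : topologicalType} (S : surface R M) (g : riemannian_metric S).
Variables (i : idx S) (p : M) (rho m K B : R).
Local Notation z0 := (chart i p).
Hypothesis dp : dom i p.
Hypothesis rho0 : 0 < rho.
Hypothesis m0 : 0 < m.
Hypothesis B0 : 0 <= B.
Hypothesis ballU : forall z, `|z - z0| <= rho -> (chart i @` dom i) z.
Hypothesis gram_ge : forall z v, `|z - z0| <= rho -> m * `|v| ^+ 2 <= quad (gram g i z) v.
Hypothesis gram_le : forall z, `|z - z0| <= rho -> `|gram g i z| <= B.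

Definition chart_ball (r : R) : set M := [set q | dom i q /\ `|chart i q - z0| < r].

Let sm := Num.sqrt m.

Let sm0 : 0 < sm.
Proof. by rewrite sqrtr_gt0. Qed.

Lemma open_chart_ball r : open (chart_ball r).
Proof.
rewrite openE => q [dq qr]; rewrite /interior.
have h1 : \forall x \near q, dom i x by apply: open_nbhs_nbhs; split => //; exact: open_dom.
have h2 : \forall x \near q, `|chart i q - chart i x| < r - `|chart i q - z0|.
  have := chart_continuous dq; move=> /cvgrPdist_lt; apply; by rewrite subr_gt0.
near=> x; split; first by near: x.
have xr : `|chart i q - chart i x| < r - `|chart i q - z0| by near: x.
have -> : chart i x - z0 = (chart i q - z0) - (chart i q - chart i x).
  by rewrite opprB [RHS]addrC subrKA.
by apply: le_lt_trans (ler_normB _ _) _; rewrite addrC -ltrBrDr.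
Unshelve. all: by end_near. Qed.

Lemma speed_ge U c t : open U -> C1_curve S U c -> U t -> dom i (c t) ->
  `|chart i (c t) - z0| <= rho -> sm * `|derive1 (chart i \o c) t| <= speed g c t.
Proof.
move=> oU Hc Ut dt ht; rewrite (speed_chart g oU Hc Ut dt).
have -> : sm * `|derive1 (chart i \o c) t| =
    Num.sqrt (m * `|derive1 (chart i \o c) t| ^+ 2).
  by rewrite sqrtrM ?(ltW m0) // sqrtr_sqr normr_id.
apply: ler_wsqrtr; exact: gram_ge.
Qed.

Lemma speed_le U c t : open U -> C1_curve S U c -> U t -> dom i (c t) ->
  `|chart i (c t) - z0| <= rho ->
  speed g c t <= Num.sqrt (4 * B) * `|derive1 (chart i \o c) t|.
Proof.
move=> oU Hc Ut dt ht; rewrite (speed_chart g oU Hc Ut dt).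
set v := derive1 _ _.
have -> : Num.sqrt (4 * B) * `|v| = Num.sqrt (4 * B * `|v| ^+ 2).
  by rewrite [RHS]sqrtrM ?mulr_ge0 // sqrtr_sqr normr_id.
apply: ler_wsqrtr; apply: le_trans (ler_norm _) _; apply: le_trans (quad_bound _ _) _.
by rewrite ler_wpM2r ?sqr_ge0 // ler_wpM2l // gram_le.
Qed.

(* Globally defined and Lipschitz along curves, [bump] confines to the chart the short curves
   that start near [p]. *)
Definition bump (q : M) : R :=
  if `[< dom i q >] then
    posq (rho ^+ 2 - ((chart i q - z0) 0 0 ^+ 2 + (chart i q - z0) 0 1 ^+ 2))
  else 0.

Lemma bump_ge0 q : 0 <= bump q.
Proof. by rewrite /bump; case: ifP => // _; exact: posq_ge0. Qed.

Let norm_lt_of_sq (v : 'rV[R]_2) : v 0 0 ^+ 2 + v 0 1 ^+ 2 < rho ^+ 2 -> `|v| < rho.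
Proof.
move=> h; rewrite norm_row2 gt_max.
have P (x : R) : x ^+ 2 < rho ^+ 2 -> `|x| < rho.
  move=> hx; rewrite -(@ltr_pXn2r _ 2) // ?nnegrE ?(ltW rho0) //.
  by rewrite real_normK ?num_real.
have := sqr_ge0 (v 0 0); have := sqr_ge0 (v 0 1) => a b.
by rewrite !P //; lra.
Qed.

Lemma bump_gt0 q : 0 < bump q -> chart_ball rho q.
Proof.
rewrite /bump; case: ifP; last by rewrite ltxx.
move=> /asboolP dq /pos_of_posq; rewrite subr_gt0 => h; split => //.
exact: norm_lt_of_sq.
Qed.

Lemma bump_ge q : dom i q -> `|chart i q - z0| <= rho / 2 -> rho ^+ 4 / 4 <= bump q.
Proof.
move=> dq; rewrite /bump asboolT // norm_row2 ge_max => /andP[h0 h1].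
have P (x : R) : `|x| <= rho / 2 -> x ^+ 2 <= rho ^+ 2 / 4.
  move=> hx; rewrite -[X in X <= _]real_normK ?num_real //.
  have -> : rho ^+ 2 / 4 = (rho / 2) ^+ 2 by field.
  by rewrite ler_pXn2r // nnegrE divr_ge0 // ltW.
have a := P _ h0; have b := P _ h1.
rewrite /posq; set s := rho ^+ 2 - _.
have hs : rho ^+ 2 / 2 <= s by rewrite /s; lra.
have r2 : 0 <= rho ^+ 2 / 2 by rewrite divr_ge0 ?sqr_ge0.
rewrite max_r; last exact: le_trans hs.
have -> : rho ^+ 4 / 4 = (rho ^+ 2 / 2) ^+ 2 by field.
by rewrite ler_pXn2r // nnegrE // (le_trans r2).
Qed.

(** Here M being Hausdorff enters. The complement is open and [bump] vanishes on it, so extending by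
    0 outside the chart creates no irregularity. *)
Lemma closed_image_ball : closed (chart_inv i @` [set z | `|z - z0| <= rho]).
Proof.
apply: compact_closed; first exact: surface_hausdorff S.
apply: continuous_compact; last exact: compact_norm_ball.
apply: continuous_in_subspaceT => z /set_mem /= hz.
exact/chart_inv_continuous/ballU.
Qed.

Lemma bump_outside q : ~ (chart_inv i @` [set z | `|z - z0| <= rho]) q -> bump q = 0.
Proof.
move=> nq; apply/eqP; rewrite -[_ == _]negbK; apply/negP => h.
have /bump_gt0[dq hq] : 0 < bump q by rewrite lt_def h bump_ge0.
by apply: nq; exists (chart i q); [exact: ltW | exact: chartK].
Qed.

(** A slope bound for [bump] along curves: 2 rho^2 from [posq], 4 rho from the sum of two squares,
    1/sm from [speed_ge]. *)
Let Lb := 8 * rho ^+ 3 / sm.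

Let Lb0 : 0 <= Lb.
Proof. by rewrite divr_ge0 ?mulr_ge0 ?exprn_ge0 // ltW. Qed.

Lemma bump_along_curve U c t : open U -> C1_curve S U c -> U t ->
  C1_at (bump \o c) t /\ `|derive1 (bump \o c) t| <= Lb * speed g c t.
Proof.
move=> oU Hc Ut.
have [[z /= hz zc]|nq] := pselect ((chart_inv i @` [set z | `|z - z0| <= rho]) (c t)); last first.
  have oK : open (~` (chart_inv i @` [set z | `|z - z0| <= rho])).
    by apply: closed_openC; exact: closed_image_ball.
  have E0 := near_preimage_open setT (Hc.1 t Ut) oK nq.
  have E : \forall s \near t, (fun=> 0) s = (bump \o c) s.
    by apply: filterS E0 => s ns /=; rewrite bump_outside.
  split.
    apply: (near_eq_C1_at E); split; first exact: derivable_cst.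
    have -> : derive1 (fun=> 0 : R) = cst 0 by apply/funext => s; rewrite derive1_cst.
    exact: cst_continuous.
  rewrite -(nbhs_singleton (near_eq_derive1 E)) derive1_cst normr0.
  by rewrite mulr_ge0 // speed_ge0.
have dt : dom i (c t) by rewrite -zc; apply/dom_chart_inv/ballU.
have ct : chart i (c t) = z by rewrite -zc chart_invK //; exact: ballU.
pose u := chart i \o c; pose x k s := u s 0 k - z0 0 k.
have nu : \forall s \near t, C1_at u s by exact: C1_curve_chart oU Hc Ut dt.
pose h s := posq (rho ^+ 2 - (x 0 s ^+ 2 + x 1 s ^+ 2)).
pose E s := 2 * Num.max 0 (rho ^+ 2 - (x 0 s ^+ 2 + x 1 s ^+ 2)) *
  (- (2 * x 0 s * derive1 u s 0 0 + 2 * x 1 s * derive1 u s 0 1)).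
have nE : \forall s \near t, h s = (bump \o c) s.
  have nd := near_preimage_open setT (Hc.1 t Ut) (@open_dom _ _ S i) dt.
  apply: filterS nd => s ds; rewrite /= /bump asboolT // /h /x /u /=.
  by rewrite !mxE.
have cx k : {for t, continuous (x k)}.
  apply: continuousB; last exact: cst_continuous.
  exact: continuous_coord_curve (nbhs_singleton nu).
have [C1h Dh] : C1_at h t /\ derive1 h t = E t.
  apply: (@C1_at_of_is_derive R R^o h E t).
    apply: filterS nu => s us.
    have dx k : is_derive (s : R^o) 1 (x k : R^o -> R^o) (derive1 u s 0 k).
      have dB := is_deriveB (is_derive_coord k us) (is_derive_cst (z0 0 k : R^o) (s : R^o) 1).
      by rewrite -[derive1 u s 0 k]subr0; exact: dB.
    have d0 := dx 0; have d1 := dx 1.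
    have dq := is_derive_disc (rho ^+ 2) d0 d1.
    have := @is_derive1_comp R (posq : R -> R) (fun s => rho ^+ 2 - (x 0 s ^+ 2 + x 1 s ^+ 2)) s
      _ _ (is_derive_posq _) dq.
    by [].
  have cmax : {for t, continuous (fun s => Num.max 0 (rho ^+ 2 - (x 0 s ^+ 2 + x 1 s ^+ 2)))}.
    apply: (@continuous_max _ _ (cst (0 : R)) (fun s => rho ^+ 2 - (x 0 s ^+ 2 + x 1 s ^+ 2)) t).
      exact: cst_continuous.
    apply: continuousB; first exact: cst_continuous.
    by apply: continuousD; [exact: (continuousM (cx 0) (cx 0)) | exact: (continuousM (cx 1) (cx 1))].
  have cxd k : {for t, continuous (fun s => 2 * x k s * derive1 u s 0 k)}.
    apply: continuousM; last exact: continuous_derive1_coord (nbhs_singleton nu).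
    by apply: continuousM; [exact: cst_continuous | exact: cx].
  apply: continuousM; first by apply: continuousM; [exact: cst_continuous | exact: cmax].
  by apply: continuousN; apply: continuousD; exact: cxd.
split; first exact: near_eq_C1_at nE C1h.
rewrite -(nbhs_singleton (near_eq_derive1 nE)) Dh /E.
have xr k : `|x k t| <= rho.
  apply: le_trans hz; rewrite -ct; have := coord_le_norm (chart i (c t) - z0) 0 k.
  by rewrite !mxE.
have sp := speed_ge oU Hc Ut dt; rewrite ct in sp; have {sp} := sp hz.
rewrite -/u; set V := derive1 u t => sp.
set mx := Num.max _ _.
have mx0 : 0 <= mx by rewrite le_max lexx.
have mx1 : mx <= rho ^+ 2.
  rewrite ge_max sqr_ge0 /=; have := sqr_ge0 (x 0 t); have := sqr_ge0 (x 1 t); lra.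
have P k : `|2 * x k t * V 0 k| <= 2 * rho * `|V|.
  rewrite !normrM (ger0_norm (ler0n _ 2)) -!mulrA ler_wpM2l //.
  by apply: ler_pM => //; exact: coord_le_norm.
rewrite normrM normrN normrM (ger0_norm (ler0n _ 2)) (ger0_norm mx0).
apply: le_trans (_ : 2 * rho ^+ 2 * (4 * rho * `|V|) <= _).
  apply: ler_pM => //; first exact: mulr_ge0.
    by rewrite ler_wpM2l.
  apply: le_trans (ler_normD _ _) _; have := P 0; have := P 1; lra.
have -> : 2 * rho ^+ 2 * (4 * rho * `|V|) = 8 * rho ^+ 3 * `|V| by ring.
rewrite /Lb -[leRHS]mulrA; apply: ler_wpM2l.
  by rewrite mulr_ge0 ?exprn_ge0 // ltW.
by rewrite [leRHS]mulrC ler_pdivlMr // mulrC.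
Qed.

(** Along a curve of length at most [eps0], [bump] differs from its initial value by at most
    rho^4/16. If it is at least rho^4/4 at one end, it stays at least rho^4/8, even when that end is
    the final one. *)
Let eps0 := rho ^+ 4 / (16 * (Lb + 1)).

(** The estimate on [bump] holds on all of M, so it presupposes nothing about where the curve goes.
    Once it has confined the curve, the chart coordinates are Lipschitz along it with constant
    1/sm. *)
Lemma short_curve_confined c a b e : piecewise_C1 S c a b ->
  (curve_length g c a b <= e%:E)%E -> e <= eps0 ->
  (dom i (c a) /\ `|chart i (c a) - z0| <= rho / 2) \/
  (dom i (c b) /\ `|chart i (c b) - z0| <= rho / 2) ->
  forall t, t \in `[a, b] -> chart_ball rho (c t) /\
    `|chart i (c t) - chart i (c a)| <= e / sm.
Proof.
move=> Hc He ee0 ends.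
have ab := piecewise_C1_lt Hc.
have e0 : 0 <= e by rewrite -lee_fin; apply: le_trans He; exact: curve_length_ge0.
have lenle t : a < t <= b -> (curve_length g c a t <= e%:E)%E.
  by move=> h; apply: le_trans He; exact: curve_length_restrict.
have bumpL t : t \in `[a, b] -> `|bump (c t) - bump (c a)| <= Lb * e.
  rewrite in_itv /= le_eqVlt => /andP[/orP[/eqP <- _|at_ tb]].
    by rewrite subrr normr0 mulr_ge0.
  have h : a < t <= b by rewrite at_.
  have := @lipschitz_along_curves _ _ _ g setT bump Lb c a t openT Lb0
    (fun U c' oU Hc' _ s Us => bump_along_curve oU Hc' Us) (piecewise_C1_restrict Hc h)
    (fun _ _ => I).
  rewrite -lee_fin => /le_trans; apply; rewrite (EFinM Lb e).
  apply: lee_wpmul2l.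
    by rewrite lee_fin.
  exact: lenle.
have aab : a \in `[a, b] by rewrite in_itv /= lexx ltW.
have bab : b \in `[a, b] by rewrite in_itv /= lexx ltW.
have r4 : 0 < rho ^+ 4 by rewrite exprn_gt0.
have Le : Lb * e <= rho ^+ 4 / 16.
  have L1 : 0 < Lb + 1 by have := Lb0; lra.
  apply: le_trans (_ : (Lb + 1) * eps0 <= _).
    apply: ler_pM => //; lra.
  have -> : (Lb + 1) * eps0 = rho ^+ 4 / 16.
    by rewrite /eps0; move: L1; generalize (Lb + 1) => L L1; field; rewrite gt_eqF.
  by [].
have ca : rho ^+ 4 / 4 - rho ^+ 4 / 16 <= bump (c a).
  case: ends => [[d h]|[d h]]; have := bump_ge d h; first lra.
  have := bumpL b bab; rewrite ler_norml => /andP[]; lra.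
have inball t : t \in `[a, b] -> chart_ball rho (c t).
  move=> tab; apply: bump_gt0; have := bumpL t tab; rewrite ler_norml => /andP[]; lra.
move=> t tab; split; first exact: inball.
have [->|ta] := eqVneq t a.
  by rewrite subrr normr0 divr_ge0 // ltW.
have h : a < t <= b by move: tab; rewrite in_itv /= lt_def ta => /andP[-> ->].
apply: norm_le_coord => [|k l]; first by rewrite divr_ge0 // ltW.
rewrite (ord1 k) !mxE.
have smi0 : 0 <= sm^-1 by rewrite invr_ge0 ltW.
have Hl U c' : open U -> C1_curve S U c' -> (forall s, U s -> chart_ball rho (c' s)) ->
    forall s, U s -> C1_at ((fun q => chart i q 0 l) \o c') s /\
      `|derive1 ((fun q => chart i q 0 l) \o c') s| <= sm^-1 * speed g c' s.
  move=> oU Hc' Hb s Us; have [ds hs] := Hb s Us.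
  have nu := C1_curve_chart oU Hc' Us ds.
  have [h1 h2] := C1_at_coord l nu; split; first exact: h1.
  have -> : derive1 ((fun q => chart i q 0 l) \o c') s = derive1 (chart i \o c') s 0 l.
    exact: h2.
  apply: le_trans (coord_le_norm _ _ _) _.
  rewrite mulrC ler_pdivlMr // mulrC; apply: speed_ge oU Hc' Us ds _; exact: ltW.
have := lipschitz_along_curves (@open_chart_ball rho) smi0 Hl (piecewise_C1_restrict Hc h)
  (fun s sat => inball s (in_itv_left (proj2 (andP h)) sat)).
move=> H; rewrite -lee_fin; apply: le_trans H _.
rewrite mulrC EFinM; apply: lee_wpmul2l; last exact: lenle.
by rewrite lee_fin invr_ge0 ltW.
Qed.

Definition near_base (q : M) := dom i q /\ `|chart i q - z0| <= rho / 2.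

Lemma dist_lt_curve q q' (e : \bar R) : (riemannian_dist g q q' < e)%E ->
  exists c a b, [/\ piecewise_C1 S c a b, c a = q, c b = q' & (curve_length g c a b < e)%E].
Proof.
by move=> /ereal_inf_lt[_ [c [a [b [H Ha Hb ->]]]] l]; exists c, a, b.
Qed.

Lemma dist_le_length c a b : piecewise_C1 S c a b ->
  (riemannian_dist g (c a) (c b) <= curve_length g c a b)%E.
Proof. by move=> H; apply: ereal_inf_lbound; exists c, a, b. Qed.

Lemma dist_ge0 q q' : (0 <= riemannian_dist g q q')%E.
Proof.
by apply: le_ereal_inf_tmp => _ [c [a [b [_ _ _ ->]]]]; exact: curve_length_ge0.
Qed.

Lemma fine_length_lt c a b e : (curve_length g c a b < e%:E)%E ->
  exists2 e', e' < e & (curve_length g c a b <= e'%:E)%E.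
Proof.
move=> le; have fn : curve_length g c a b \is a fin_num.
  by rewrite ge0_fin_numE ?curve_length_ge0 // (lt_trans le) ?ltry.
by exists (fine (curve_length g c a b)); rewrite -?lte_fin fineK.
Qed.

Lemma dist_confined q q' e : (riemannian_dist g q q' < e%:E)%E -> e <= eps0 ->
  near_base q \/ near_base q' ->
  exists2 e', e' < e & [/\ chart_ball rho q, chart_ball rho q' &
    `|chart i q' - chart i q| <= e' / sm].
Proof.
move=> /dist_lt_curve[c [a [b [H <- <- /fine_length_lt[e' e'e le]]]]] e0 ends.
have ab := ltW (piecewise_C1_lt H).
have C := short_curve_confined H le (ltW (lt_le_trans e'e e0)) ends.
exists e' => //.
have aab : a \in `[a, b] by rewrite in_itv /= lexx ab.
have bab : b \in `[a, b] by rewrite in_itv /= lexx ab.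
by have [h1 _] := C a aab; have [h2 h3] := C b bab; split.
Qed.

Lemma dist_ge q q' : near_base q \/ near_base q' -> dom i q -> dom i q' ->
  sm * `|chart i q' - chart i q| <= eps0 ->
  ((sm * `|chart i q' - chart i q|)%:E <= riemannian_dist g q q')%E.
Proof.
move=> nb _ _ h; rewrite leNgt; apply/negP => lt.
have [e' he' [_ _]] := dist_confined lt h nb.
by rewrite ler_pdivlMr // mulrC leNgt he'.
Qed.

Lemma dist_le (z z' : 'rV[R]_2) : `|z - z0| < rho -> `|z' - z0| < rho ->
  (riemannian_dist g (chart_inv i z) (chart_inv i z')
     <= (Num.sqrt (4 * B) * `|z' - z|)%:E)%E.
Proof.
move=> hz hz'; pose v := z' - z; pose u (t : R) := z + t *: v.
have du t : C1_at u t /\ derive1 u t = v.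
  apply: (@C1_at_of_is_derive R _ u (cst v) t); last exact: cst_continuous.
  near=> s; have := @is_derive_line R _ _ id z v s (@derivable_id _ _ _ _).
  by rewrite derive_id.
pose U := [set t | `|u t - z0| < rho].
have oU : open U.
  rewrite (_ : U = (fun t => `|u t - z0|) @^-1` [set x | x < rho]) //.
  apply: open_comp; last exact: open_lt.
  move=> t _; apply: (@continuous_comp _ _ _ (fun t => u t - z0) Num.Def.normr t).
    apply: continuousB; last exact: cst_continuous.
    exact: C1_at_continuous (du t).1.
  exact: norm_continuous.
have sU : `[0, 1]%classic `<=` U.
  move=> t /=; rewrite in_itv /= => ht; rewrite /U /= distrC.
  by apply: in_ball_segment ht _ _; rewrite distrC.
pose c := chart_inv i \o u.
have Ub t : U t -> `|u t - z0| <= rho by exact: ltW.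
have Hc : C1_curve S U c.
  apply: C1_curve_of_chart oU (fun t _ => (du t).1) _ => t /Ub; exact: ballU.
have sg : C1_segment S c 0 1 by split => //; exists U, c.
have := dist_le_length (piecewise_C1_segment sg).
rewrite /c /= /u scale0r addr0 scale1r /v addrC subrK => /le_trans; apply.
rewrite -/v -/u -/c.
have [_ [_ [_ _ _ _ [_ _ mc _]]]] := segment_extension g sg.
rewrite (curve_length_oo mc).
have k0 : 0 <= Num.sqrt (4 * B) * `|v| by rewrite mulr_ge0 ?sqrtr_ge0.
apply: le_trans (ge0_integral_oo_leZl (f2 := fun=> 1) k0 _ _ mc _ _) _.
- exact: speed_ge0.
- by [].
- exact: measurable_cst.
- move=> t t01; rewrite mulr1.
  have Ut : U t by apply: sU; exact: subset_itv_oo_cc.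
  have dt : dom i (c t) by apply/dom_chart_inv/ballU/Ub.
  have ct : chart i (c t) = u t by rewrite /c /= chart_invK //; exact/ballU/Ub.
  apply: le_trans (speed_le oU Hc Ut dt _) _; first by rewrite ct; exact: Ub.
  have -> : derive1 (chart i \o c) t = derive1 u t; last by rewrite (du t).2.
  have E : \forall s \near t, (chart i \o c) s = u s.
    apply: filterS (open_nbhs_nbhs (conj oU Ut)) => s Us.
    by rewrite /c /= chart_invK //; exact/ballU/Ub.
  exact: nbhs_singleton (near_eq_derive1 E).
- by rewrite integral_cst //= lebesgue_measure_itv /= lte_fin ltr01 oppr0 addr0 !mule1.
Unshelve. all: by end_near. Qed.

(** A linear map in the chart centred at p fixes p, so it sends curves from q to p to curves ending
    at p and stretches their lengths by at most theta, as long as they stay in the ball of radius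
    s. *)
Lemma dist_push (T : 'M[R]_2) (theta s : R) q e : 0 < theta -> s <= rho ->
  (forall w v : 'rV[R]_2, `|w| < s -> `|w *m T| <= rho /\
     quad (gram g i (z0 + w *m T)) (v *m T) <= theta ^+ 2 * quad (gram g i (z0 + w)) v) ->
  near_base q -> (riemannian_dist g q p < e%:E)%E -> e <= eps0 ->
  `|chart i q - z0| + e / sm < s ->
  (riemannian_dist g (chart_inv i (z0 + (chart i q - z0) *m T)) p
     <= theta%:E * riemannian_dist g q p)%E.
Proof.
move=> th0 srho HT nq de ee0 hs.
pose P x := chart_inv i (z0 + (chart i x - z0) *m T).
have Pp : P p = p by rewrite /P subrr mul0mx addr0 chartK.
have HP U c' : open U -> C1_curve S U c' -> (forall t, U t -> chart_ball s (c' t)) ->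
    C1_curve S U (P \o c') /\ forall t, U t -> speed g (P \o c') t <= theta * speed g c' t.
  move=> oU Hc' Hb; pose u := chart i \o c'; pose u2 t := z0 + (u t - z0) *m T.
  have nu t (Ut : U t) := C1_curve_chart oU Hc' Ut (Hb t Ut).1.
  have u2U t : U t -> (chart i @` dom i) (u2 t).
    move=> Ut; apply: ballU; rewrite /u2 addrC addKr.
    by have [] := HT (u t - z0) 0 (Hb t Ut).2.
  have Hc2 : C1_curve S U (P \o c').
    apply: (@C1_curve_of_chart _ _ S U i u2 oU _ u2U) => t Ut.
    exact: (C1_at_affine z0 T (nu t Ut)).1.
  split => // t Ut; have [dt ht] := Hb t Ut.
  have dt2 : dom i ((P \o c') t) by apply/dom_chart_inv/u2U.
  rewrite (speed_chart g oU Hc2 Ut dt2) (speed_chart g oU Hc' Ut dt).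
  have -> : chart i ((P \o c') t) = u2 t by rewrite /P /= chart_invK //; exact: u2U.
  have -> : derive1 (chart i \o (P \o c')) t = derive1 u t *m T.
    rewrite -(C1_at_affine z0 T (nu t Ut)).2.
    have E : \forall x \near t, (chart i \o (P \o c')) x = u2 x.
      apply: filterS (open_nbhs_nbhs (conj oU Ut)) => x Ux.
      by rewrite /P /= chart_invK //; exact: u2U.
    exact: nbhs_singleton (near_eq_derive1 E).
  have -> : theta = Num.sqrt (theta ^+ 2) by rewrite sqrtr_sqr gtr0_norm.
  rewrite -sqrtrM ?sqr_ge0 //; apply: ler_wsqrtr.
  have [_] := HT (u t - z0) (derive1 u t) ht.
  by rewrite /u2 /= [z0 + (_ - z0)]addrC subrK.
have main c a b : piecewise_C1 S c a b -> c a = q -> c b = p ->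
    (curve_length g c a b <= e%:E)%E ->
    (riemannian_dist g (P q) p <= theta%:E * curve_length g c a b)%E.
  move=> Hc ca cb le.
  have HD t : t \in `[a, b] -> chart_ball s (c t).
    move=> tab; have [] := short_curve_confined Hc le ee0 _ tab; first by left; rewrite ca.
    rewrite ca => -[dt _] ht; split => //; apply: le_lt_trans hs.
    have -> : chart i (c t) - z0 = (chart i q - z0) + (chart i (c t) - chart i q).
      by rewrite [RHS]addrC subrKA.
    by apply: le_trans (ler_normD _ _) _; rewrite lerD2l.
  have [H1 H2] := piecewise_C1_push (@open_chart_ball s) (ltW th0) HP Hc HD.
  by apply: le_trans H2; rewrite -{1}Pp -ca -cb; exact: dist_le_length H1.
(* A competitor longer than e may leave the chart and cannot be pushed; [c0] is shorter and is
   pushed instead. *)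
have [c0 [a0 [b0 [H0 ca0 cb0 /ltW l0]]]] := dist_lt_curve de.
rewrite -lee_pdivrMl //; apply: le_ereal_inf_tmp => _ [c [a [b [Hc ca cb ->]]]].
rewrite lee_pdivrMl //.
have [l|l] := leP (curve_length g c a b) e%:E; first exact: main.
apply: le_trans (main _ _ _ H0 ca0 cb0 l0) _.
apply: lee_wpmul2l; first by rewrite lee_fin ltW.
exact: le_trans l0 (ltW l).
Qed.

End LocalGeometry.

(** * Stretching of metrics by almost scalar matrices *)

Section QuadraticFormScaling.
Context {R : realType}.
Implicit Types (A T : 'M[R]_2) (v w : 'rV[R]_2).

Lemma norm_scalar_add (mu d : R) T w : `|T - mu%:M| <= d ->
  `|w *m T - mu *: w| <= 2 * d * `|w|.
Proof.
move=> h; have -> : w *m T - mu *: w = w *m (T - mu%:M).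
  by rewrite mulmxBr mul_mx_scalar.
apply: le_trans (norm_mulmx _ _) _; rewrite -!mulrA ler_wpM2l // mulrC.
by rewrite ler_wpM2r.
Qed.

Lemma quadD_le A x y (B : R) : `|A| <= B ->
  quad A (x + y) <= quad A x + 8 * B * `|x| * `|y| + 4 * B * `|y| ^+ 2.
Proof.
move=> hA; rewrite !quadE !mxE.
have P i j : `|x 0 i * A i j * y 0 j| <= B * `|x| * `|y|.
  rewrite !normrM; apply: ler_pM => //; last exact: coord_le_norm.
  rewrite mulrC; apply: ler_pM => //; last exact: coord_le_norm.
  by apply: le_trans hA; exact: coord_le_norm.
have Q i j : `|y 0 i * A i j * x 0 j| <= B * `|x| * `|y|.
  rewrite !normrM [leRHS]mulrAC; apply: ler_pM => //; last exact: coord_le_norm.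
  rewrite mulrC; apply: ler_pM => //; last exact: coord_le_norm.
  by apply: le_trans hA; exact: coord_le_norm.
have q : y 0 0 * A 0 0 * y 0 0 + y 0 1 * A 1 0 * y 0 0 +
    (y 0 0 * A 0 1 * y 0 1 + y 0 1 * A 1 1 * y 0 1) <= 4 * B * `|y| ^+ 2.
  rewrite -quadE; apply: le_trans (ler_norm _) _; apply: le_trans (quad_bound _ _) _.
  by rewrite ler_wpM2r ?sqr_ge0 // ler_wpM2l.
have := le_trans (ler_norm _) (P 0 0); have := le_trans (ler_norm _) (P 0 1).
have := le_trans (ler_norm _) (P 1 0); have := le_trans (ler_norm _) (P 1 1).
have := le_trans (ler_norm _) (Q 0 0); have := le_trans (ler_norm _) (Q 0 1).
have := le_trans (ler_norm _) (Q 1 0); have := le_trans (ler_norm _) (Q 1 1).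
move: q; lra.
Qed.

(** [A] is the metric at the source and [A'] at the image. [T] stretches by |mu| up to O(d),
    changing the metric costs 1 + O(k), and m makes both errors relative. The first factor is
    squared as well, through 1 + x <= (1 + x)^2, so that the bound has the shape theta^2. *)
Lemma quad_scaling A A' T (m B mu d k : R) v : 0 < m -> 0 <= d -> 0 <= k -> 0 <= B ->
  `|A| <= B -> (forall v, m * `|v| ^+ 2 <= quad A v) -> `|A' - A| <= k ->
  `|T - mu%:M| <= d ->
  quad A' (v *m T) <=
    ((1 + 4 / m * k) * (`|mu| + (8 * B / m + 1) * d)) ^+ 2 * quad A v.
Proof.
move=> m0 d0 k0 B0 hA Am hk hT.
have vT : v *m T = mu *: v + (v *m T - mu *: v) by rewrite addrC subrK.
have hy := norm_scalar_add v hT; set y := v *m T - mu *: v in vT hy.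
have Qm (x : 'rV[R]_2) : `|x| ^+ 2 <= quad A x / m by rewrite ler_pdivlMr // mulrC.
set Q := quad A v.
have Q0 : 0 <= Q by apply: le_trans (Am v); rewrite mulr_ge0 ?sqr_ge0 // ltW.
set b := 8 * B / m.
have b0 : 0 <= b by rewrite /b divr_ge0 ?mulr_ge0 // ltW.
have s1 : quad A (v *m T) <= (`|mu| + (b + 1) * d) ^+ 2 * Q.
  rewrite vT; apply: le_trans (quadD_le _ _ hA) _.
  have -> : quad A (mu *: v) = mu ^+ 2 * Q by rewrite /Q !quadE !mxE; ring.
  have h1 : 8 * B * `|mu *: v| * `|y| <= 2 * b * d * `|mu| * Q.
    rewrite normrZ; apply: le_trans (_ : 8 * B * (`|mu| * `|v|) * (2 * d * `|v|) <= _).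
      by rewrite ler_wpM2l // !mulr_ge0.
    have -> : 8 * B * (`|mu| * `|v|) * (2 * d * `|v|) = 16 * B * `|mu| * d * `|v| ^+ 2 by ring.
    have -> : 2 * b * d * `|mu| * Q = 16 * B * `|mu| * d * (Q / m) by rewrite /b; ring.
    by rewrite ler_wpM2l // !mulr_ge0.
  have h2 : 4 * B * `|y| ^+ 2 <= 2 * b * d ^+ 2 * Q.
    apply: le_trans (_ : 4 * B * (2 * d * `|v|) ^+ 2 <= _).
      rewrite ler_wpM2l ?mulr_ge0 // ler_pXn2r // nnegrE //.
      by rewrite !mulr_ge0.
    have -> : 4 * B * (2 * d * `|v|) ^+ 2 = 16 * B * d ^+ 2 * `|v| ^+ 2 by ring.
    have -> : 2 * b * d ^+ 2 * Q = 16 * B * d ^+ 2 * (Q / m) by rewrite /b; ring.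
    by rewrite ler_wpM2l // !mulr_ge0 ?sqr_ge0.
  have e : (`|mu| + (b + 1) * d) ^+ 2 = mu ^+ 2 + 2 * `|mu| * (b + 1) * d + (b + 1) ^+ 2 * d ^+ 2.
    by rewrite -[mu ^+ 2]real_normK ?num_real //; ring.
  rewrite e.
  have h3 : 0 <= (2 * `|mu| * d + (b ^+ 2 + 1) * d ^+ 2) * Q.
    by rewrite mulr_ge0 // addr_ge0 // mulr_ge0 ?mulr_ge0 ?sqr_ge0 // addr_ge0 ?sqr_ge0.
  move: h1 h2 h3; lra.
have := quad_bound (A' - A) (v *m T); rewrite quadB ler_norml => /andP[_ s2].
have s3 : quad A' (v *m T) <= (1 + 4 / m * k) * quad A (v *m T).
  have : 4 * `|A' - A| * `|v *m T| ^+ 2 <= 4 * k * (quad A (v *m T) / m).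
    by apply: ler_pM; rewrite ?mulr_ge0 ?sqr_ge0 ?ler_wpM2l.
  have -> : 4 * k * (quad A (v *m T) / m) = 4 / m * k * quad A (v *m T) by ring.
  move: s2; lra.
apply: le_trans s3 _; set x := 4 / m * k.
have x0 : 0 <= x by rewrite /x mulr_ge0 // divr_ge0 // ltW.
apply: le_trans (_ : (1 + x) * ((`|mu| + (b + 1) * d) ^+ 2 * Q) <= _).
  by rewrite ler_wpM2l // addr_ge0.
rewrite [in leRHS]exprMn -[leRHS]mulrA; apply: ler_wpM2r.
  by rewrite mulr_ge0 ?sqr_ge0.
have : 0 <= x + x ^+ 2 by rewrite addr_ge0 ?sqr_ge0.
lra.
Qed.

End QuadraticFormScaling.

(** * Local comparison of the distance with the chart norm *)

Section LocalGeometryTheorem.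
Context {R : realType} {M : topologicalType} (S : surface R M) (g : riemannian_metric S).

(** In the last property the factor equals 1 for mu = 1 and d = 0, and the change of metric
    contributes an error of order |z| (|1 - mu| + d). With d = O(|z| |1 - mu|) the whole error is
    O(|z| |1 - mu|), the precision that monotonicity along the curve needs. *)
Theorem local_geometry (i : idx S) (p : M) : dom i p ->
  let e := fun z : 'rV[R]_2 => chart_inv i (chart i p + z) in
  exists r L : R, [/\ 0 < r, 1 <= L,
    forall z : 'rV[R]_2, `|z| <= r -> (chart i @` dom i) (chart i p + z),
    forall q eta, 0 < eta -> eta <= r -> (riemannian_dist g q p <= eta%:E)%E ->
      dom i q /\ `|chart i q - chart i p| <= L * eta &
    [/\ forall z z' : 'rV[R]_2, `|z| <= r -> `|z'| <= r ->
          (`|z' - z|%:E <= L%:E * riemannian_dist g (e z) (e z'))%E,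
        forall z z' : 'rV[R]_2, `|z| <= r -> `|z'| <= r ->
          (riemannian_dist g (e z) (e z') <= (L * `|z' - z|)%:E)%E &
        forall (z : 'rV[R]_2) (T : 'M[R]_2) (mu d : R), `|z| <= r -> `|mu| <= 2 ->
          0 <= d -> d <= 1 -> `|T - mu%:M| <= d ->
          (riemannian_dist g (e (z *m T)) p <=
            ((1 + L * `|z| * (`|1 - mu| + 2 * d)) * (`|mu| + L * d))%:E
               * riemannian_dist g (e z) p)%E]].
Proof.
move=> dp e.
have [rho [m [K [B [rho0 m0 K0 B0 [bU bg bl bK]]]]]] := gram_local_bounds g dp.
set z0 := chart i p.
pose sm := Num.sqrt m; have sm0 : 0 < sm by rewrite sqrtr_gt0.
pose Lb := 8 * rho ^+ 3 / sm.
pose eps0 := rho ^+ 4 / (16 * (Lb + 1)).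
have Lb0 : 0 <= Lb by rewrite /Lb divr_ge0 ?mulr_ge0 ?exprn_ge0 // ltW.
have eps00 : 0 < eps0.
  by rewrite divr_gt0 ?exprn_gt0 // mulr_gt0 // ltr_wpDl.
pose Cu := Num.sqrt (4 * B); have Cu0 : 0 <= Cu by exact: sqrtr_ge0.
(* A curve from [e z] to [p] of length at most (Cu + 1) |z| stays within q0 * |z| of the base point.
   Metrics are thus compared only at scale |z|, the source of the factor |z| in the last
   property. *)
pose q0 := 2 + (Cu + 1) / sm.
have Cq : 0 <= (Cu + 1) / sm by rewrite divr_ge0 ?addr_ge0 // ltW.
have q0_ge : 2 <= q0 by rewrite /q0 lerDl.
pose r1 := rho / (4 * q0).
have den1 : 0 < 4 * q0 by lra.
(* This keeps the three lengths 2r, 2r sm and (Cu + 1) r below [eps0]. *)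
pose r2 := eps0 / (2 * sm + Cu + 2).
have den2 : 0 < 2 * sm + Cu + 2 by have := ltW sm0; lra.
pose r := Num.min (Num.min r1 r2) (rho / 8).
have r0 : 0 < r.
  by rewrite !lt_min (divr_gt0 rho0 den1) (divr_gt0 eps00 den2) divr_gt0.
have rr1 : r <= r1 by rewrite ge_min ge_min lexx.
have rr2 : r <= r2 by rewrite ge_min ge_min lexx orbT.
have rr3 : r <= rho / 8 by rewrite ge_min lexx orbT.
pose L := 1 + sm^-1 * 2 + Cu + 4 / m * K * q0 + (8 * B / m + 1).
have smi : 0 <= sm^-1 by rewrite invr_ge0 ltW.
have b0 : 0 <= 8 * B / m by rewrite divr_ge0 ?mulr_ge0 // ltW.
have k0 : 0 <= 4 / m * K * q0.
  by rewrite mulr_ge0 ?(le_trans _ q0_ge) // mulr_ge0 // divr_ge0 // ltW.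
have ball (z : 'rV[R]_2) : `|z| <= r -> `|z0 + z - z0| <= rho.
  by rewrite addrAC subrr add0r; move: rr3; lra.
have nbz (z : 'rV[R]_2) : `|z| <= r -> near_base i p rho (e z).
  move=> hz; have Iz := bU _ (ball z hz); split; first exact: dom_chart_inv.
  by rewrite /e chart_invK // addrAC subrr add0r; move: rr3; lra.
have che (z : 'rV[R]_2) : `|z| <= r -> chart i (e z) = z0 + z.
  by move=> hz; rewrite /e chart_invK //; exact/bU/ball.
have addB (x y w : 'rV[R]_2) : (x + y) - (x + w) = y - w.
  by rewrite opprD addrACA subrr add0r.
have rr2' : r * (2 * sm + Cu + 2) <= eps0 by rewrite -ler_pdivlMr.
exists r, L; split => //.
- by rewrite /L; lra.
- by move=> z /ball /bU.
- move=> q eta eta0 etar hd.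
  have np : near_base i p rho p by split => //; rewrite subrr normr0 divr_ge0 // ltW.
  have lt2 : (riemannian_dist g q p < (2 * eta)%:E)%E.
    by apply: le_lt_trans hd _; rewrite lte_fin; lra.
  have le2 : 2 * eta <= eps0.
    apply: le_trans rr2'; have : 0 <= r * (2 * sm + Cu) by rewrite mulr_ge0 ?(ltW r0) //; have := ltW sm0; lra.
    lra.
  have [e' e'e [[dq _] _ h]] := dist_confined rho0 m0 bU bg lt2 le2 (or_intror np).
  split => //; rewrite distrC; apply: le_trans h _.
  apply: le_trans (_ : (2 * eta) / sm <= _); first by rewrite ler_wpM2r // ltW.
  rewrite mulrAC ler_wpM2r ?(ltW eta0) // /L.
  have : 2 / sm = sm^-1 * 2 by rewrite mulrC.
  lra.
split.
- move=> z z' hz hz'.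
  have dz := dom_chart_inv (bU _ (ball z hz)); have dz' := dom_chart_inv (bU _ (ball z' hz')).
  have small : sm * `|chart i (e z') - chart i (e z)| <= eps0.
    rewrite !che // addB.
    have h : `|z' - z| <= 2 * r by apply: le_trans (ler_normB _ _) _; lra.
    apply: le_trans (ler_wpM2l (ltW sm0) h) _; apply: le_trans rr2'.
    have : 0 <= r * (Cu + 2) by rewrite mulr_ge0 ?(ltW r0) // addr_ge0.
    lra.
  have := dist_ge rho0 m0 bU bg (or_introl (nbz z hz)) dz dz' small.
  rewrite !che // addB => h.
  have L0 : 0 < L by rewrite /L; lra.
  apply: le_trans (_ : L%:E * (sm * `|z' - z|)%:E <= _)%E; last first.
    by apply: lee_wpmul2l h; rewrite lee_fin ltW.
  rewrite -EFinM lee_fin mulrA ler_peMl //.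
  have -> : 1 = sm^-1 * sm by rewrite mulVf // gt_eqF.
  apply: ler_wpM2r; [exact: ltW | rewrite /L; lra].
- move=> z z' hz hz'.
  have lt (w : 'rV[R]_2) : `|w| <= r -> `|z0 + w - z0| < rho.
    by rewrite addrAC subrr add0r; move: rr3; lra.
  have := dist_le B0 bU bl (lt z hz) (lt z' hz').
  rewrite addB => /le_trans; apply; rewrite lee_fin ler_wpM2r // -/Cu /L; lra.
move=> z T mu d hz hmu d0 d1 hT.
have [z_eq0|zn0] := eqVneq z 0.
  rewrite z_eq0 mul0mx /e addr0 chartK //.
  have e0 : (riemannian_dist g p p = 0)%E.
    apply/eqP; rewrite eq_le dist_ge0 andbT.
    have z00 : `|z0 - z0| < rho by rewrite subrr normr0.
    have := dist_le B0 bU bl z00 z00.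
    by rewrite /z0 chartK // subrr normr0 mulr0.
  by rewrite e0 mule0.
have zp : 0 < `|z| by rewrite normr_gt0.
set f1 := 1 + _; set f2 := `|mu| + _.
have L0 : 0 < L by rewrite /L; lra.
have D0 : 0 <= `|1 - mu| + 2 * d by rewrite addr_ge0 // mulr_ge0.
have f1E : f1 = 1 + L * `|z| * (`|1 - mu| + 2 * d) by [].
have f10 : 1 <= f1.
  by rewrite f1E lerDl; apply: mulr_ge0 D0; apply: mulr_ge0 => //; exact: ltW.
have f20 : 0 <= f2 by rewrite /f2 addr_ge0 // mulr_ge0 // ltW.
(* [dist_push] requires a positive factor. If it vanishes then mu = d = 0 and T = 0, and the image
   point is p itself. *)
have [f2_eq0|f2n0] := eqVneq f2 0.
  have Ld0 : 0 <= L * d by rewrite mulr_ge0 // ltW.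
  have mu0 : mu = 0.
    by apply/eqP; rewrite -normr_le0; move: f2_eq0; rewrite /f2; lra.
  have d_eq0 : d = 0.
    move/eqP: f2_eq0; rewrite /f2 mu0 normr0 add0r mulf_eq0 (gt_eqF L0) /=.
    by move/eqP.
  have T0 : T = 0.
    apply/eqP; rewrite -normr_le0; move: hT; rewrite mu0 d_eq0.
    by rewrite (_ : 0%:M = 0) ?subr0 //; apply/matrixP => a b; rewrite !mxE mul0rn.
  rewrite T0 mulmx0 f2_eq0 mulr0 mul0e /e addr0 chartK //.
  have z00 : `|z0 - z0| < rho by rewrite subrr normr0.
  have := dist_le B0 bU bl z00 z00.
  by rewrite /z0 chartK // subrr normr0 mulr0.
have f2p : 0 < f2 by rewrite lt_def f2n0.
pose ee := (Cu + 1) * `|z|.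
have de : (riemannian_dist g (e z) p < ee%:E)%E.
  have h1 : `|z0 + z - z0| < rho by rewrite addrAC subrr add0r; move: rr3; lra.
  have h2 : `|z0 - z0| < rho by rewrite subrr normr0.
  have := dist_le B0 bU bl h1 h2; rewrite {2}/z0 chartK // => /le_lt_trans; apply.
  by rewrite lte_fin opprD addNKr normrN /ee -/Cu; lra.
have eee : ee <= eps0.
  rewrite /ee; apply: le_trans rr2'.
  apply: le_trans (_ : (Cu + 1) * r <= _); first by rewrite ler_wpM2l // addr_ge0.
  have : 0 <= r * (2 * sm + 1) by rewrite mulr_ge0 ?(ltW r0) //; have := ltW sm0; lra.
  lra.
have s_rho : `|z| * q0 <= rho / 4.
  apply: le_trans (_ : r * q0 <= _); first by rewrite ler_wpM2r // (le_trans _ q0_ge).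
  have : r * (4 * q0) <= rho by rewrite -ler_pdivlMr.
  lra.
have small : `|chart i (e z) - z0| + ee / sm < `|z| * q0.
  rewrite che // addrAC subrr add0r /ee.
  have -> : `|z| + (Cu + 1) * `|z| / sm = `|z| * (1 + (Cu + 1) / sm) by ring.
  by rewrite ltr_pM2l // /q0 ltrD2r ltr1n.
have wT (w : 'rV[R]_2) : `|w *m T| <= 4 * `|w|.
  have := norm_scalar_add w hT; have -> : w *m T = mu *: w + (w *m T - mu *: w).
    by rewrite addrC subrK.
  rewrite [mu *: w + _ - mu *: w]addrAC subrr add0r => h.
  apply: le_trans (ler_normD _ _) _; rewrite normrZ.
  have := ler_wpM2r (normr_ge0 w) hmu; have := ler_wpM2r (normr_ge0 w) d1.
  by move: h; lra.
have HT (w v : 'rV[R]_2) : `|w| < `|z| * q0 -> `|w *m T| <= rho /\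
    quad (gram g i (z0 + w *m T)) (v *m T) <= (f1 * f2) ^+ 2 * quad (gram g i (z0 + w)) v.
  move=> hw; have wr : `|w| <= rho by lra.
  have wTr : `|w *m T| <= rho by apply: le_trans (wT w) _; lra.
  split=> //.
  have b1 : `|z0 + w - z0| <= rho by rewrite addrAC subrr add0r.
  have b2 : `|z0 + w *m T - z0| <= rho by rewrite addrAC subrr add0r.
  have dTw : `|w *m T - w| <= (`|z| * q0) * (`|1 - mu| + 2 * d).
    have -> : w *m T - w = (w *m T - mu *: w) - (1 - mu) *: w.
      by rewrite scalerBl scale1r opprB addrA subrK.
    apply: le_trans (ler_normB _ _) _; rewrite normrZ.
    have := norm_scalar_add w hT; have := ler_wpM2r D0 (ltW hw).
    lra.
  have hk := bK _ _ b1 b2; rewrite addB in hk.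
  have := @quad_scaling _ _ _ _ _ _ _ _ _ v m0 d0 (mulr_ge0 K0 (normr_ge0 (w *m T - w))) B0
    (bl _ b1) (fun x => bg _ x b1) hk hT.
  have Q0 : 0 <= quad (gram g i (z0 + w)) v.
    by apply: le_trans (bg _ v b1); rewrite mulr_ge0 ?sqr_ge0 // ltW.
  move=> /le_trans; apply; apply: ler_wpM2r => //.
  have a1 : 4 / m * (K * `|w *m T - w|) <= L * `|z| * (`|1 - mu| + 2 * d).
    apply: le_trans (_ : 4 / m * (K * ((`|z| * q0) * (`|1 - mu| + 2 * d))) <= _).
      by rewrite ler_wpM2l ?divr_ge0 ?(ltW m0) // ler_wpM2l.
    have -> : 4 / m * (K * ((`|z| * q0) * (`|1 - mu| + 2 * d))) =
      (4 / m * K * q0) * (`|z| * (`|1 - mu| + 2 * d)) by ring.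
    rewrite -[leRHS]mulrA; apply: ler_wpM2r; first exact: mulr_ge0.
    rewrite /L; lra.
  have a2 : (8 * B / m + 1) * d <= L * d by apply: ler_wpM2r => //; rewrite /L; lra.
  have p0 : 0 <= 4 / m * (K * `|w *m T - w|).
    by rewrite mulr_ge0 ?divr_ge0 ?(ltW m0) // mulr_ge0.
  rewrite ler_pXn2r // ?nnegrE.
  - by apply: ler_pM; rewrite ?f1E ?/f2 ?addr_ge0 // ?mulr_ge0 // ?addr_ge0 // ?lerD2l.
  - by rewrite mulr_ge0 // ?addr_ge0 // mulr_ge0 // addr_ge0.
  - by rewrite mulr_ge0 // (le_trans ler01).
have zs : `|z| * q0 <= rho by lra.
have th0 : 0 < f1 * f2 by rewrite mulr_gt0 // (lt_le_trans ltr01).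
have := dist_push dp rho0 m0 bU bg th0 zs HT (nbz z hz) de eee small.
by rewrite che // addrAC subrr add0r.
Qed.

End LocalGeometryTheorem.

(** * The local stable curve *)

Section SaddleCoordinates.
Context {R : realType}.

Lemma mxBE (m n : nat) (A A' : 'M[R]_(m, n)) i j : (A - A') i j = A i j - A' i j.
Proof. by rewrite !mxE. Qed.

Lemma eigenbasis (A : 'M[R]_2) (ls lu : R) : eigenvalue A ls -> eigenvalue A lu -> ls != lu ->
  exists (vs vu : 'rV[R]_2) (Q : 'M[R]_2),
    [/\ vs *m A = ls *: vs, vu *m A = lu *: vu,
       forall x y, ((x *: vs + y *: vu) *m Q) 0 0 = x /\ ((x *: vs + y *: vu) *m Q) 0 1 = y &
       forall w : 'rV[R]_2, w = (w *m Q) 0 0 *: vs + (w *m Q) 0 1 *: vu].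
Proof.
move=> /eigenvalueP[vs As s0] /eigenvalueP[vu Au u0] neq.
pose P : 'M[R]_2 := \matrix_(k, j) (if k == 0 then vs 0 j else vu 0 j).
have wP (w : 'rV[R]_2) : w *m P = w 0 0 *: vs + w 0 1 *: vu.
  apply/rowP => j; rewrite !mxE big_ord_recl big_ord1 !mxE /=.
  by congr (_ + w _ _ * _); apply/val_inj.
have Pu : P \in unitmx.
  rewrite unitmxE unitfE; apply/negP => /det0P[w w0]; rewrite wP => E.
  have := congr1 (fun v => v *m A) E; rewrite mul0mx mulmxDl -!scalemxAl As Au => E2.
  have y0 : (w 0 1 * (lu - ls)) *: vu = 0.
    have : w 0 0 *: (ls *: vs) + w 0 1 *: (lu *: vu) - ls *: (w 0 0 *: vs + w 0 1 *: vu) = 0.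
      by rewrite E2 E scaler0 subr0.
    rewrite scalerDr !scalerA opprD addrACA (mulrC ls) subrr add0r -scalerBl.
    by move=> <-; congr (_ *: _); ring.
  have w1 : w 0 1 = 0.
    move/eqP: y0; rewrite scaler_eq0 (negPf u0) orbF mulf_eq0 subr_eq0 [lu == ls]eq_sym (negPf neq) orbF.
    by move/eqP.
  have w00 : w 0 0 = 0.
    move/eqP: E; rewrite w1 scale0r addr0 scaler_eq0 (negPf s0) orbF.
    by move/eqP.
  by case/eqP: w0; rewrite [w]row2E w1 w00 !scale0r addr0.
exists vs, vu, (invmx P); split => //.
- move=> x y; pose w : 'rV[R]_2 := x *: delta_mx 0 0 + y *: delta_mx 0 1.
  have w0 : w 0 0 = x by rewrite !mxE /= mulr1 mulr0 addr0.
  have w1 : w 0 1 = y by rewrite !mxE /= mulr1 mulr0 add0r.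
  have -> : x *: vs + y *: vu = w *m P by rewrite wP w0 w1.
  by rewrite mulmxK.
- by move=> w; rewrite -wP mulmxKV.
Qed.

Variables (f : 'rV[R]_2 -> 'rV[R]_2) (z0 vs vu : 'rV[R]_2) (Q : 'M[R]_2) (rho K ls lu : R).
Hypothesis rho0 : 0 < rho.
Hypothesis K0 : 0 <= K.
Hypothesis fz0 : f z0 = z0.
Hypothesis fd : forall z, `|z0 - z| < rho -> differentiable f z.
Hypothesis f_lip : forall z z' v : 'rV[R]_2, `|z0 - z| < rho -> `|z0 - z'| < rho ->
  `|'D_v f z' - 'D_v f z| <= K * `|z' - z| * `|v|.
Hypothesis f_taylor : forall z z' : 'rV[R]_2, `|z0 - z| < rho -> `|z0 - z'| < rho ->
  `|f z' - f z - 'D_(z' - z) f z| <= K * `|z' - z| ^+ 2.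
Hypothesis Ds : 'D_vs f z0 = ls *: vs.
Hypothesis Du : 'D_vu f z0 = lu *: vu.
Hypothesis QE : forall x y,
  ((x *: vs + y *: vu) *m Q) 0 0 = x /\ ((x *: vs + y *: vu) *m Q) 0 1 = y.

Definition emb (a : R * R) : 'rV[R]_2 := a.1 *: vs + a.2 *: vu.

Definition coords (w : 'rV[R]_2) : R * R := ((w *m Q) 0 0, (w *m Q) 0 1).

Definition in_coords (a : R * R) : R * R := coords (f (z0 + emb a) - z0).

Let B := `|vs| + `|vu|.

Lemma emb_norm a e : `|a.1| <= e -> `|a.2| <= e -> `|emb a| <= B * e.
Proof. by move=> h1 h2; apply: norm_lincomb2. Qed.

Lemma embB a a' : emb a' - emb a = (a'.1 - a.1) *: vs + (a'.2 - a.2) *: vu.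
Proof. by rewrite /emb opprD addrACA -!scalerBl. Qed.

Lemma coords_norm (w : 'rV[R]_2) : `|(coords w).1| <= 2 * `|w| * `|Q| /\ `|(coords w).2| <= 2 * `|w| * `|Q|.
Proof. by split; apply: le_trans (coord_le_norm _ _ _) (norm_mulmx _ _). Qed.

Lemma in_coords0 : in_coords (0, 0) = (0, 0).
Proof.
by rewrite /in_coords /emb /= !scale0r !addr0 fz0 subrr /coords mul0mx !mxE.
Qed.

Let split1 (x y a b s t l c : R) :
  `|x - y - (a * s + b * t)| <= c -> `|(a - l) * s + b * t| <= c -> `|x - y - l * s| <= c + c.
Proof.
move=> h1 h2; have -> : x - y - l * s = (x - y - (a * s + b * t)) + ((a - l) * s + b * t) by ring.
by apply: le_trans (ler_normD _ _) _; rewrite lerD.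
Qed.

Let split2 (x y a b s t l c : R) :
  `|x - y - (a * s + b * t)| <= c -> `|a * s + (b - l) * t| <= c -> `|x - y - l * t| <= c + c.
Proof.
move=> h1 h2; have -> : x - y - l * t = (x - y - (a * s + b * t)) + (a * s + (b - l) * t) by ring.
by apply: le_trans (ler_normD _ _) _; rewrite lerD.
Qed.

Let shiftB (x y a b s t c : R) :
  x - y - (s * a + t * b) = x - c - (y - c) - (a * s + b * t).
Proof. by ring. Qed.

(** Supplies the hypotheses of [stable_graph]; a, b, c, d are the entries of the differential of f
    in the eigenbasis. *)
Lemma saddle_coordinates (eps : R) : 0 < eps -> exists r0 K' : R, [/\ 0 < r0, 0 <= K',
  forall a : R * R, `|a.1| <= r0 -> `|a.2| <= r0 -> `|z0 - (z0 + emb a)| < rho &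
  forall r, 0 < r -> r <= r0 -> exists a b c d : R * R -> R, [/\
    forall z z' (e : R), box r z -> box r z' -> `|z'.1 - z.1| <= e -> `|z'.2 - z.2| <= e ->
      `|(in_coords z').1 - (in_coords z).1 - ls * (z'.1 - z.1)| <= eps * e /\
      `|(in_coords z').2 - (in_coords z).2 - lu * (z'.2 - z.2)| <= eps * e,
    forall z, box r z ->
      [/\ `|a z - ls| <= eps, `|b z| <= eps, `|c z| <= eps & `|d z - lu| <= eps],
    forall z z' (e : R), box r z -> box r z' -> `|z'.1 - z.1| <= e -> `|z'.2 - z.2| <= e ->
      `|(in_coords z').1 - (in_coords z).1 - (a z * (z'.1 - z.1) + b z * (z'.2 - z.2))|
         <= K' * e ^+ 2 /\
      `|(in_coords z').2 - (in_coords z).2 - (c z * (z'.1 - z.1) + d z * (z'.2 - z.2))|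
         <= K' * e ^+ 2 &
    forall z (e : R), box r z -> `|z.1| <= e -> `|z.2| <= e ->
      `|(in_coords z).2 - lu * z.2| <= K' * e ^+ 2]].
Proof.
move=> eps0.
have B0 : 0 <= B by rewrite addr_ge0.
pose K' := 2 * `|Q| * K * B ^+ 2.
have K'0 : 0 <= K' by rewrite /K' !mulr_ge0 ?sqr_ge0.
(* The first bound keeps the box inside the Taylor ball, the second makes the differential vary by
   at most eps/4 over it. *)
pose r0 := Num.min (rho / (B + 1)) (eps / (4 * (K' + 1))).
have B1 : 0 < B + 1 by lra.
have K1 : 0 < 4 * (K' + 1) by lra.
have r00 : 0 < r0 by rewrite lt_min !divr_gt0.
have r01 : r0 * (B + 1) <= rho by rewrite -ler_pdivlMr // ge_min lexx.
have r02 : r0 * (4 * (K' + 1)) <= eps by rewrite -ler_pdivlMr // ge_min lexx orbT.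
have inrho a : `|a.1| <= r0 -> `|a.2| <= r0 -> `|z0 - (z0 + emb a)| < rho.
  move=> h1 h2; rewrite opprD addNKr normrN; apply: le_lt_trans (emb_norm h1 h2) _; lra.
exists r0, K'; split => // r rp rr.
have inr z : box r z -> `|z0 - (z0 + emb z)| < rho.
  by move=> [h1 h2]; apply: inrho; [exact: le_trans h1 rr | exact: le_trans h2 rr].
pose ca (k : 'I_2) (v : 'rV[R]_2) (z : R * R) := ('D_v f (z0 + emb z) *m Q) 0 k.
have inz0 : `|z0 - z0| < rho by rewrite subrr normr0.
have addB (x y w : 'rV[R]_2) : (x + y) - (x + w) = y - w.
  by rewrite opprD addrACA subrr add0r.
have coefD (k : 'I_2) (v : 'rV[R]_2) z (hz : box r z) (hv : `|v| <= B) :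
    `|ca k v z - ('D_v f z0 *m Q) 0 k| <= K' * r.
  have -> : ca k v z - ('D_v f z0 *m Q) 0 k = (('D_v f (z0 + emb z) - 'D_v f z0) *m Q) 0 k.
    by rewrite mulmxBl mxBE.
  apply: le_trans (coord_le_norm _ _ _) _; apply: le_trans (norm_mulmx _ _) _.
  have h := f_lip v inz0 (inr z hz); rewrite addrAC subrr add0r in h.
  have h2 : K * `|emb z| * `|v| <= K * (B * r) * B.
    apply: ler_pM => //; first exact: mulr_ge0.
    by rewrite ler_wpM2l //; exact: emb_norm hz.1 hz.2.
  have -> : K' * r = 2 * (K * (B * r) * B) * `|Q| by rewrite /K'; ring.
  by rewrite ler_wpM2r // ler_wpM2l // (le_trans h).
have vsB : `|vs| <= B by rewrite lerDl.
have vuB : `|vu| <= B by rewrite lerDr.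
have [q00 q01] := QE 1 0; have [q10 q11] := QE 0 1.
rewrite !scale1r !scale0r !addr0 !add0r in q00 q01 q10 q11.
have K'r : K' * r <= eps / 4.
  have h : K' * r <= K' * r0 by rewrite ler_wpM2l.
  lra.
have co z : box r z -> [/\ `|ca 0 vs z - ls| <= K' * r, `|ca 0 vu z| <= K' * r,
   `|ca 1 vs z| <= K' * r & `|ca 1 vu z - lu| <= K' * r].
  move=> hz; split.
  - have := coefD 0 vs z hz vsB; by rewrite Ds -scalemxAl mxE q00 mulr1.
  - have := coefD 0 vu z hz vuB; by rewrite Du -scalemxAl mxE q10 mulr0 subr0.
  - have := coefD 1 vs z hz vsB; by rewrite Ds -scalemxAl mxE q01 mulr0 subr0.
  - have := coefD 1 vu z hz vuB; by rewrite Du -scalemxAl mxE q11 mulr1.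
have quad z z' (e : R) : box r z -> box r z' -> `|z'.1 - z.1| <= e -> `|z'.2 - z.2| <= e ->
    `|(in_coords z').1 - (in_coords z).1 - (ca 0 vs z * (z'.1 - z.1) + ca 0 vu z * (z'.2 - z.2))|
       <= K' * e ^+ 2 /\
    `|(in_coords z').2 - (in_coords z).2 - (ca 1 vs z * (z'.1 - z.1) + ca 1 vu z * (z'.2 - z.2))|
       <= K' * e ^+ 2.
  move=> hz hz' h1 h2.
  have T := f_taylor (inr z hz) (inr z' hz'); rewrite addB in T.
  set w := f _ - f _ - _ in T.
  have e0 : 0 <= e by exact: le_trans h1.
  have nd : `|emb z' - emb z| <= B * e.
    by rewrite embB; exact: (@emb_norm (z'.1 - z.1, z'.2 - z.2)).
  have wK : 2 * `|w| * `|Q| <= K' * e ^+ 2.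
    have -> : K' * e ^+ 2 = 2 * (K * (B * e) ^+ 2) * `|Q| by rewrite /K'; ring.
    rewrite ler_wpM2r // ler_wpM2l //; apply: le_trans T _; rewrite ler_wpM2l //.
    by rewrite ler_pXn2r // nnegrE // mulr_ge0.
  have Dw : 'D_(emb z' - emb z) f (z0 + emb z) =
      (z'.1 - z.1) *: 'D_vs f (z0 + emb z) + (z'.2 - z.2) *: 'D_vu f (z0 + emb z).
    have df := fd (inr z hz); rewrite !deriveE // embB linearD !linearZ //.
  have FE k (y : R * R) : ((f (z0 + emb y) - z0) *m Q) 0 k = (f (z0 + emb y) *m Q) 0 k - (z0 *m Q) 0 k.
    by rewrite mulmxBl mxBE.
  have wE k : (w *m Q) 0 k = (f (z0 + emb z') *m Q) 0 k - (z0 *m Q) 0 k -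
     ((f (z0 + emb z) *m Q) 0 k - (z0 *m Q) 0 k) -
     (ca k vs z * (z'.1 - z.1) + ca k vu z * (z'.2 - z.2)).
    have lin (x y : R) (u v : 'rV[R]_2) : (x *: u + y *: v) 0 k = x * u 0 k + y * v 0 k.
      by rewrite !mxE.
    by rewrite /w Dw !mulmxBl !mxBE mulmxDl -!scalemxAl lin; exact: shiftB.
  have bound k : `|(w *m Q) 0 k| <= K' * e ^+ 2.
    by apply: le_trans wK; apply: le_trans (coord_le_norm _ _ _) (norm_mulmx _ _).
  split; rewrite /in_coords /coords /= !FE.
  - by have := bound 0; rewrite wE.
  - by have := bound 1; rewrite wE.
exists (ca 0 vs), (ca 0 vu), (ca 1 vs), (ca 1 vu); split => //.
- move=> z z' e hz hz' h1 h2.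
  (* [e] may exceed the size of the box, but the true displacement [e1] is at most 2r, which turns
     the quadratic error into eps/2 times [e1]. *)
  pose e1 := Num.max `|z'.1 - z.1| `|z'.2 - z.2|.
  have k1 : `|z'.1 - z.1| <= e1 by rewrite le_max lexx.
  have k2 : `|z'.2 - z.2| <= e1 by rewrite le_max lexx orbT.
  have e1e : e1 <= e by rewrite ge_max h1 h2.
  have e10 : 0 <= e1 by exact: le_trans k1.
  have e1r : e1 <= 2 * r.
    move: hz hz' => [a1 a2] [b1 b2]; rewrite ge_max; apply/andP; split.
      by apply: le_trans (ler_normB _ _) _; lra.
    by apply: le_trans (ler_normB _ _) _; lra.
  have [q1 q2] := quad z z' e1 hz hz' k1 k2.
  have [c1 c2 c3 c4] := co z hz.
  have sq : K' * e1 ^+ 2 <= eps / 2 * e1.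
    rewrite expr2 mulrA ler_wpM2r //.
    have := ler_wpM2l K'0 e1r; lra.
  have lin (s t x y : R) : `|s| <= K' * r -> `|t| <= K' * r -> `|x| <= e1 -> `|y| <= e1 ->
      `|s * x + t * y| <= eps / 2 * e1.
    move=> hs ht hx hy; apply: le_trans (ler_normD _ _) _; rewrite !normrM.
    have := ler_pM (normr_ge0 _) (normr_ge0 _) (le_trans hs K'r) hx.
    have := ler_pM (normr_ge0 _) (normr_ge0 _) (le_trans ht K'r) hy.
    lra.
  have l1 := lin _ _ _ _ c1 c2 k1 k2; have l2 := lin _ _ _ _ c3 c4 k1 k2.
  have ee : eps * e1 <= eps * e by rewrite ler_wpM2l // ltW.
  have half : eps / 2 * e1 + eps / 2 * e1 <= eps * e by lra.
  split; apply: le_trans half.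
  + exact: split1 (le_trans q1 sq) l1.
  + exact: split2 (le_trans q2 sq) l2.
- move=> z hz; have [c1 c2 c3 c4] := co z hz.
  have Ke : K' * r <= eps by move: K'r eps0; lra.
  by split; [exact: le_trans c1 Ke | exact: le_trans c2 Ke | exact: le_trans c3 Ke | exact: le_trans c4 Ke].
- move=> z e hz h1 h2.
  have b0 : box r (0, 0) by split; rewrite normr0 ltW.
  have h1' : `|z.1 - ((0, 0) : R * R).1| <= e by rewrite subr0.
  have h2' : `|z.2 - ((0, 0) : R * R).2| <= e by rewrite subr0.
  have [_] := quad (0, 0) z e b0 hz h1' h2'.
  rewrite in_coords0 /= !subr0.
  have emb00 : emb (0, 0) = 0 by rewrite /emb /= !scale0r addr0.
  rewrite /ca emb00 addr0 Ds Du -!scalemxAl [X in X * z.1 + _]mxE [X in _ + X * z.2]mxE q01 q11.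
  by rewrite mulr0 mul0r add0r mulr1.
Qed.

End SaddleCoordinates.

(** * The stable graph carried back to the surface *)

Section LocalStableCurve.
Context {R : realType} {M : topologicalType} (S : surface R M).

Lemma open_overlap_map (i : idx S) (phi : M -> M) : continuous phi ->
  open (chart i @` (dom i `&` phi @^-1` dom i)).
Proof.
move=> cphi; apply: open_image_chartI.
by apply: open_comp => [x _|]; [exact: cphi | exact: open_dom].
Qed.

(** At eps = 0 the last inequality is |ls|^2 < |ls| |lu|, so it survives for small eps. As eps <= 1
    and |ls| < 1, the losses are at most eps (|ls| + |lu| + 5), hence the choice of [e3]. *)
Lemma saddle_gap (ls lu : R) : 0 < `|ls| -> `|ls| < 1 -> 1 < `|lu| ->
  exists eps : R, [/\ 0 < eps, eps <= 1, `|ls| + eps < 1, 1 < `|lu| - eps &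
    (`|ls| + eps) ^+ 2 < `|ls| * `|lu| - eps * (`|ls| + `|lu| + 2)].
Proof.
move: `|ls| `|lu| => l L l0 l1 L1.
pose e1 := (1 - l) / 2; pose e2 := (L - 1) / 2; pose e3 := l * (L - l) / (2 * (l + L + 5)).
have s0 : 0 < 2 * (l + L + 5) by lra.
have e30 : 0 < e3 by rewrite divr_gt0 // mulr_gt0 // subr_gt0 (lt_trans l1).
pose e := Num.min (Num.min e1 e2) (Num.min e3 1).
have m1 : e <= e1 by rewrite !ge_min lexx.
have m2 : e <= e2 by rewrite !ge_min lexx !orbT.
have m3 : e <= e3 by rewrite !ge_min lexx !orbT.
have m4 : e <= 1 by rewrite !ge_min lexx !orbT.
have e0 : 0 < e by rewrite !lt_min e30 ltr01 /e1 /e2 !divr_gt0 // subr_gt0.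
exists e; split => //; [rewrite /e1 in m1; lra | rewrite /e2 in m2; lra |].
have : e * (2 * (l + L + 5)) <= l * (L - l) by rewrite -ler_pdivlMr.
have : e ^+ 2 <= e by rewrite expr2 ler_piMl // ltW.
have : e * l <= e by rewrite ler_piMr // ltW.
have : 0 < e * (l + L) by rewrite mulr_gt0 // addr_gt0 // (lt_trans l0) // (lt_trans l1).
have : 0 < l * (L - l) by rewrite mulr_gt0 // subr_gt0 (lt_trans l1).
lra.
Qed.

(** [f] is phi read in the parameter of the curve, and the last clause says that an orbit staying
    close to p in the chart lies on it. The radius r stays free so that the curve can later be
    fitted into the region where the distance estimates hold. *)
Theorem local_stable_curve (phi : M -> M) (i : idx S) (p : M) (ls lu : R) :
  Ck_map S 2 phi -> dom i p -> phi p = p ->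
  let A := jacobian (chart i \o phi \o chart_inv i) (chart i p) in
  eigenvalue A ls -> eigenvalue A lu -> 0 < `|ls| -> `|ls| < 1 -> 1 < `|lu| ->
  exists (vs vu : 'rV[R]_2) (Lc lam r0 : R),
   [/\ vs *m A = ls *: vs,
      forall x y, `|x| <= Lc * `|x *: vs + y *: vu|,
      [/\ 0 < lam, lam < 1, 0 < r0 & 0 < Lc] &
      forall r, 0 < r -> r <= r0 -> exists (sg m f : R -> R) (C : R),
      let gam := fun x => chart_inv i (chart i p + (x *: vs + sg x *: vu)) in
      [/\ 0 <= C, sg 0 = 0 /\ m 0 = 0,
         forall x x', `|x| <= r -> `|x'| <= r ->
           `|sg x' - sg x - m x * (x' - x)| <= C * (x' - x) ^+ 2 /\
           `|f x' - f x| <= lam * `|x' - x|,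
         f 0 = 0 /\ (forall x, `|x| <= r -> `|sg x| <= r /\ phi (gam x) = gam (f x)) &
         forall q, (forall k, dom i (iter k phi q) /\
             Lc * `|chart i (iter k phi q) - chart i p| <= r) ->
           exists2 x, `|x| <= r & q = gam x]].
Proof.
move=> [cphi Cphi] dp pp A els elu ls0 ls1 lu1.
set z0 := chart i p.
pose fl := chart i \o phi \o chart_inv i.
pose Om := chart i @` (dom i `&` phi @^-1` dom i).
have oOm : open Om by exact: open_overlap_map.
have Omz0 : Om z0 by exists p => //; split => //=; rewrite pp.
have [rho [K [rho0 K0 rhoOm flip ftay]]] := Ck2_taylor oOm Omz0 (Cphi i i).
have fd (z : 'rV[R]_2) : `|z0 - z| < rho -> differentiable fl z.
  by move=> /rhoOm Oz; exact: Ck_differentiable (Cphi i i) Oz.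
have fz0 : fl z0 = z0 by rewrite /fl /= chartK // pp.
have neq : ls != lu by apply: contraTneq ls1 => ->; rewrite -leNgt ltW.
have [vs [vu [Q [As Au QE Qw]]]] := eigenbasis els elu neq.
have inz0 : `|z0 - z0| < rho by rewrite subrr normr0.
have Ds : 'D_vs fl z0 = ls *: vs by rewrite deriveEjacobian //; exact: fd.
have Du : 'D_vu fl z0 = lu *: vu by rewrite deriveEjacobian //; exact: fd.
have [eps [eps0 eps1 gap1 gap2 gap3]] := saddle_gap ls0 ls1 lu1.
have [r0 [K' [r00 K'0 inrho H]]] :=
  saddle_coordinates rho0 K0 fz0 fd flip ftay Ds Du QE eps0.
pose lam := `|ls| + eps; pose Fc := in_coords fl z0 vs vu Q.
have lam0 : 0 < lam by rewrite addr_gt0.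
exists vs, vu, (2 * `|Q| + 1), lam, r0; split => //.
- move=> x y; have [q _] := QE x y.
  rewrite -[X in `|X| <= _]q; apply: le_trans (coord_le_norm _ _ _) _.
  apply: le_trans (norm_mulmx _ _) _; rewrite mulrAC.
  by apply: ler_wpM2r; rewrite ?lerDl.
move=> r rp rr; have [a [b [c [d [Hlin Hco Hquad Hq0]]]]] := H r rp rr.
have Fc0 : Fc (0, 0) = (0, 0) by exact: in_coords0.
have [sg [m [C [C0 Hst Huq [sg0 m0] Hsg]]]] := stable_graph rp (ltW eps0) (lexx _) gap1 (lexx _) gap2
  Fc0 Hlin K'0 eps1 lam0 (lexx _) gap3 Hco Hquad Hq0.
have Fcx x : `|x| <= r -> (Fc (x, sg x)).2 = sg (Fc (x, sg x)).1.
  by move=> /Hst h; exact: Huq (stable_iter 1 h).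
have inbox (z : R * R) : box r z -> `|z0 - (z0 + emb vs vu z)| < rho.
  by move=> [h1 h2]; apply: inrho; [exact: le_trans h1 rr | exact: le_trans h2 rr].
have addB (w : 'rV[R]_2) : z0 + (w - z0) = w by rewrite addrCA subrr addr0.
have embK w : emb vs vu (coords Q w) = w by rewrite /emb /= -Qw.
have FcE (z : R * R) : box r z ->
    phi (chart_inv i (z0 + emb vs vu z)) = chart_inv i (z0 + emb vs vu (Fc z)).
  move=> /inbox /rhoOm /image_chartP[dz dphi].
  by rewrite /Fc /in_coords embK addB /fl /= chartK.
exists sg, m, (fun x => (Fc (x, sg x)).1), C; split => //.
- move=> x x' hx hx'; split; first exact: Hsg.
  exact: (stable_contracts rp (ltW eps0) (lexx _) gap1 (lexx _) gap2 Hlin 1 (Hst _ hx) (Hst _ hx')).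
- split; first by rewrite sg0 Fc0.
  move=> x hx; split; first exact: (Hst x hx 0%N).2.
  have := FcE (x, sg x) (Hst x hx 0%N); rewrite /emb /= => ->.
  by rewrite -(Fcx x hx).
move=> q Hq.
pose aa k := coords Q (chart i (iter k phi q) - z0).
have aabox k : box r (aa k).
  have [_ h] := Hq k; have [c1 c2] := coords_norm Q (chart i (iter k phi q) - z0).
  have h' : 2 * `|chart i (iter k phi q) - z0| * `|Q| <= r.
    apply: le_trans h; by rewrite mulrAC; apply: ler_wpM2r; rewrite ?lerDl.
  by split; [exact: le_trans c1 h' | exact: le_trans c2 h'].
have aaS k : aa k = iter k Fc (aa 0%N).
  elim: k => [//|k IH]; rewrite iterS -IH.
  rewrite /Fc /in_coords [in RHS]/aa embK addB /fl /= chartK; last by have [] := Hq k.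
  by rewrite /aa iterS.
have st : stable Fc r (aa 0%N) by move=> k; rewrite -aaS.
exists (aa 0%N).1; first exact: (aabox 0%N).1.
rewrite -(Huq _ st).
have -> : (aa 0%N).1 *: vs + (aa 0%N).2 *: vu = chart i q - z0 by rewrite -[RHS]embK.
by rewrite addB chartK //; have [] := Hq 0%N.
Qed.

End LocalStableCurve.

Section RankOne.
Context {R : realType}.

(** Only the row of E at the largest coordinate of w is nonzero, which makes the norm as small as
    |d| / |w|. E is the correction to mu * id that sends c(t) exactly to c(mu t). *)
Lemma rank_one_map (w d : 'rV[R]_2) : w != 0 ->
  exists E : 'M[R]_2, w *m E = d /\ `|E| <= `|d| / `|w|.
Proof.
move=> w0; have wp : 0 < `|w| by rewrite normr_gt0.
have [j wj] : exists j, `|w 0 j| = `|w|.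
  rewrite norm_row2; case: (leP `|w 0 0| `|w 0 1|) => _; first by exists 1.
  by exists 0.
have wj0 : w 0 j != 0 by rewrite -normr_gt0 wj.
exists (\matrix_(a, b) (if a == j then d 0 b / w 0 j else 0)); split.
  apply/rowP => b; rewrite mxE (bigD1 j) //= big1 ?addr0; last first.
    by move=> k kj; rewrite !mxE (negPf kj) mulr0.
  by rewrite !mxE eqxx mulrC divfK.
apply: norm_le_coord => [|a b]; first by rewrite divr_ge0.
rewrite mxE; case: ifP => _; last by rewrite normr0 divr_ge0.
rewrite normrM normfV wj ler_wpM2r ?invr_ge0 //; exact: coord_le_norm.
Qed.

End RankOne.

Section ThresholdRadius.
Context {R : realType}.

(** The growth bound takes the place of continuity. Going from s just below the supremum b up to b
    gives h b <= eta; going from b to (1 + y) b, where h exceeds eta, gives eta <= h b. The bound b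
    <= r/2 leaves room beyond b. *)
Lemma threshold_radius (h : R -> R) (r eta : R) : 0 < r ->
  (forall s mu, 0 < s <= r -> 0 <= mu < 1 -> h (mu * s) < h s) ->
  (forall s mu, 0 < s <= r -> 1 <= mu <= 2 -> mu * s <= r ->
     h (mu * s) <= (1 + 2 * (mu - 1)) * h s) ->
  (forall s, 0 <= s <= r -> h s <= eta -> s <= r / 2) ->
  h 0 < eta -> (exists2 s, 0 < s <= r & h s <= eta) -> 0 < eta ->
  exists b, [/\ 0 < b <= r / 2, h b = eta & forall s, 0 <= s <= r -> (h s <= eta <-> s <= b)].
Proof.
move=> r0 mono grow near0 h0 [s0 /andP[s00 s0r] hs0] eta0.
pose E := [set s | 0 <= s <= r /\ h s <= eta].
have hE : has_sup E.
  split; first by exists s0; rewrite /E /= (ltW s00) s0r.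
  by exists r => s [/andP[]].
pose b := sup E.
have ubE s : E s -> s <= b by move=> Es; apply: sup_upper_bound.
have bs0 : s0 <= b by apply: ubE; rewrite /E /= (ltW s00) s0r.
have b0 : 0 < b by exact: lt_le_trans bs0.
have br : b <= r / 2.
  by apply: ge_sup; [exact: hE.1 | move=> s [hs1 hs2]; exact: near0].
have br' : b <= r by lra.
have hb1 : h b <= eta.
  apply/ler_addgt0Pr => e e0.
  pose x := Num.min (b / 2) (e * b / (4 * eta)).
  have x0 : 0 < x by rewrite lt_min !divr_gt0 // mulr_gt0.
  have x1 : x <= b / 2 by rewrite ge_min lexx.
  have x2 : x * (4 * eta) <= e * b by rewrite -ler_pdivlMr ?mulr_gt0 // ge_min lexx orbT.
  have [s Es sb] := sup_adherent x0 hE; rewrite -/b in sb.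
  have [/andP[s_ge0 sr] hs] := Es; have sble := ubE s Es.
  have s2 : b / 2 <= s by lra.
  have sp : 0 < s by lra.
  have mu1 : 1 <= b / s <= 2.
    by rewrite ler_pdivlMr // mul1r sble ler_pdivrMr //=; lra.
  have := grow s (b / s); rewrite divfK ?gt_eqF // sp sr mu1 => /(_ isT isT br') H.
  apply: le_trans H _; apply: le_trans (_ : (1 + 2 * (b / s - 1)) * eta <= _).
    rewrite ler_wpM2l //; case/andP: mu1 => m1 _; lra.
  rewrite mulrDl mul1r lerD2l.
  have -> : 2 * (b / s - 1) * eta = (b - s) * (2 * eta) / s.
    by field; rewrite gt_eqF.
  rewrite ler_pdivrMr //.
  have : (b - s) * (2 * eta) <= x * (2 * eta) by rewrite ler_wpM2r ?mulr_ge0 // ?ltW //; lra.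
  have : e * (b / 2) <= e * s by rewrite ler_wpM2l // ltW.
  lra.
have hb2 : eta <= h b.
  apply/ler_addgt0Pr => e e0.
  pose y := Num.min 1 (e / (2 * (`|h b| + 1))).
  have hb0 : 0 <= `|h b| by [].
  have den : 0 < 2 * (`|h b| + 1) by lra.
  have y0 : 0 < y by rewrite lt_min ltr01 divr_gt0.
  have y1 : y <= 1 by rewrite ge_min lexx.
  have y2 : y * (2 * (`|h b| + 1)) <= e by rewrite -ler_pdivlMr // ge_min lexx orbT.
  have sr : (1 + y) * b <= r.
    have : y * b <= b by rewrite ler_piMl // ltW.
    lra.
  have sb : b < (1 + y) * b by rewrite ltr_pMl // ltrDl.
  have big : eta < h ((1 + y) * b).
    rewrite ltNge; apply/negP => hs.
    have : (1 + y) * b <= b by apply: ubE; split => //; rewrite sr andbT; lra.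
    by rewrite leNgt sb.
  have := grow b (1 + y); rewrite b0 br' => /(_ isT) H.
  have {H} := H (ltac:(apply/andP; split; lra)) sr.
  have : 2 * y * h b <= 2 * y * `|h b| by rewrite ler_wpM2l ?ler_norm // mulr_ge0 // ltW.
  lra.
have hb : h b = eta by apply/le_anti; rewrite hb1 hb2.
exists b; split => //; first by rewrite b0 br.
move=> s /andP[s_ge0 sr]; split => [hs|]; first by apply: ubE; split => //; rewrite s_ge0.
rewrite le_eqVlt => /orP[/eqP->|sb]; first by rewrite hb.
have := mono b (s / b); rewrite b0 br' divfK ?gt_eqF // hb => H; apply/ltW/H => //.
by rewrite divr_ge0 ?(ltW b0) // ltr_pdivrMr // mul1r.
Qed.

End ThresholdRadius.

(** * The stable graph as a C^{1+Lip} curve *)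

Section GraphCurves.
Context {R : realType} {M : topologicalType} (S : surface R M) (g : riemannian_metric S).
Variables (i : idx S) (z0 vs vu : 'rV[R]_2) (sg m : R -> R) (C r : R).
Hypothesis C0 : 0 <= C.
Hypothesis sg_quad : forall x x', `|x| <= r -> `|x'| <= r ->
  `|sg x' - sg x - m x * (x' - x)| <= C * (x' - x) ^+ 2.

Definition graph_pt (x : R) : 'rV[R]_2 := x *: vs + sg x *: vu.

(** In the sum of the expansions at x and at y the values of [sg] cancel and (m x - m y)(x - y)
    remains. *)
Lemma slope_lipschitz x y : `|x| <= r -> `|y| <= r -> `|m x - m y| <= 2 * C * `|x - y|.
Proof.
move=> hx hy; have [->|n] := eqVneq x y; first by rewrite !subrr normr0 mulr0.
have p : 0 < `|x - y| by rewrite normr_gt0 subr_eq0.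
rewrite -(ler_pM2r p) -normrM.
have -> : (m x - m y) * (x - y) =
  (sg y - sg x - m x * (y - x)) + (sg x - sg y - m y * (x - y)) by ring.
apply: le_trans (ler_normD _ _) _.
have h1 := sg_quad hx hy; have h2 := sg_quad hy hx.
have e1 : (y - x) ^+ 2 = `|x - y| ^+ 2 by rewrite real_normK ?num_real //; ring.
have e2 : (x - y) ^+ 2 = `|x - y| ^+ 2 by rewrite real_normK ?num_real.
rewrite e1 in h1; rewrite e2 in h2.
by apply: le_trans (lerD h1 h2) _; rewrite expr2 !mulrA -mulrDl; lra.
Qed.

Lemma graph_pt_lipschitz (Mm x y : R) : `|x| <= r -> `|y| <= r -> `|m x| <= Mm ->
  `|graph_pt y - graph_pt x| <= (`|vs| + (Mm + 2 * r * C) * `|vu|) * `|y - x|.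
Proof.
move=> hx hy hm.
have -> : graph_pt y - graph_pt x = (y - x) *: vs + (sg y - sg x) *: vu.
  by rewrite /graph_pt opprD addrACA -!scalerBl.
have yx : `|y - x| <= 2 * r by apply: le_trans (ler_normB _ _) _; lra.
have h : `|sg y - sg x| <= (Mm + 2 * r * C) * `|y - x|.
  have -> : sg y - sg x = (sg y - sg x - m x * (y - x)) + m x * (y - x) by rewrite subrK.
  apply: le_trans (ler_normD _ _) _; have := sg_quad hx hy; rewrite normrM => h1.
  have h2 : `|m x| * `|y - x| <= Mm * `|y - x| by rewrite ler_wpM2r.
  have h3 : C * (y - x) ^+ 2 <= 2 * r * C * `|y - x|.
    rewrite -[(y - x) ^+ 2]real_normK ?num_real // expr2 mulrA ler_wpM2r //.
    by rewrite mulrC ler_wpM2r.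
  lra.
apply: le_trans (ler_normD _ _) _; rewrite !normrZ.
have := ler_wpM2r (normr_ge0 vu) h; lra.
Qed.

Lemma graph_curve_C1 x : `|x| < r ->
  C1_at (fun x => z0 + graph_pt x) x /\ derive1 (fun x => z0 + graph_pt x) x = vs + m x *: vu.
Proof.
move=> xr; apply: (@C1_at_of_is_derive R _ _ (fun x => vs + m x *: vu) x).
  have nr : \forall y \near x, `|y| < r.
    have : \forall y \near x, `|x - y| < r - `|x|.
      by apply/nbhs_normP; exists (r - `|x|) => //=; rewrite subr_gt0.
    apply: filterS => y h; have := ler_normB x (x - y); rewrite subKr; lra.
  apply: filterS nr => y yr.
  have ds : is_derive (y : R^o) 1 (sg : R^o -> R^o) (m y).
    apply: (@is_derive_of_quadratic R sg y (m y) C (r - `|y|)); first by rewrite subr_gt0.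
    move=> w hw; apply: sg_quad; first exact: ltW.
    by have := ler_normD (w - y) y; rewrite subrK; lra.
  have H (a : 'I_1) b : is_derive (y : R^o) 1 (fun w : R => (z0 + graph_pt w) a b : R^o)
      ((vs + m y *: vu) a b).
    have d1 := is_deriveM (is_derive_id (y : R) 1) (is_derive_cst (vs a b) (y : R) 1).
    have d2 := is_deriveM ds (is_derive_cst (vu a b) (y : R) 1).
    have d3 := is_deriveD (is_derive_cst (z0 a b) (y : R) 1) (is_deriveD d1 d2).
    have -> : (fun w : R => (z0 + graph_pt w) a b) =
        cst (z0 a b) + (id * cst (vs a b) + (sg : R -> R) * cst (vu a b)).
      by apply/funext => w; rewrite /graph_pt !mxE.
    have [e3 v3] := d3; apply: DeriveDef; first exact: e3.
    by rewrite v3 /GRing.scale /= !mxE; ring.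
  have D : derivable (fun w : R => z0 + graph_pt w) y 1.
    by apply/derivable_mxP => a b; have [] := H a b.
  apply: DeriveDef; first exact: D.
  by rewrite derive_mx //; apply/matrixP => a b; rewrite mxE; have [_ ->] := H a b.
apply: continuousD; first exact: cst_continuous.
apply: continuousZr_tmp.
have mc : {for x, continuous m}.
  apply/(@cvgrPdist_lt _ _ _ (nbhs x)) => e e0.
  pose C1 := 2 * C + 1.
  have C10 : 0 < C1 by rewrite /C1; move: C0; lra.
  near=> y.
  have h1 : `|x - y| < e / C1 by near: y; apply: cvgr_dist_lt => //; exact: divr_gt0.
  have h2 : `|x - y| < r - `|x| by near: y; apply: cvgr_dist_lt => //; rewrite subr_gt0.
  have yr : `|y| <= r by have := ler_normB x (x - y); rewrite subKr; lra.
  apply: le_lt_trans (slope_lipschitz (ltW xr) yr) _.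
  move: h1; rewrite ltr_pdivlMr // /C1 => h1; have := normr_ge0 (x - y); lra.
exact: mc.
Unshelve. all: by end_near. Qed.

Hypothesis ballU : forall x, `|x| < r -> (chart i @` dom i) (z0 + graph_pt x).

Definition graph_curve (x : R) : M := chart_inv i (z0 + graph_pt x).

Let U : set R := [set x | `|x| < r].

Lemma open_graph_domain : open U.
Proof.
rewrite (_ : U = (fun x : R => `|x|) @^-1` [set y | y < r]) //.
by apply: open_comp; [move=> x _; exact: norm_continuous | exact: open_lt].
Qed.

Lemma graph_curve_C1_curve : C1_curve S U graph_curve.
Proof.
apply: C1_curve_of_chart open_graph_domain _ _ => x Ux; last exact: ballU.
exact: (graph_curve_C1 Ux).1.
Qed.

Lemma chart_graph_curve x : U x -> chart i (graph_curve x) = z0 + graph_pt x.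
Proof. by move=> Ux; rewrite /graph_curve chart_invK //; exact: ballU. Qed.

Lemma dom_graph_curve x : U x -> dom i (graph_curve x).
Proof. by move=> Ux; exact/dom_chart_inv/ballU. Qed.

Lemma derive1_graph_curve x : U x ->
  derive1 (chart i \o graph_curve) x = vs + m x *: vu.
Proof.
move=> Ux; rewrite -(graph_curve_C1 Ux).2.
have E : \forall y \near x, (chart i \o graph_curve) y = z0 + graph_pt y.
  have := open_nbhs_nbhs (conj open_graph_domain Ux).
  by apply: filterS => y Uy; exact: chart_graph_curve.
exact: nbhs_singleton (near_eq_derive1 E).
Qed.

Lemma speed_graph_curve x : U x -> speed g graph_curve x =
  Num.sqrt (quad (gram g i (z0 + graph_pt x)) (vs + m x *: vu)).
Proof.
move=> Ux; rewrite (speed_chart g open_graph_domain graph_curve_C1_curve Ux (dom_graph_curve Ux)).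
by rewrite chart_graph_curve // derive1_graph_curve.
Qed.

Lemma derive1_graph_curve_chart (j : idx S) x : U x -> dom j (graph_curve x) ->
  derive1 (chart j \o graph_curve) x =
  'D_(vs + m x *: vu) (chart j \o chart_inv i) (z0 + graph_pt x).
Proof.
move=> Ux dj; have di := dom_graph_curve Ux.
rewrite (derive1_chart_change open_graph_domain graph_curve_C1_curve Ux di dj).
rewrite derive1_graph_curve // chart_graph_curve // deriveEjacobian //.
apply: (Ck_differentiable (transition_smooth i j 1)).
by apply/image_chartP; split; [exact: ballU | exact: dj].
Qed.

(** In chart i the velocity vs + m x vu is Lipschitz because [m] is. For an arbitrary chart j one
    also needs the transition map to have a Lipschitz differential. *)
Lemma graph_curve_C1Lip : C1Lip_curve S U graph_curve.
Proof.
split; first exact: graph_curve_C1_curve.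
move=> j t Ut dj.
pose tau := chart j \o chart_inv i.
have oOm : open (chart i @` (dom i `&` dom j)) by exact/open_image_chartI/open_dom.
have Om : (chart i @` (dom i `&` dom j)) (z0 + graph_pt t).
  by apply/image_chartP; split; [exact: ballU | exact: dj].
have [rho [K [rho0 K0 rhoOm Dlip _]]] := Ck2_taylor oOm Om (transition_smooth i j 2).
pose B := `|vs| + (`|m t| + 2 * C * (2 * r)) * `|vu|.
have r0 : 0 < r by exact: le_lt_trans Ut.
have B0 : 0 <= B by rewrite !addr_ge0 // mulr_ge0 // addr_ge0 // !mulr_ge0 // ltW.
have mB x : U x -> `|m x| <= `|m t| + 2 * C * (2 * r).
  move=> Ux; have := slope_lipschitz (ltW Ux) (ltW Ut).
  have tx : `|x - t| <= 2 * r.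
    by apply: le_trans (ler_normB _ _) _; move: (ltW Ux) (ltW Ut); rewrite /=; lra.
  have h1 : 2 * C * `|x - t| <= 2 * C * (2 * r) by rewrite ler_wpM2l // mulr_ge0.
  have h2 := ler_normD (m x - m t) (m t); rewrite subrK in h2.
  lra.
pose G := `|vs| + (`|m t| + 2 * C * (2 * r) + 2 * r * C) * `|vu|.
have G0 : 0 <= G by rewrite !addr_ge0 // mulr_ge0 // !addr_ge0 // !mulr_ge0 // ltW.
have Lsg x y : U x -> U y -> `|graph_pt y - graph_pt x| <= G * `|y - x|.
  move=> Ux Uy; apply: graph_pt_lipschitz; try exact: ltW.
  exact: mB.
pose N := `|'D_vu tau (z0 + graph_pt t)| + K * rho * `|vu|.
have N0 : 0 <= N by rewrite addr_ge0 // !mulr_ge0 // ltW.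
have addB (x y w : 'rV[R]_2) : (x + y) - (x + w) = y - w.
  by rewrite opprD addrACA subrr add0r.
pose e0 := Num.min (r - `|t|) (rho / (G + 1)).
have G1 : 0 < G + 1 by lra.
have e00 : 0 < e0 by rewrite lt_min subr_gt0 Ut divr_gt0.
have inU x : `|t - x| < e0 -> U x.
  rewrite lt_min => /andP[h _]; rewrite /U /=.
  by have := ler_normB t (t - x); rewrite subKr; lra.
have inrho x : `|t - x| < e0 -> `|(z0 + graph_pt t) - (z0 + graph_pt x)| < rho.
  move=> h; have Ux := inU x h; rewrite addB; apply: le_lt_trans (Lsg x t Ux Ut) _.
  have : `|t - x| * (G + 1) < rho.
    by rewrite -ltr_pdivlMr //; move: h; rewrite lt_min => /andP[].
  have := normr_ge0 (t - x); lra.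
pose Lip := K * G * B + 2 * C * N.
have key x y : `|t - x| < e0 -> `|t - y| < e0 ->
    `|derive1 (chart j \o graph_curve) y - derive1 (chart j \o graph_curve) x| <= Lip * `|y - x|.
  move=> hx hy; have Ux := inU x hx; have Uy := inU y hy.
  have Ox := rhoOm _ (inrho x hx); have Oy := rhoOm _ (inrho y hy).
  have dx : dom j (graph_curve x) by move/image_chartP: Ox => [].
  have dy : dom j (graph_curve y) by move/image_chartP: Oy => [].
  rewrite !derive1_graph_curve_chart // -/tau.
  set vx := vs + m x *: vu; set vy := vs + m y *: vu.
  have dtau : differentiable tau (z0 + graph_pt x).
    exact: Ck_differentiable (transition_smooth i j 1) Ox.
  (* The base point is moved first, with the direction fixed, then the direction. *)
  have -> : 'D_vy tau (z0 + graph_pt y) - 'D_vx tau (z0 + graph_pt x) =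
     ('D_vy tau (z0 + graph_pt y) - 'D_vy tau (z0 + graph_pt x)) +
     (m y - m x) *: 'D_vu tau (z0 + graph_pt x).
    rewrite -[LHS](subrKA ('D_vy tau (z0 + graph_pt x))); congr (_ + _).
    rewrite !deriveE // -linearB -linearZ /=; congr ('d _ _ _).
    by rewrite /vx /vy opprD addrACA subrr add0r scalerBl.
  apply: le_trans (ler_normD _ _) _; rewrite mulrDl; apply: lerD.
    apply: le_trans (Dlip _ _ vy (inrho x hx) (inrho y hy)) _; rewrite addB.
    have vyB : `|vy| <= B.
      apply: le_trans (ler_normD _ _) _; rewrite lerD2l normrZ ler_wpM2r //; exact: mB.
    have h1 := Lsg x y Ux Uy.
    apply: le_trans (_ : K * (G * `|y - x|) * B <= _); last first.
      by rewrite -!mulrA ler_wpM2l // ler_wpM2l // mulrC.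
    by apply: ler_pM => //; [exact: mulr_ge0 | exact: ler_wpM2l].
  rewrite normrZ.
  have hN : `|'D_vu tau (z0 + graph_pt x)| <= N.
    have tt : `|(z0 + graph_pt t) - (z0 + graph_pt t)| < rho by rewrite subrr normr0.
    have := Dlip _ _ vu tt (inrho x hx); have := ler_normD
      ('D_vu tau (z0 + graph_pt x) - 'D_vu tau (z0 + graph_pt t)) ('D_vu tau (z0 + graph_pt t)).
    rewrite subrK => a1 a2; apply: le_trans a1 _; rewrite addrC lerD2l.
    apply: le_trans a2 _; rewrite ler_wpM2r // ler_wpM2l // distrC; exact/ltW/inrho.
  rewrite mulrAC; apply: ler_pM => //; exact: slope_lipschitz (ltW Uy) (ltW Ux).
near=> e.
apply: (@klipschitzW _ _ _ Lip).
  have e_gt0 : 0 < e by near: e; exact: nbhs_right_gt.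
  have tb : ball (t : R^o) e t by exact: ballxx.
  exact: (@globally_properfilter _ _ (t, t)).
have ee0 : e <= e0 by near: e; exact: nbhs_right_le.
move=> [x y] /= [bx by_]; rewrite /= distrC [X in _ <= Lip * X]distrC.
by apply: key; [exact: lt_le_trans bx ee0 | exact: lt_le_trans by_ ee0].
Unshelve. all: by end_near. Qed.

End GraphCurves.

(** * The distance to the fixed point along the stable curve *)

Section GraphArcs.
Context {R : realType} {M : topologicalType} (S : surface R M) (g : riemannian_metric S).
Variables (i : idx S) (z0 vs vu : 'rV[R]_2) (sg m : R -> R) (C r : R).
Hypothesis C0 : 0 <= C.
Hypothesis sg_quad : forall x x', `|x| <= r -> `|x'| <= r ->
  `|sg x' - sg x - m x * (x' - x)| <= C * (x' - x) ^+ 2.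
Hypothesis ballU : forall x, `|x| < r -> (chart i @` dom i) (z0 + graph_pt vs vu sg x).
Local Notation c := (graph_curve i z0 vs vu sg).

Lemma graph_curve_segment a b : - r < a -> a < b -> b < r -> C1_segment S c a b.
Proof.
move=> ra ab br; split => //; exists [set x | `|x| < r], c; split => //.
- exact: open_graph_domain.
- by move=> x /=; rewrite in_itv /= => /andP[ax xb]; rewrite ltr_norml; lra.
- exact: graph_curve_C1_curve C0 sg_quad ballU.
Qed.

Lemma dist_le_graph_length a b : - r < a -> a < b -> b < r ->
  (riemannian_dist g (c a) (c b) <= curve_length g c a b)%E.
Proof.
by move=> ra ab br; apply/dist_le_length/piecewise_C1_segment/graph_curve_segment.
Qed.

(** The same curve run backwards. Bounding d(c(b), p) by a length needs a curve from c(b) to p,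
    whereas [c] runs from p to c(b); this reversal stands in for the symmetry of d. *)
Let sg' x := sg (- x).
Let m' x := - m (- x).

Let sg'_quad x x' : `|x| <= r -> `|x'| <= r ->
  `|sg' x' - sg' x - m' x * (x' - x)| <= C * (x' - x) ^+ 2.
Proof.
rewrite -(normrN x) -(normrN x') => hx hx'; have := sg_quad hx hx'.
rewrite /sg' /m'.
have -> : (- x' - - x) ^+ 2 = (x' - x) ^+ 2 by ring.
by have -> : m (- x) * (- x' - - x) = - m (- x) * (x' - x) by ring.
Qed.

Let graph_ptN x : graph_pt (- vs) vu sg' x = graph_pt vs vu sg (- x).
Proof. by rewrite /graph_pt /sg' scalerN scaleNr. Qed.

Let ballU' x : `|x| < r -> (chart i @` dom i) (z0 + graph_pt (- vs) vu sg' x).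
Proof. by move=> hx; rewrite graph_ptN; apply: ballU; rewrite normrN. Qed.

Let c' := graph_curve i z0 (- vs) vu sg'.

Let cN x : c' x = c (- x).
Proof. by rewrite /c' /graph_curve graph_ptN. Qed.

Let speedN x : `|x| < r -> speed g c' (- x) = speed g c x.
Proof.
move=> hx; have hx' : `|- x| < r by rewrite normrN.
rewrite (speed_graph_curve g C0 sg'_quad ballU' hx') (speed_graph_curve g C0 sg_quad ballU hx).
rewrite graph_ptN opprK /m' opprK; congr Num.sqrt.
have -> : - vs + - m x *: vu = - (vs + m x *: vu) by rewrite scaleNr opprD.
by rewrite /quad linearN /= mulNmx mulmxN mulNmx opprK.
Qed.

Lemma dist_le_graph_length_rev b : 0 < b -> b < r ->
  (riemannian_dist g (c b) (c 0%R) <= curve_length g c 0 b)%E.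
Proof.
move=> b0 br; have rb : - r < - b by rewrite ltrN2.
have nb0 : - b < 0 by rewrite oppr_lt0.
have r0 : 0 < r by exact: lt_trans br.
have sg1 : C1_segment S c' (- b) 0.
  split => //; exists [set x | `|x| < r], c'; split => //.
  - exact: open_graph_domain.
  - by move=> x /=; rewrite in_itv /= => /andP[ax xb]; rewrite ltr_norml; lra.
  - exact: graph_curve_C1_curve C0 sg'_quad ballU'.
have := dist_le_length g (piecewise_C1_segment sg1).
rewrite !cN opprK oppr0 => /le_trans; apply; rewrite !curve_lengthE.
have cont : {within `[(- b)%R, (- 0)%R], continuous (speed g c')}.
  apply: continuous_in_subspaceT => x /set_mem /=; rewrite in_itv /= oppr0 => /andP[bx x0].
  apply: (speed_continuous (@open_graph_domain R r) (graph_curve_C1_curve C0 sg'_quad ballU')).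
  by rewrite /= ltr_norml; lra.
have := integration_by_substitution_oppr (ltW b0) cont; rewrite oppr0 => ->.
rewrite le_eqVlt; apply/orP; left; apply/eqP; apply: eq_integral => x.
move=> /set_mem /=; rewrite in_itv /= => /andP[x0 xb].
by rewrite speedN // ltr_norml; lra.
Qed.

End GraphArcs.

Section DistanceAlongGraph.
Context {R : realType} {M : topologicalType} (S : surface R M) (g : riemannian_metric S).
Variables (i : idx S) (p : M) (z0 vs vu : 'rV[R]_2) (sg m : R -> R) (C r rg L Lc : R).
Hypothesis C0 : 0 <= C.
Hypothesis r0 : 0 < r.
Hypothesis sg_quad : forall x x', `|x| <= r -> `|x'| <= r ->
  `|sg x' - sg x - m x * (x' - x)| <= C * (x' - x) ^+ 2.
Hypothesis sg0 : sg 0 = 0.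
Hypothesis m00 : m 0 = 0.
Hypothesis L1 : 1 <= L.
Hypothesis Lc0 : 0 < Lc.
Hypothesis transverse : forall x y, `|x| <= Lc * `|x *: vs + y *: vu|.
Hypothesis inball : forall t, `|t| <= r -> `|graph_pt vs vu sg t| <= rg.
Let e (z : 'rV[R]_2) := chart_inv i (z0 + z).
Hypothesis push : forall (z : 'rV[R]_2) (T : 'M[R]_2) (mu d : R), `|z| <= rg -> `|mu| <= 2 ->
  0 <= d -> d <= 1 -> `|T - mu%:M| <= d ->
  (riemannian_dist g (e (z *m T)) p <=
    ((1 + L * `|z| * (`|1 - mu| + 2 * d)) * (`|mu| + L * d))%:E * riemannian_dist g (e z) p)%E.

Lemma graph_pt_norm t : `|t| <= r ->
  `|graph_pt vs vu sg t| <= (`|vs| + 2 * r * C * `|vu|) * `|t|.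
Proof.
move=> ht; have h0 : `|0 : R| <= r by rewrite normr0 ltW.
have mm : `|m 0| <= 0 by rewrite m00 normr0.
have := graph_pt_lipschitz vs vu C0 sg_quad h0 ht mm.
by rewrite /graph_pt sg0 !scale0r addr0 !subr0 add0r.
Qed.

(** The expansion at t, evaluated at mu t and at 0, gives an error with the factor |1 - mu|; an
    expansion at 0 would lose that factor. *)
Lemma sg_homogeneous t mu : `|t| <= r -> `|mu * t| <= r -> -1 <= mu -> mu <= 2 ->
  `|sg (mu * t) - mu * sg t| <= 3 * C * t ^+ 2 * `|1 - mu|.
Proof.
move=> ht hmt mu1 mu2; have h0 : `|0 : R| <= r by rewrite normr0 ltW.
have q1 := sg_quad ht hmt; have := sg_quad ht h0.
rewrite sg0 !sub0r => q2.
have -> : sg (mu * t) - mu * sg t =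
  (sg (mu * t) - sg t - m t * (mu * t - t)) - (1 - mu) * (- sg t - m t * - t) by ring.
apply: le_trans (ler_normB _ _) _; rewrite normrM.
have b1 : (mu * t - t) ^+ 2 = t ^+ 2 * `|1 - mu| * `|1 - mu|.
  by rewrite -mulrA -expr2 real_normK ?num_real //; ring.
have b2 : `|1 - mu| <= 2 by rewrite ler_norml; lra.
rewrite b1 in q1; rewrite sqrrN in q2.
have h1 : `|1 - mu| * `|- sg t - m t * - t| <= `|1 - mu| * (C * t ^+ 2) by rewrite ler_wpM2l.
have h2 : C * (t ^+ 2 * `|1 - mu| * `|1 - mu|) <= C * (t ^+ 2 * `|1 - mu| * 2).
  by rewrite ler_wpM2l // ler_wpM2l // mulr_ge0 ?sqr_ge0.
lra.
Qed.

Lemma graph_dist_scaling : exists C3 r1 : R, [/\ 0 <= C3, 0 < r1, r1 <= r &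
  forall t mu, 0 < `|t| -> `|t| <= r1 -> -1 <= mu -> mu <= 2 -> `|mu * t| <= r ->
  (riemannian_dist g (e (graph_pt vs vu sg (mu * t))) p <=
    (`|mu| + C3 * `|t| * `|1 - mu|)%:E * riemannian_dist g (e (graph_pt vs vu sg t)) p)%E].
Proof.
(* [K1] |t| |1 - mu| bounds the rank-one correction E, since |t| <= Lc |w|; the choice of [r1] makes
   this at most 1 and at most |1 - mu| / 2. *)
pose K1 := 3 * C * `|vu| * Lc; pose Bv := `|vs| + 2 * r * C * `|vu|.
have K10 : 0 <= K1 by rewrite !mulr_ge0 // ltW.
have Bv0 : 0 <= Bv by rewrite addr_ge0 // !mulr_ge0 // ltW.
have L0 : 0 <= L by exact: le_trans L1.
have den : 0 < 2 * (K1 + 1) by lra.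
exists (4 * L * Bv + L * K1 + 2 * L ^+ 2 * Bv), (Num.min r (2 * (K1 + 1))^-1); split.
- have a1 : 0 <= 4 * L * Bv by rewrite !mulr_ge0.
  have a2 := mulr_ge0 L0 K10; have a3 := mulr_ge0 (mulr_ge0 (ler0n R 2) (sqr_ge0 L)) Bv0.
  lra.
- by rewrite lt_min r0 invr_gt0.
- by rewrite ge_min lexx.
move=> t mu t0 tr1 mu1 mu2 hmt.
have tr : `|t| <= r by apply: le_trans tr1 _; rewrite ge_min lexx.
have tK : K1 * `|t| <= 1 / 2.
  have : `|t| * (2 * (K1 + 1)) <= 1.
    rewrite -ler_pdivlMr // div1r; apply: le_trans tr1 _; by rewrite ge_min lexx orbT.
  lra.
set w := graph_pt vs vu sg t.
have tw : `|t| <= Lc * `|w| by exact: transverse.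
have w0 : w != 0.
  by apply: contraTneq tw => ->; rewrite normr0 mulr0 -ltNge.
have wp : 0 < `|w| by rewrite normr_gt0.
have b2 : `|1 - mu| <= 2 by rewrite ler_norml; lra.
pose X := `|t| * `|1 - mu|; have X0 : 0 <= X by rewrite mulr_ge0.
have KX : K1 * X <= 1.
  rewrite /X mulrA; apply: le_trans (_ : 1 / 2 * 2 <= _); last lra.
  by apply: ler_pM => //; exact: mulr_ge0.
have KX2 : 2 * (K1 * X) <= `|1 - mu|.
  have := ler_wpM2r (normr_ge0 (1 - mu)) tK; rewrite /X; lra.
have [E [wE nE]] := rank_one_map (graph_pt vs vu sg (mu * t) - mu *: w) w0.
have dE : graph_pt vs vu sg (mu * t) - mu *: w = (sg (mu * t) - mu * sg t) *: vu.
  by rewrite /w /graph_pt scalerDr !scalerA opprD addrACA subrr add0r scalerBl.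
have nE2 : `|E| <= K1 * X.
  apply: le_trans nE _; rewrite dE normrZ ler_pdivrMr //.
  apply: le_trans (_ : 3 * C * t ^+ 2 * `|1 - mu| * `|vu| <= _).
    by rewrite ler_wpM2r //; exact: sg_homogeneous.
  have -> : 3 * C * t ^+ 2 * `|1 - mu| * `|vu| = (3 * C * `|vu| * X) * `|t|.
    by rewrite -[t ^+ 2]real_normK ?num_real // /X; ring.
  have -> : K1 * X * `|w| = (3 * C * `|vu| * X) * (Lc * `|w|) by rewrite /K1; ring.
  by rewrite ler_wpM2l // !mulr_ge0.
have hmu : `|mu| <= 2 by rewrite ler_norml; lra.
have hT : `|mu%:M + E - mu%:M| <= K1 * X by rewrite addrAC subrr add0r.
have := push (inball tr) hmu (mulr_ge0 K10 X0) KX hT.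
rewrite -/w mulmxDr mul_mx_scalar wE [mu *: w + _]addrC subrK => /le_trans; apply.
apply: lee_wpmul2r; first exact: dist_ge0.
rewrite lee_fin.
have wB : `|w| <= Bv * `|t| by exact: graph_pt_norm.
have f1 : 1 + L * `|w| * (`|1 - mu| + 2 * (K1 * X)) <= 1 + 2 * L * Bv * X.
  rewrite lerD2l; apply: le_trans (_ : L * (Bv * `|t|) * (2 * `|1 - mu|) <= _).
    have LX : 0 <= 2 * (K1 * X) by apply: mulr_ge0 => //; exact: mulr_ge0 K10 X0.
    apply: ler_pM; [exact: mulr_ge0 | exact: addr_ge0 | exact: ler_wpM2l | lra].
  by rewrite /X le_eqVlt; apply/orP; left; apply/eqP; ring.
apply: le_trans (_ : (1 + 2 * L * Bv * X) * (`|mu| + L * (K1 * X)) <= _).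
  apply: ler_wpM2r f1; apply: addr_ge0 => //.
  exact: mulr_ge0 L0 (mulr_ge0 K10 X0).
have g1 : L * Bv * X * `|mu| <= L * Bv * X * 2 by apply: ler_wpM2l hmu; exact: mulr_ge0 (mulr_ge0 L0 Bv0) X0.
have g2 : L ^+ 2 * Bv * X * (K1 * X) <= L ^+ 2 * Bv * X * 1.
  by apply: ler_wpM2l => //; exact: mulr_ge0 (mulr_ge0 (sqr_ge0 L) Bv0) X0.
have -> : (4 * L * Bv + L * K1 + 2 * L ^+ 2 * Bv) * `|t| * `|1 - mu| =
  (4 * L * Bv + L * K1 + 2 * L ^+ 2 * Bv) * X by rewrite /X; ring.
lra.
Qed.

End DistanceAlongGraph.

Section SublevelInterval.
Context {R : realType}.

(** C * r <= (1 - lam)/4 makes the factor |mu| + C |t| |1 - mu| less than 1 for 0 <= mu < 1, at most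
    1 + 2 (mu - 1) for 1 <= mu <= 2, and at most 1 for |mu| <= lam of either sign. *)
Lemma sublevel_interval (D : R -> R) (A A' C lam r eta : R) :
  0 < A -> 0 < A' -> 0 < lam -> lam < 1 -> 0 < r -> 0 < eta -> A' * eta <= r / 2 ->
  0 <= C -> C * r <= (1 - lam) / 4 ->
  (forall t, `|t| <= r -> D t <= A * `|t|) -> (forall t, `|t| <= r -> `|t| <= A' * D t) ->
  (forall t mu, 0 < `|t| -> `|t| <= r -> -1 <= mu -> mu <= 2 -> `|mu * t| <= r ->
     D (mu * t) <= (`|mu| + C * `|t| * `|1 - mu|) * D t) ->
  [/\ exists a b, [/\ a < 0 < b, - (r / 2) <= a /\ b <= r / 2, D a = eta, D b = eta &
        forall t, `|t| <= r -> (D t <= eta <-> a <= t <= b)] &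
      forall t s, `|t| <= r -> `|s| <= lam * `|t| -> D s <= D t].
Proof.
move=> A0 A'0 lam0 lam1 r0 eta0 eta_small C0 Cr up low scal.
have nn (t : R) : `|t| <= r -> 0 <= D t.
  by move=> h; rewrite -(pmulr_rge0 _ A'0); apply: le_trans (low t h).
have D0 : D 0 = 0.
  have h : `|0 : R| <= r by rewrite normr0 ltW.
  by apply/le_anti; rewrite nn // andbT; have := up 0 h; rewrite normr0 mulr0.
have Ct (t : R) : `|t| <= r -> 0 <= C * `|t| <= (1 - lam) / 4.
  move=> h; rewrite mulr_ge0 //=; apply: le_trans Cr; exact: ler_wpM2l.
have half (sgn : R) : `|sgn| = 1 -> exists b, [/\ 0 < b <= r / 2, D (sgn * b) = eta &
    forall s, 0 <= s <= r -> (D (sgn * s) <= eta <-> s <= b)].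
  move=> sgn1; have ns (s : R) : 0 <= s -> `|sgn * s| = s by move=> h; rewrite normrM sgn1 mul1r ger0_norm.
  apply: (@threshold_radius R (fun s => D (sgn * s)) r eta) => //.
  - move=> s mu /andP[s0 sr] /andP[mu0 mu1].
    have sn := ns s (ltW s0).
    have ms : mu * s <= r.
      apply: le_trans sr; apply: ler_piMl; exact: ltW.
    have n1 : `|mu * (sgn * s)| <= r by rewrite mulrCA ns ?mulr_ge0 // ltW.
    have l1 : 0 < `|sgn * s| by rewrite sn.
    have l2 : `|sgn * s| <= r by rewrite sn.
    have l3 : -1 <= mu by lra.
    have l4 : mu <= 2 by lra.
    have := scal (sgn * s) mu l1 l2 l3 l4 n1; rewrite [mu * (sgn * s)]mulrCA => /le_lt_trans; apply.
    have Dp : 0 < D (sgn * s) by rewrite -(pmulr_rgt0 _ A'0); exact: lt_le_trans l1 (low (sgn * s) l2).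
    rewrite gtr_pMl // ger0_norm // (@ger0_norm _ (1 - mu)); last by lra.
    have /andP[c1 c2] := Ct (sgn * s) l2.
    have l5 : 0 <= 1 - mu by lra.
    have := ler_wpM2r l5 c2; move: mu1 lam0 lam1; nra.
  - move=> s mu /andP[s0 sr] /andP[mu1 mu2] ms.
    have mu0 : 0 <= mu by lra.
    have sn := ns s (ltW s0).
    have n1 : `|mu * (sgn * s)| <= r by rewrite mulrCA ns ?mulr_ge0 // ltW.
    have l1 : 0 < `|sgn * s| by rewrite sn.
    have l2 : `|sgn * s| <= r by rewrite sn.
    have l3 : -1 <= mu by lra.
    have := scal (sgn * s) mu l1 l2 l3 mu2 n1; rewrite [mu * (sgn * s)]mulrCA => /le_trans; apply.
    apply: ler_wpM2r; first exact: nn.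
    rewrite ger0_norm // distrC (@ger0_norm _ (mu - 1)); last by lra.
    have /andP[c1 c2] := Ct (sgn * s) l2.
    have l5 : 0 <= mu - 1 by lra.
    have := ler_wpM2r l5 c2; move: l5 lam0 lam1; nra.
  - move=> s /andP[s0 sr] Ds.
    have l2 : `|sgn * s| <= r by rewrite ns.
    have := low (sgn * s) l2; rewrite ns // => /le_trans; apply; apply: le_trans eta_small.
    exact: ler_wpM2l (ltW A'0) _ _ Ds.
  - by rewrite mulr0 D0.
  - exists (Num.min r (eta / A)); first by rewrite lt_min r0 divr_gt0 //= ge_min lexx.
    have s0 : 0 <= Num.min r (eta / A) by rewrite le_min ltW //= divr_ge0 // ltW.
    apply: le_trans (up _ _) _; first by rewrite ns // ge_min lexx.
    by rewrite ns // mulrC -ler_pdivlMr // ge_min lexx orbT.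
have [b [/andP[b0 br] Db bE]] := half 1 (normr1 _).
have [a [/andP[a0 ar] Da aE]] := half (-1) (normrN1 _).
split.
  exists (- a), b; split.
  - by rewrite oppr_lt0 a0 b0.
  - by rewrite lerN2.
  - by rewrite -mulN1r.
  - by rewrite -[b]mul1r.
  move=> t ht; have [t0|t0] := leP 0 t.
    have H : 0 <= t <= r by rewrite t0 -(ger0_norm t0).
    have := bE t H; rewrite mul1r => ->; split=> [->|/andP[]//]; rewrite andbT; lra.
  have H : 0 <= - t <= r by rewrite -(ltr0_norm t0) ht normr_ge0.
  have := aE (- t) H; rewrite mulN1r opprK => ->; split=> [h|/andP[h _]]; last lra.
  by apply/andP; split; lra.
move=> t s ht hs; have [t0|t0] := eqVneq t 0.
  by move: hs; rewrite t0 normr0 mulr0 normr_le0 => /eqP->.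
have tp : 0 < `|t| by rewrite normr_gt0.
have smu : `|s / t| <= lam by rewrite normrM normfV ler_pdivrMr.
have := smu; rewrite ler_norml => /andP[m1 m2].
have sE : s / t * t = s by rewrite divfK.
have sr : `|s / t * t| <= r.
  rewrite sE; apply: le_trans hs _; apply: le_trans ht; apply: ler_piMl => //; exact: ltW.
have l3 : -1 <= s / t by lra.
have l4 : s / t <= 2 by lra.
have := scal t (s / t) tp ht l3 l4 sr; rewrite sE => /le_trans; apply.
apply: ler_piMl; first exact: nn.
have /andP[c1 c2] := Ct t ht.
have d2 : `|1 - s / t| <= 2 by rewrite ler_norml; lra.
have := ler_wpM2l c1 d2; lra.
Qed.

End SublevelInterval.

Lemma pos_below_both {R : realType} (x y : R) : 0 < x -> 0 < y ->
  exists z, [/\ 0 < z, z <= x & z <= y].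
Proof.
move=> x0 y0; exists (Num.min x y); split.
- by rewrite lt_min x0.
- by rewrite ge_min lexx.
- by rewrite ge_min lexx orbT.
Qed.

(** * Choice of eta and the four properties *)

Theorem mainTheorem1 (R : realType) (M : topologicalType) (S : surface R M)
    (g : riemannian_metric S) (phi : M -> M) (p : M) (ls lu : R)
    (phi_C2 : Ck_diffeomorphism S 2 phi)
    (p_hyp : hyperbolic_fixed_point S phi p)
    (ls_eig : eigenvalue (tangent_map S phi p) ls)
    (lu_eig : eigenvalue (tangent_map S phi p) lu)
    (ls_gt0 : 0 < `|ls|) (ls_lt1 : `|ls| < 1) (lu_gt1 : 1 < `|lu|) :
  exists eta : R, 0 < eta /\
    let W := local_stable_set g phi p eta in
    let d := riemannian_dist g in
    [/\ (* (1) and (2), [c] being a parametrization of W with c(t0) = p *)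
        exists (c : R -> M) (a b t0 : R),
          [/\ C1Lip_arc S c a b,
              W = [set c t | t in `[a, b]],
              t0 \in `[a, b] /\ c t0 = p,
              (velocity S c t0 <= eigenspace (tangent_map S phi p) ls)%MS &
              (eta%:E <= curve_length g c a t0)%E /\
              (eta%:E <= curve_length g c t0 b)%E],
        (* (3) *)
        exists C lambda : R, [/\ 0 < C, 0 < lambda, lambda < 1 &
          forall x y : M, W x -> W y -> forall k : nat,
            (d (iter k phi x) (iter k phi y)
               <= (C * lambda ^+ k)%:E * d x y)%E] &
        (* (4) *)
        W = \bigcap_(k in [set: nat]) orbit_nbhd g phi p eta k].
Proof.
have [pp _] := p_hyp; have [phi' [_ _ Cphi _]] := phi_C2.
set i := chart_at S p; have dp : dom i p := dom_chart_at S p.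
pose z0 := chart i p.
have AE : tangent_map S phi p = jacobian (chart i \o phi \o chart_inv i) z0.
  by rewrite /tangent_map pp.
have [rg [L [rg0 L1 rgU conf [low up push]]]] := local_geometry g dp.
have := local_stable_curve Cphi dp pp; rewrite /= -/z0 -AE.
move=> /(_ ls lu ls_eig lu_eig ls_gt0 ls_lt1 lu_gt1).
move=> [vs [vu [Lc [lam [r0 [vsA transv [lam0 lam1 r00 Lc0] H]]]]]].
have vsE : (vs <= eigenspace (tangent_map S phi p) ls)%MS by apply/eigenspaceP.
(* [vsE] stays in the goal, as [done] would try to reduce the matrices it contains. *)
move: vsE; clear p_hyp ls_eig lu_eig vsA AE.
pose nv := `|vs| + `|vu| + 1.
have nv0 : 0 < nv by rewrite /nv ltr_wpDl // addr_ge0.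
have [r [rp rr0]] := pos_below_both r00 (divr_gt0 rg0 nv0).
rewrite (ler_pdivlMr _ _ nv0) => rnv.
have [sg [m [f [C [C0 [sg0 m0] sgf [f0 inv] char]]]]] := H r rp rr0.
have sgq x x' (hx : `|x| <= r) (hx' : `|x'| <= r) := (sgf x x' hx hx').1.
have fl x x' (hx : `|x| <= r) (hx' : `|x'| <= r) := (sgf x x' hx hx').2.
pose W := graph_pt vs vu sg; pose c := graph_curve i z0 vs vu sg.
have W0 : W 0 = 0 by rewrite /W /graph_pt sg0 !scale0r addr0.
have c0 : c 0 = p by rewrite /c /graph_curve -/(W 0) W0 addr0 /z0 chartK.
have Wr t : `|t| <= r -> `|W t| <= rg.
  move=> ht; apply: le_trans (ler_normD _ _) _; rewrite !normrZ.
  have h1 := ler_wpM2r (normr_ge0 vs) ht.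
  have h2 := ler_wpM2r (normr_ge0 vu) (inv t ht).1.
  by move: rnv; rewrite /nv; move: rp; lra.
have L0 : 0 < L by exact: lt_le_trans L1.
have zr : `|0 : R| <= r by rewrite normr0 ltW.
have [C3 [r1 [C30 r10 r1r scal]]] :=
  graph_dist_scaling C0 rp sgq sg0 m0 L1 Lc0 transv Wr push.
pose B := `|vs| + (2 * C * r + 2 * r * C) * `|vu|.
have B0 : 0 <= B.
  by rewrite addr_ge0 // mulr_ge0 // addr_ge0 // !mulr_ge0 // ltW.
have WL t t' : `|t| <= r -> `|t'| <= r -> `|W t' - W t| <= B * `|t' - t|.
  move=> ht ht'; apply: (graph_pt_lipschitz vs vu C0 sgq) => //.
  have := slope_lipschitz sgq ht zr; rewrite m0 !subr0 => /le_trans; apply.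
  by apply: ler_wpM2l => //; exact: mulr_ge0.
pose d := riemannian_dist g.
(* Along the curve, d and the parameter distance are comparable with these constants; the summand 1
   keeps [A] positive. *)
pose A := L * B + 1; pose A' := Lc * L.
have A0 : 0 < A by rewrite ltr_wpDl // mulr_ge0 // ltW.
have A'0 : 0 < A' by exact: mulr_gt0.
have dup t t' : `|t| <= r -> `|t'| <= r -> (d (c t) (c t') <= (A * `|t' - t|)%:E)%E.
  move=> ht ht'; apply: le_trans (up _ _ (Wr t ht) (Wr t' ht')) _; rewrite lee_fin.
  apply: le_trans (ler_wpM2l (ltW L0) (WL t t' ht ht')) _.
  by rewrite mulrA; apply: ler_wpM2r => //; rewrite lerDl.
have dlow t t' : `|t| <= r -> `|t'| <= r -> (`|t' - t|%:E <= A'%:E * d (c t) (c t'))%E.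
  move=> ht ht'; have := low _ _ (Wr t ht) (Wr t' ht').
  have Lc0' : (0 <= Lc%:E)%E by rewrite lee_fin ltW.
  move=> /(lee_wpmul2l Lc0'); rewrite muleA -!EFinM -/A'; apply: le_trans; rewrite lee_fin.
  have -> : W t' - W t = (t' - t) *: vs + (sg t' - sg t) *: vu.
    by rewrite /W /graph_pt opprD addrACA -!scalerBl.
  exact: transv.
pose D t := fine (d (c t) p).
have dE t : `|t| <= r -> d (c t) p = (D t)%:E.
  move=> ht; rewrite fineK // ge0_fin_numE; last exact: dist_ge0.
  by have := dup t 0 ht zr; rewrite c0 => /le_lt_trans; apply; rewrite ltry.
have Dup t : `|t| <= r -> D t <= A * `|t|.
  by move=> ht; have := dup t 0 ht zr; rewrite c0 dE // sub0r normrN lee_fin.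
have Dlow t : `|t| <= r -> `|t| <= A' * D t.
  by move=> ht; have := dlow t 0 ht zr; rewrite c0 dE // sub0r normrN -EFinM lee_fin.
have C31 : 0 < 4 * (C3 + 1) by rewrite mulr_gt0 // ltr_wpDl.
have lam1' : 0 < 1 - lam by rewrite subr_gt0.
(* Half of [r1] keeps the arc strictly inside the domain |t| < r; the other bound gives C3 * r2 <=
   (1 - lam)/4. *)
have [r2 [r20 r2r1]] := pos_below_both (divr_gt0 r10 (ltr0n R 2)) (divr_gt0 lam1' C31).
rewrite (ler_pdivlMr _ _ C31) => r2C3.
have r2r (t : R) : `|t| <= r2 -> `|t| < r by move: r2r1 r1r r10; lra.
have r2r' (t : R) (h : `|t| <= r2) := ltW (r2r t h).
have C3r2 : C3 * r2 <= (1 - lam) / 4 by lra.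
have A'2 : 0 < 2 * A' by rewrite mulr_gt0.
(* eta <= rg allows [conf] to place eta-close points in the chart; A' * eta <= r2/2 makes them close
   enough for [char] and keeps their parameters within r2/2. *)
have [eta [eta0 eta_rg]] := pos_below_both rg0 (divr_gt0 r20 A'2).
rewrite (ler_pdivlMr _ _ A'2) => eta_r2.
have A'eta : A' * eta <= r2 / 2 by lra.
have [|[a [b [/andP[a0 b0] [ar br] Da Db Dab]]] Dmono] :=
  @sublevel_interval R D A A' _ _ _ _ A0 A'0 lam0 lam1 r20 eta0 A'eta C30 C3r2
    (fun t h => Dup t (r2r' t h)) (fun t h => Dlow t (r2r' t h)).
  move=> t mu t0 tr2 mu1 mu2 hmt.
  have tr1 : `|t| <= r1 by lra.
  have := scal t mu t0 tr1 mu1 mu2 (r2r' _ hmt).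
  rewrite -[chart_inv _ _]/(c (mu * t)) -[chart_inv _ (_ + graph_pt _ _ _ t)]/(c t) -/d.
  by rewrite (dE _ (r2r' _ hmt)) (dE _ (r2r' _ tr2)) -EFinM lee_fin.
have abr (t : R) : a <= t <= b -> `|t| <= r2.
  by move=> /andP[h1 h2]; rewrite ler_norml; lra.
have fr n t t' : `|t| <= r -> `|t'| <= r ->
    [/\ `|iter n f t| <= r, `|iter n f t'| <= r & `|iter n f t' - iter n f t| <= lam ^+ n * `|t' - t|].
  move=> ht ht'; have f_in (x : R) : `|x| <= r -> `|f x| <= r.
    move=> hx; have := fl 0 x zr hx; rewrite f0 !subr0 => /le_trans; apply.
    by apply: le_trans hx; apply: ler_piMl => //; exact: ltW.
  elim: n => [|n [h1 h2 h3]]; first by rewrite expr0 mul1r.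
  split; [exact: f_in | exact: f_in |].
  rewrite exprS -mulrA; apply: le_trans (fl _ _ h1 h2) _.
  by apply: ler_wpM2l => //; exact: ltW.
have orb n t : `|t| <= r -> iter n phi (c t) = c (iter n f t).
  move=> ht; elim: n => //= n ->; have [h _ _] := fr n t t ht ht.
  exact: (inv _ h).2.
have fdec n t : `|t| <= r -> `|iter n f t| <= lam ^+ n * `|t|.
  move=> ht; have [_ _] := fr n 0 t zr ht.
  have -> : iter n f 0 = 0 by elim: n => //= n ->.
  by rewrite !subr0.
have arcN t : a <= t <= b -> forall n, (d (iter n phi (c t)) p <= eta%:E)%E.
  move=> hab n; have tr2 := abr t hab; have tr := r2r' t tr2.
  have [h1 _ _] := fr n t t tr tr.
  rewrite orb // dE // lee_fin; apply: le_trans _ ((Dab t tr2).2 hab).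
  (* [Dmono] compares D only with parameters shrunk by lam or more, which holds from time 1 on. *)
  case: n h1 => [//|n] h1; apply: Dmono => //.
  apply: le_trans (fdec n.+1 t tr) _; apply: ler_wpM2r => //.
  by rewrite exprS; apply: ler_piMr; [exact: ltW | rewrite exprn_ile1 // ltW].
have Narc q : (forall n, (d (iter n phi q) p <= eta%:E)%E) -> exists2 t, a <= t <= b & q = c t.
  move=> Hq; have [n|x hx qx] := char q.
    have [h1 h2] := conf _ eta eta0 eta_rg (Hq n); split=> //.
    apply: le_trans (ler_wpM2l (ltW Lc0) h2) _.
    by rewrite mulrA -/A'; move: A'eta r2r1 r1r r20; lra.
  exists x => //; have := Hq 0%N; rewrite /= qx -[chart_inv _ _]/(c x) dE // lee_fin => hD.
  have h1 := Dlow x hx; have h2 := ler_wpM2l (ltW A'0) hD.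
  by apply/Dab => //; move: A'eta r20; lra.
have stab t : a <= t <= b -> global_stable_set g phi p (c t).
  move=> hab; have tr := r2r' t (abr t hab); rewrite /global_stable_set /=.
  apply: (@squeeze_cvge _ _ _ _ (cst 0%E) _ (fun k : nat => (A * `|t| * lam ^+ k)%:E)).
  - near=> k; rewrite /cst dist_ge0 /=; have [h1 _ _] := fr k t t tr tr.
    rewrite orb // -/d dE // lee_fin; apply: le_trans (Dup _ h1) _.
    by rewrite -mulrA [`|t| * _]mulrC; apply: ler_wpM2l (fdec k t tr); exact: ltW.
  - exact: cvg_cst.
  - apply: cvg_EFin; first by near=> k.
    rewrite -[X in _ --> X](mulr0 (A * `|t|)); apply: cvgMl_tmp.
    by apply: cvg_expr; rewrite ger0_norm // ltW.
have WE : local_stable_set g phi p eta = [set c t | t in `[a, b]].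
  apply/seteqP; split=> [q [_ Hq]|q [t] /=].
    (* [orbit_nbhd] at k tests the times j < k, so time n is read off at k = n + 1. *)
    have [n|t hab ->] := Narc q; first exact: (Hq n.+1).
    by exists t => //=; rewrite in_itv.
  by rewrite in_itv /= => hab <-; split; [exact: stab | move=> k _ j _; exact: arcN].
have oU := @open_graph_domain R r.
have ballU t : `|t| < r -> (chart i @` dom i) (z0 + graph_pt vs vu sg t).
  by move=> ht; apply: rgU; apply: Wr; exact: ltW.
have arc1 := graph_curve_C1_curve C0 sgq ballU.
have abU t : a <= t <= b -> `|t| < r by move=> /abr /r2r.
have ra : - r < a by move: ar r2r1 r1r r20; lra.
have br' : b < r by move: br r2r1 r1r r20; lra.
have r0' : 0 < r by [].
have velo t : `|t| < r -> velocity S c t != 0.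
  move=> ht; apply/eqP => v0; have di := dom_graph_curve ballU ht.
  have := derive1_chart_change oU arc1 ht (dom_chart_at S (c t)) di.
  rewrite -[derive1 (_ (chart_at _ (c t)) \o _) _]/(velocity S c t) v0 mul0mx.
  rewrite (derive1_graph_curve C0 sgq ballU ht) => e0; have := transv 1 (m t).
  by rewrite scale1r e0 !normr0 mulr0 normr1 ler10.
have velo0 : velocity S c 0 = vs.
  have h0 : `|0 : R| < r by rewrite normr0.
  by rewrite /velocity c0 -/i (derive1_graph_curve C0 sgq ballU h0) m0 scale0r addr0.
have inj t t' : `|t| <= r -> `|t'| <= r -> c t = c t' -> t = t'.
  (* If c(t) = c(t'), then d(c(t), c(t')) <= 0 by [dup] at t and t, and [dlow] forces t = t'. *)
  move=> ht ht' e; have := dup t t ht ht; rewrite subrr normr0 mulr0 {2}e => h.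
  have A'0' : (0 <= A'%:E)%E by rewrite lee_fin ltW.
  have := le_trans (dlow t t' ht ht') (lee_wpmul2l A'0' h).
  by rewrite mule0 lee_fin normr_le0 subr_eq0 => /eqP.
have contr x y : local_stable_set g phi p eta x -> local_stable_set g phi p eta y ->
    forall k, (d (iter k phi x) (iter k phi y) <= (A * A' * lam ^+ k)%:E * d x y)%E.
  rewrite WE => -[t /=]; rewrite in_itv /= => /abr /r2r' ht <- [t' /=].
  rewrite in_itv /= => /abr /r2r' ht' <- k; rewrite !orb //.
  have [h1 h2 h3] := fr k t t' ht ht'; apply: le_trans (dup _ _ h1 h2) _.
  have Al0 : 0 <= A * lam ^+ k by rewrite mulr_ge0 ?exprn_ge0 // ltW.
  have Al0' : (0 <= (A * lam ^+ k)%:E)%E by rewrite lee_fin.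
  have -> : A * A' * lam ^+ k = A * lam ^+ k * A' by ring.
  rewrite [(_ * A')%:E]EFinM -muleA.
  apply: le_trans (lee_wpmul2l Al0' (dlow t t' ht ht')).
  by rewrite -EFinM lee_fin -mulrA; apply: ler_wpM2l => //; exact: ltW.
move=> vsE; exists eta; split=> //=; split.
- exists c, a, b, 0; split=> //.
  + split.
    * exact: lt_trans b0.
    * exists [set x | `|x| < r]; split.
      - exact: oU.
      - by move=> x /=; rewrite in_itv /= => /abU.
      - exact: (graph_curve_C1Lip C0 sgq ballU).
    * move=> t; rewrite in_itv /= => /abU ht; exact: velo.
    * move=> t t'; rewrite !in_itv /= => /abU /ltW ht /abU /ltW ht'; exact: inj.
  + by rewrite in_itv /= (ltW a0) (ltW b0).
  + by rewrite velo0.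
  + split.
    * rewrite -Da -dE; last by apply/ltW/abU; rewrite lexx (ltW (lt_trans a0 b0)).
      by rewrite -c0; apply: (dist_le_graph_length g C0 sgq ballU).
    * rewrite -Db -dE; last by apply/ltW/abU; rewrite lexx (ltW (lt_trans a0 b0)).
      by rewrite -c0; apply: (dist_le_graph_length_rev g C0 sgq ballU).
- exists (A * A'), lam; split=> //; exact: mulr_gt0.
- rewrite WE; apply/seteqP; split=> [q [t] /=|q Hq].
    by rewrite in_itv /= => hab <- k _ j _; exact: arcN.
  have [n|t hab ->] := Narc q; first exact: (Hq n.+1).
  by exists t => //=; rewrite in_itv.
Unshelve. all: by end_near. Qed.
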